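(* Let $(S^7,\omega,g)$ be the seven-sphere with its standard nearly-parallel $G_2$-structure induced by the octonions in $\mathbb R^8$ (as a totally umbilical hypersurface of $\mathbb R^8$), so that $d\omega=-\lambda\,{*\omega}$ with $\lambda$ a non-zero constant, and let $\nabla$ be its $G_2$-connection with torsion 3-form. The nearly-parallel 7-sphere solves the gravitino equation, the gaugino equation with $F^A=R^\nabla$, and satisfies the Bianchi identities (B1) and (B2) with negative $\alpha'$. Consequently, the product $(S^7\times\mathbb R,\ \Phi,\ A=\nabla^8)$ with the $Spin(7)$-structure $\Phi=e_0\wedge\omega+{*\omega}$, $e_0$ the standard 1-form on $\mathbb R$, solves the supersymmetry equations (gravitino, dilatino, gaugino) with non-zero flux and non-constant dilaton and satisfies (B1), (B2). Therefore it solves the equations of motion in dimension 8. The product $(S^7\times S^1,\Phi,A=\nabla^8)$ is a compact space solving locally the supersymmetry equations and satisfying (B1), (B2) in dimension 8.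
   Context: **Dimension 7.** A $G_2$-structure is a 3-form locally equal to $\omega=e_{127}-e_{236}+e_{347}+e_{567}-e_{146}-e_{245}+e_{135}$ in an oriented orthonormal coframe ($e_{ij\dots}=e_i\wedge e_j\wedge\cdots$; this fixes metric, orientation $e_{1\dots7}$ and Hodge star). The $G_2$-connection with torsion 3-form is $\nabla=\nabla^g+\frac12T$ (i.e. $g(\nabla_XY,Z)=g(\nabla^g_XY,Z)+\frac12T(X,Y,Z)$), $T$ a 3-form, with $\nabla\omega=0$; it is unique and exists for nearly-parallel structures. **Dimension 8.** A $Spin(7)$-structure is a 4-form locally of the form $e_0\wedge\omega+{*^7\omega}$, with $\omega=e_{127}-e_{236}+e_{347}+e_{567}-e_{146}-e_{245}+e_{135}$ and ${*^7\omega}=e_{3456}+e_{1457}+e_{1256}+e_{1234}+e_{2357}+e_{1367}-e_{2467}$, in an oriented orthonormal coframe $e_0,\dots,e_7$. Lee form $\theta^8=-\frac17{*({*d\Phi}\wedge\Phi)}$. $\nabla^8=\nabla^g+\frac12T^8$ is the unique connection with torsion 3-form and $\nabla^8\Phi=0$. Dilaton: $\theta^8=\frac{12}7d\phi$. **Supersymmetry equations** (flux $H=T$, dilaton $\phi$, gauge connection $A$ with curvature $F^A$, Clifford relation $e_me_n+e_ne_m=-2\delta_{mn}$, $\varepsilon$ the nowhere zero spinor defining the structure): gravitino $\nabla^g_m\varepsilon+\frac18H_{mnp}e_ne_p\varepsilon=0$; dilatino $(\partial_m\phi\,e_m+\frac1{12}H_{mnp}e_me_ne_p)\varepsilon=0$;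 gaugino $F^A_{mn}e_me_n\varepsilon=0$ (the 2-form part of $F^A$ lies in $g_2$, $spin(7)$ respectively). ''Solving locally'' means that the Lee form is closed, so that $\phi$ is only a locally defined function. **Bianchi identities**, with $\tilde\nabla=\nabla^g-\frac12T$ and $T$ the torsion of $\nabla$: (B1) $dT=2\alpha'\,\mathrm{Tr}(F^A\wedge F^A)$; (B2) $dT=2\alpha'\big(\mathrm{Tr}(F^A\wedge F^A)-\mathrm{Tr}(R^{\tilde\nabla}\wedge R^{\tilde\nabla})\big)$. For a metric connection with curvature 2-forms $\Omega_{ab}=g(R(\cdot,\cdot)e_a,e_b)$, $\mathrm{Tr}(R\wedge R)=\sum_{a<b}\Omega_{ab}\wedge\Omega_{ab}$. ''Satisfies with negative $\alpha'$'' means that (B1) holds for some constant $\alpha'<0$ and (B2) holds for some constant $\alpha'<0$ (possibly a different one); equivalently, for a prescribed $\alpha'<0$ each identity is achieved after a constant homothetic rescaling of the structure. **Equations of motion** (for $H=T$, $A=\nabla$, and the constant $\alpha'$ of (B1)): $\mathrm{Ric}_{mn}-\frac14H_{mpq}H_n{}^{pq}+2\nabla^g_m\nabla^g_n\phi+2\alpha'\,\mathrm{Tr}(F^A_{mp}F^A_n{}^p)=0$; $\nabla^{g,m}(e^{-2\phi}H_{mnp})=0$; $D^m(e^{-2\phi}F^A_{mn})+\frac12e^{-2\phi}H_{npq}F^{A\,pq}=0$ ($D$ = Levi-Civita on form indices coupled to $A$); $s^g+4\,\mathrm{div}\,\mathrm{grad}\,\phi-4\|d\phi\|^2-\frac1{12}H_{mnp}H^{mnp}+\alpha'\,\mathrm{Tr}(F^A_{mn}F^{A\,mn})=0$,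 with $\mathrm{Tr}(F_{mp}F_{nq})=\sum_{a<b}(F_{mp})_{ab}(F_{nq})_{ab}$. *)

(* Defs.v *)
From HB Require Import structures.
From mathcomp Require Import all_boot all_order all_algebra all_fingroup.
From mathcomp Require Import all_classical all_reals all_analysis.
From mathcomp Require Import ring lra.

Set Implicit Arguments.
Unset Strict Implicit.
Unset Printing Implicit Defensive.

Import Order.TTheory GRing.Theory Num.Theory.
Import numFieldNormedType.Exports.

Local Open Scope classical_set_scope.
Local Open Scope ring_scope.

Fixpoint ninv (s : seq nat) : nat :=
  if s is x :: s' then (count (fun y => y < x)%N s' + ninv s')%N else 0%N.

(* [mono J I] is e_J(e_{I_1}, ..., e_{I_k}) for a duplicate-free J: the sign of
   the permutation taking J to I, and 0 when there is none.                   *)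
Definition mono (J I : seq nat) : int :=
  if perm_eq I J then (-1) ^+ ninv [seq index i J | i <- I] else 0.

Definition altform (l : seq (int * seq nat)) (I : seq nat) : int :=
  foldr (fun t s => t.1 * mono t.2 I + s) 0 l.

Definition omega_table : seq (int * seq nat) :=
  [:: (1, [:: 1; 2; 7]%N); (- 1, [:: 2; 3; 6]%N); (1, [:: 3; 4; 7]%N);
      (1, [:: 5; 6; 7]%N); (- 1, [:: 1; 4; 6]%N); (- 1, [:: 2; 4; 5]%N);
      (1, [:: 1; 3; 5]%N)].

Definition staromega_table : seq (int * seq nat) :=
  [:: (1, [:: 3; 4; 5; 6]%N); (1, [:: 1; 4; 5; 7]%N); (1, [:: 1; 2; 5; 6]%N);
      (1, [:: 1; 2; 3; 4]%N); (1, [:: 2; 3; 5; 7]%N); (1, [:: 1; 3; 6; 7]%N);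
      (- 1, [:: 2; 4; 6; 7]%N)].

(* Labels 1..7 in dimension 7 (the element i of 'I_7 stands for e_(i+1)) and
   0..7 in dimension 8 (the element i of 'I_8 stands for e_i).                *)
Definition omega0 (I : seq 'I_7) : int :=
  altform omega_table [seq (nat_of_ord i).+1 | i <- I].

Definition Phi0 (I : seq 'I_8) : int :=
  altform ([seq (t.1, 0%N :: t.2) | t <- omega_table] ++ staromega_table)
          [seq nat_of_ord i | i <- I].

(* The coefficient of e_c in the product e_a e_b of octonions, R^8 having the
   basis e_0 = 1, e_1, ..., e_7 and
   e_i e_j = - delta_ij + sum_k omega_ijk e_k for i, j, k > 0.                *)
Definition oct (a b c : nat) : int :=
  if a == 0%N then (b == c)%:R else
  if b == 0%N then (a == c)%:R else
  if c == 0%N then - (a == b)%:R else altform omega_table [:: a; b; c].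

Definition octL (R : realType) (a : 'I_8) : 'M[R]_8 :=
  \matrix_(c, b) (oct a b c)%:~R.

Definition smooth_on (R : realType) (V W : normedModType R) (U : set V)
    (f : V -> W) : Prop :=
  forall (vs : seq V) (x : V), U x ->
    differentiable (foldr (fun v g => 'D_v g) f vs) x.

(* Functions on a subset D of V, such as a submanifold, are represented by
   functions on V whose values off D are irrelevant; they are smooth on D when
   the representative is smooth on some open neighbourhood of D.  Only
   derivatives at points of D in directions tangent to D are ever taken, and
   those of a smooth representative depend only on the values on D.           *)
Definition smooth_near (R : realType) (V W : normedModType R) (D : set V)
    (f : V -> W) : Prop :=
  exists U : set V, [/\ open U, D `<=` U & smooth_on U f].

(* An n-dimensional submanifold [pts] of a vector space V with inner product
   [ip], together with tangent vector fields [fr i] which form, at each of its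
   points, an orthonormal basis of its tangent space.  It carries the induced
   metric and the orientation given by the frame.                             *)
Record framed (R : realType) (V : normedModType R) (n : nat) := Framed {
  pts : set V ;
  fr : 'I_n -> V -> V ;
  ip : V -> V -> R }.

(* The components of a form with respect to the frame: a k-form a is given by
   the functions a [:: i_1; ...; i_k] = a(e_{i_1}, ..., e_{i_k}); its values on
   lists of other lengths are irrelevant.                                     *)
Definition dform (R : realType) (V : normedModType R) (n : nat) : Type :=
  seq 'I_n -> V -> R.

Definition form_eq (R : realType) (V : normedModType R) (n : nat) (D : set V)
    (k : nat) (a b : dform V n) : Prop :=
  forall (x : V) (I : seq 'I_n), D x -> size I = k -> a I x = b I x.

Definition smooth_form (R : realType) (V : normedModType R) (n : nat)
    (D : set V) (k : nat) (a : dform V n) : Prop :=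
  (forall I : seq 'I_n, size I = k -> smooth_near D (a I)) /\
  (forall (x : V) (I : k.-tuple 'I_n) (s : 'S_k), D x ->
     a [seq tnth I (s i) | i <- enum 'I_k] x = (-1) ^+ s * a I x).

Definition del (T : Type) (k : nat) (s : seq T) : seq T :=
  take k s ++ drop k.+1 s.

(* (a /\ b)(v_1, ..., v_(p+q)) is the sum over all permutations s of
   sgn(s) a(v_s(1), ..., v_s(p)) b(v_s(p+1), ..., v_s(p+q)) / (p! q!),
   for a p-form a and a q-form b.                                             *)
Definition wedge (R : realType) (V : normedModType R) (n : nat) (p : nat)
    (a b : dform V n) : dform V n := fun I x =>
  ((p`! * (size I - p)`!)%:R)^-1 *
  \sum_(s : 'S_(size I))
    (-1) ^+ s *
    (let J := [seq tnth (in_tuple I) (s k) | k <- enum 'I_(size I)] in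
     a (take p J) x * b (drop p J) x).

(* Hodge star of a k-form, for the orientation e_1 /\ ... /\ e_n: *e_J is the
   e_I, up to sign, with e_J /\ *e_J the volume form.                         *)
Definition star (R : realType) (V : normedModType R) (n : nat) (k : nat)
    (a : dform V n) : dform V n := fun I x =>
  (k`!%:R)^-1 *
  \sum_(J : k.-tuple 'I_n)
    (mono (iota 0 n) [seq nat_of_ord i | i <- J ++ I])%:~R * a J x.

Section Geometry.
Variables (R : realType) (V : normedModType R) (n : nat) (M : framed V n).
Implicit Types (x : V) (D : set V).

Definition lie (i j : 'I_n) x : V :=
  'D_(fr M i x) (fr M j) x - 'D_(fr M j x) (fr M i) x.

Definition struct (i j k : 'I_n) x : R := ip M (lie i j x) (fr M k x).

(* Cartan's formula: (da)(X_0, ..., X_k) is the sum over j of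
   (-1)^j X_j (a(.. omit X_j ..)) plus the sum over j < l of
   (-1)^(j+l) a([X_j, X_l], .. omit X_j, X_l ..).                             *)
Definition extd (a : dform V n) : dform V n := fun I x =>
  let X := tnth (in_tuple I) in
  \sum_(j < size I) (-1) ^+ j * 'D_(fr M (X j) x) (a (del j I)) x
  + \sum_(j < size I) \sum_(l < size I | (j < l)%N)
      (-1) ^+ (j + l) *
      \sum_p struct (X j) (X l) p x * a (p :: del j (del l I)) x.

Definition dfun (f : V -> R) : dform V n := extd (fun _ => f).

(* A metric connection is given by G i j k = g(nabla_{e_i} e_j, e_k). *)
Definition connection : Type := 'I_n -> 'I_n -> 'I_n -> V -> R.

(* Levi-Civita connection: Koszul's formula in an orthonormal frame. *)
Definition lc : connection := fun i j k x =>
  2^-1 * (struct i j k x - struct j k i x + struct k i j x).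

Lemma lc_metric_torsion_free i j k x :
  (forall u v, ip M (- u) v = - ip M u v) ->
  lc i j k x = - lc i k j x /\ lc i j k x - lc j i k x = struct i j k x.
Proof.
move=> ipN.
have sC p q l : struct p q l x = - struct q p l x.
  by rewrite /struct -ipN /lie opprB.
rewrite /lc (sC i k) (sC k j) (sC j i); split; last by rewrite (sC k i); field.
by ring.
Qed.

Definition tconn (T : dform V n) : connection := fun i j k x =>
  lc i j k x + 2^-1 * T [:: i; j; k] x.

Definition cov (G : connection) (m : 'I_n) (a : dform V n) : dform V n := fun I x =>
  'D_(fr M m x) (a I) x
  - \sum_(k < size I) \sum_p
      G m (tnth (in_tuple I) k) p x * a (set_nth p I k p) x.

Definition parallel D (k : nat) (G : connection) (a : dform V n) : Prop :=
  forall m, form_eq D k (cov G m a) (fun _ _ => 0).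

(* T is the torsion 3-form of the unique connection nabla with torsion a 3-form
   such that the k-form a is nabla-parallel.                                  *)
Definition characteristic_torsion D (k : nat) (a T : dform V n) : Prop :=
  [/\ smooth_form D 3 T, parallel D k (tconn T) a
    & forall T' : dform V n, smooth_form D 3 T' -> parallel D k (tconn T') a ->
        form_eq D 3 T' T].

(* The curvature of G, F m l a b = g(R(e_m, e_l) e_a, e_b), where
   R(X,Y) = [nabla_X, nabla_Y] - nabla_[X,Y].                                 *)
Definition curv (G : connection) (m l a b : 'I_n) x : R :=
  'D_(fr M m x) (G l a b) x - 'D_(fr M l x) (G m a b) x
  + \sum_p (G l a p x * G m p b x - G m a p x * G l p b x)
  - \sum_p struct m l p x * G p a b x.

(* Near each point of D the k-form a is equal to the constant form std in an
   oriented orthonormal coframe f_i = sum_j A_ij e_j.                         *)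
Definition locally_modelled_on D (k : nat) (std : seq 'I_n -> int)
    (a : dform V n) : Prop :=
  forall x, D x -> exists (U : set V) (A : V -> 'M[R]_n),
    [/\ open U, U x, (forall i j, smooth_on U (fun y => A y i j))
      & forall y, D y -> U y ->
          [/\ A y *m (A y)^T = 1%:M, \det (A y) = 1
            & forall I : k.-tuple 'I_n,
                a I y = \sum_(J : k.-tuple 'I_n)
                  (std J)%:~R * \prod_(l < k) A y (tnth J l) (tnth I l)]].

Definition curvature : Type := 'I_n -> 'I_n -> 'I_n -> 'I_n -> V -> R.

Definition curv2form (F : curvature) (a b : 'I_n) : dform V n := fun I x =>
  if I is [:: m; l] then F m l a b x else 0.

Definition TrFF (F : curvature) : dform V n := fun I x =>
  \sum_(a < n) \sum_(b < n | (a < b)%N)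
    wedge 2 (curv2form F a b) (curv2form F a b) I x.

Definition bianchi1 D (T : dform V n) (F : curvature) (alpha : R) : Prop :=
  form_eq D 4 (extd T) (fun I x => 2 * alpha * TrFF F I x).

Definition bianchi2 D (T : dform V n) (F : curvature) (alpha : R) : Prop :=
  form_eq D 4 (extd T) (fun I x => 2 * alpha *
    (TrFF F I x - TrFF (curv (tconn (fun J y => - T J y))) I x)).

Section Spinors.
(* Spinor fields are vector-valued functions, by means of the trivialization of
   the spinor bundle which the frame provides; [gam i] is the Clifford action
   of e_i.                                                                    *)
Variables (N : nat) (gam : 'I_n -> 'M[R]_N).
Implicit Types (eps : V -> 'cV[R]_N).

Definition cliff2 (B : 'I_n -> 'I_n -> R) : 'M[R]_N :=
  \sum_p \sum_q B p q *: (gam p *m gam q).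

Definition cliff3 (B : 'I_n -> 'I_n -> 'I_n -> R) : 'M[R]_N :=
  \sum_m \sum_p \sum_q B m p q *: (gam m *m gam p *m gam q).

(* eps is nowhere zero and defines the k-form a, namely
   a(e_I) = - <eps, e_{i_1} ... e_{i_k} eps> / <eps, eps> for distinct indices. *)
Definition spinor_defines D (k : nat) (a : dform V n) eps : Prop :=
  smooth_near D eps /\
  forall x, D x -> eps x != 0 /\
    forall I : seq 'I_n, size I = k -> uniq I ->
      a I x * ((eps x)^T *m eps x) 0 0 =
      - ((eps x)^T *m foldr (fun i y => gam i *m y) (eps x) I) 0 0.

Definition spin_cov (m : 'I_n) eps x : 'cV[R]_N :=
  'D_(fr M m x) eps x
  + 4^-1 *: (cliff2 (fun p q => lc m p q x) *m eps x).

Definition gravitino D (H : dform V n) eps : Prop :=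
  forall x m, D x ->
    spin_cov m eps x
    + 8^-1 *: (cliff2 (fun p q => H [:: m; p; q] x) *m eps x) = 0.

Definition dilatino D (H : dform V n) (phi : V -> R) eps : Prop :=
  forall x, D x ->
    (\sum_m 'D_(fr M m x) phi x *: gam m
     + 12^-1 *: cliff3 (fun m p q => H [:: m; p; q] x)) *m eps x = 0.

Definition gaugino D (F : curvature) eps : Prop :=
  forall x a b, D x -> cliff2 (fun m p => F m p a b x) *m eps x = 0.

End Spinors.

(* Tr(F_{m p} F_{l q}) *)
Definition trF (F : curvature) (m p l q : 'I_n) x : R :=
  \sum_(a < n) \sum_(b < n | (a < b)%N) F m p a b x * F l q a b x.

Definition ricci (m l : 'I_n) x : R := \sum_p curv lc p m l p x.

Definition scalar_curv x : R := \sum_m ricci m m x.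

Definition hess (phi : V -> R) (m l : 'I_n) x : R :=
  cov lc m (dfun phi) [:: l] x.

(* D_m B_{pl}: Levi-Civita on the form indices p, l, coupled to the connection A
   on the remaining two.                                                      *)
Definition gauge_cov (A : connection) (m : 'I_n) (B : curvature)
    (p l a b : 'I_n) x : R :=
  'D_(fr M m x) (B p l a b) x
  - \sum_q (lc m p q x * B q l a b x + lc m l q x * B p q a b x
            + A m a q x * B p l q b x + A m b q x * B p l a q x).

Definition equations_of_motion D (H : dform V n) (A : connection)
    (phi : V -> R) (alpha : R) : Prop :=
  let F := curv A in
  let w := fun x => expR (- 2 * phi x) in
  [/\ (forall x m l, D x ->
         ricci m l x
         - 4^-1 * (\sum_p \sum_q H [:: m; p; q] x * H [:: l; p; q] x)
         + 2 * hess phi m l x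
         + 2 * alpha * (\sum_p trF F m p l p x) = 0),
      (forall x l p, D x ->
         \sum_m cov lc m (fun I y => w y * H I y) [:: m; l; p] x = 0),
      (forall x l a b, D x ->
         \sum_m gauge_cov A m (fun p q c d y => w y * F p q c d y) m l a b x
         + 2^-1 * w x * (\sum_p \sum_q H [:: l; p; q] x * F p q a b x) = 0)
    & (forall x, D x ->
         scalar_curv x
         + 4 * (\sum_m hess phi m m x)
         - 4 * (\sum_m 'D_(fr M m x) phi x ^+ 2)
         - 12^-1 * (\sum_m \sum_p \sum_q H [:: m; p; q] x ^+ 2)
         + alpha * (\sum_m \sum_p trF F m p m p x) = 0)].

End Geometry.

Definition dot (R : realType) (N : nat) (u v : 'cV[R]_N) : R :=
  (u^T *m v) 0 0.

(* The sphere of radius r in the octonions, with the frame e_i(x) = (e_i x)/r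
   (octonion product).  The basis (x/r, e_1(x), ..., e_7(x)) of R^8 is positive:
   it is the standard one at x = r, and the sphere is connected.              *)
Definition sphere7 (R : realType) (r : R) : framed 'cV[R]_8 7 :=
  Framed [set x | dot x x = r ^+ 2]
         (fun i x => r^-1 *: (octL R (lift ord0 i) *m x))
         (@dot R 8).

(* b(v_1, ..., v_k) for a constant form b on R^8 *)
Definition eval8 (R : realType) (b : seq 'I_8 -> int) (vs : seq 'cV[R]_8) : R :=
  \sum_(J : (size vs).-tuple 'I_8)
    (b J)%:~R * \prod_(k < size vs) tnth (in_tuple vs) k (tnth J k) 0.

(* The G_2-structure which the Spin(7)-structure Phi0 of R^8 (invariant under
   octonionic left multiplication by unit imaginary octonions) induces on the
   hypersurface: the interior product of the unit normal x/r with Phi0.       *)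
Definition sphere7_omega (R : realType) (r : R) : dform 'cV[R]_8 7 := fun I x =>
  eval8 Phi0 ((r^-1 *: x) :: [seq fr (sphere7 r) i x | i <- I]).

Definition line (R : realType) : framed R 1 :=
  Framed (setT : set R) (fun _ _ => 1 : R) (fun u v : R => u * v).

Definition circle (R : realType) (s : R) : framed 'cV[R]_2 1 :=
  Framed [set z | dot z z = s ^+ 2]
         (fun _ z => s^-1 *: \col_i (if i == 0 then - z 1 0 else z 0 0))
         (@dot R 2).

Section Product.
Variables (R : realType) (V W : normedModType R) (n : nat).
Variables (M : framed V n) (L : framed W 1).

(* Riemannian product; e_0 is the unit tangent field of the curve L. *)
Definition prod_framed : framed (V * W)%type n.+1 :=
  Framed (pts M `*` pts L)
         (fun i x => if unlift ord0 i is Some j then (fr M j x.1, 0)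
                     else (0, fr L ord0 x.2))
         (fun u v => ip M u.1 v.1 + ip L u.2 v.2).

Definition pullback (a : dform V n) : dform (V * W)%type n.+1 := fun I x =>
  if all (fun i => i != ord0) I then a (pmap (unlift ord0) I) x.1 else 0.

Definition e0form : dform (V * W)%type n.+1 := fun I _ => (I == [:: ord0])%:R.

Definition product_Phi (a : dform V n) : dform (V * W)%type n.+1 := fun I x =>
  wedge 1 e0form (pullback a) I x + pullback (star 3 a) I x.

End Product.

Definition lee8 (R : realType) (V : normedModType R) (M : framed V 8)
    (Phi : dform V 8) : dform V 8 := fun I x =>
  - 7^-1 * star 7 (wedge 3 (star 5 (extd M Phi)) Phi) I x.

Definition gamma7 (R : realType) (i : 'I_7) : 'M[R]_8 := octL R (lift ord0 i).

Definition gamma8 (R : realType) (i : 'I_8) : 'M[R]_(8 + 8) :=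
  if unlift ord0 i is Some j then block_mx 0 (gamma7 R j) (gamma7 R j) 0
  else block_mx 0 (- 1%:M) 1%:M 0.

(* Sanity checks: the frame of the sphere is tangent and orthonormal, and left
   multiplications by e_1, ..., e_7 satisfy the Clifford relation.            *)

Lemma octL_skew (R : realType) (i : 'I_7) :
  (octL R (lift ord0 i))^T = - octL R (lift ord0 i).
Proof.
have H : all (fun i => all (fun b => all (fun c =>
    oct i.+1 c b == - oct i.+1 b c) (iota 0 8)) (iota 0 8)) (iota 0 7).
  by vm_compute.
apply/matrixP => c b; rewrite !mxE lift0 -rmorphN; congr (_%:~R); apply/eqP.
have Ho (m : nat) (k : 'I_m) : (k : nat) \in iota 0 m by rewrite mem_iota /=.
by move/allP: H => /(_ _ (Ho _ i))/allP/(_ _ (Ho _ b))/allP/(_ _ (Ho _ c)).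
Qed.

Lemma octL_clifford (R : realType) (i j : 'I_7) :
  octL R (lift ord0 i) *m octL R (lift ord0 j)
  + octL R (lift ord0 j) *m octL R (lift ord0 i) = (- 2 * (i == j)%:R)%:M.
Proof.
pose S (i j b c : nat) : int :=
  foldr (fun k s => oct i.+1 k c * oct j.+1 b k
                    + oct j.+1 k c * oct i.+1 b k + s) 0 (iota 0 8).
have H : all (fun i => all (fun j => all (fun b => all (fun c =>
    S i j b c == (- 2 * (i == j)%:R) *+ (c == b))
    (iota 0 8)) (iota 0 8)) (iota 0 7)) (iota 0 7).
  by vm_compute.
apply/matrixP => c b; rewrite !mxE -big_split /=.
transitivity (((- 2 * (i == j)%:R) *+ (c == b) : int)%:~R : R); last first.
  by rewrite rmorphMn rmorphM /= rmorphN; do 2 case: eqP.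
have Ho (m : nat) (k : 'I_m) : (k : nat) \in iota 0 m by rewrite mem_iota /=.
move/allP: H => /(_ _ (Ho _ i))/allP/(_ _ (Ho _ j))/allP/(_ _ (Ho _ b)).
move=> /allP/(_ _ (Ho _ c))/eqP <-.
rewrite /S (_ : foldr _ _ _ = \sum_(k < 8) (oct i.+1 k c * oct j.+1 b k
                    + oct j.+1 k c * oct i.+1 b k)); last first.
  by rewrite -(big_mkord xpredT (fun k => oct i.+1 k c * oct j.+1 b k
                    + oct j.+1 k c * oct i.+1 b k)) /index_iota unlock.
rewrite rmorph_sum; apply: eq_bigr => k _.
by rewrite !mxE !lift0 rmorphD !rmorphM.
Qed.

Lemma dotC (R : realType) (N : nat) (u v : 'cV[R]_N) : dot u v = dot v u.
Proof. by rewrite /dot !mxE; apply: eq_bigr => k _; rewrite !mxE mulrC. Qed.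

Lemma dot_octL (R : realType) (i j : 'I_7) (x : 'cV[R]_8) :
  dot (octL R (lift ord0 i) *m x) (octL R (lift ord0 j) *m x)
  = (i == j)%:R * dot x x.
Proof.
have E a b : dot (octL R (lift ord0 a) *m x) (octL R (lift ord0 b) *m x) =
    - (x^T *m (octL R (lift ord0 a) *m octL R (lift ord0 b)) *m x) 0 0.
  by rewrite /dot trmx_mul octL_skew mulmxN mulNmx !mulmxA mxE.
apply: (mulfI (_ : 2 != 0)); first by rewrite pnatr_eq0.
rewrite mulr2n mulrDl mul1r {2}dotC !E -opprD.
transitivity (- ((x^T *m (octL R (lift ord0 i) *m octL R (lift ord0 j)
   + octL R (lift ord0 j) *m octL R (lift ord0 i))) *m x) 0 0).
  by rewrite mulmxDr mulmxDl [X in _ = - X]mxE.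
rewrite octL_clifford mul_mx_scalar -scalemxAl mxE /dot; ring.
Qed.

Lemma dotZl (R : realType) (N : nat) (c : R) (u v : 'cV[R]_N) :
  dot (c *: u) v = c * dot u v.
Proof.
by rewrite /dot (_ : (c *: u)^T = c *: u^T) ?linearZ // -scalemxAl mxE.
Qed.

Lemma sphere7_frame (R : realType) (r : R) (x : 'cV[R]_8) (i j : 'I_7) :
  r != 0 -> pts (sphere7 r) x ->
  ip (sphere7 r) (fr (sphere7 r) i x) (fr (sphere7 r) j x) = (i == j)%:R /\
  dot x (fr (sphere7 r) i x) = 0.
Proof.
move=> r0 /= Hx; split.
  by rewrite dotZl dotC dotZl dot_octL Hx eq_sym; field.
rewrite dotC dotZl; apply/eqP; rewrite mulf_eq0 invr_eq0 (negPf r0) /=.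
have : dot (octL R (lift ord0 i) *m x) x = - dot (octL R (lift ord0 i) *m x) x.
  rewrite [LHS]dotC /dot trmx_mul octL_skew mulmxN mulNmx [in RHS]mxE.
  by rewrite opprK mulmxA.
by move/eqP; rewrite -addr_eq0 -mulr2n mulrn_eq0.
Qed.

(* Main.v *)
Require Import Defs.
From HB Require Import structures.
From mathcomp Require Import all_boot all_order all_algebra all_fingroup.
From mathcomp Require Import all_classical all_reals all_analysis.
From mathcomp Require Import ring lra.

Set Implicit Arguments.
Unset Strict Implicit.
Unset Printing Implicit Defensive.

Import Order.TTheory GRing.Theory Num.Theory.
Import numFieldNormedType.Exports.

Local Open Scope classical_set_scope.
Local Open Scope ring_scope.

(** Forms, connections and curvatures are functions on the whole ambient space, and curvatures have
    to be differentiated again in the equations of motion. The frame is tangent to every concentric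
    sphere, so q = |x|^2/r^2 is constant along it: the identities are proved at every ambient point
    with explicit powers of q, and q = 1 is inserted only after the last differentiation. Origin of
    the constants: for the connection g w one has nabla_m w = (c - 3 g) p_m where q = 1, hence g =
    c/3, and since lc = (c/2) w the torsion is -(c/3) w. Then dT = (2/3) c^2 p, while Tr(R wedge R)
    is -(2/9) c^4 p for the torsion T and (8/9) c^4 p for -T; this gives the two negative values of
    alpha'. On the product the Lee form is 2 c e_0, which fixes the slope of the dilaton. In the
    trivialization given by the frame, the spinor is the position vector itself. *)

(* Left multiplication by the imaginary units makes R^8 a Clifford module with
   skew generators E_i, and in the frame e_i(x) = E_i x / r the G_2-form of the
   sphere is w_ijk(x) = - <x, E_i E_j E_k x> / r^2, its dual p being given
   likewise by the products of four generators.  The structure functions of the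
   frame are c w with c = - 2/r, and D_m w = c p_m, while D_m p is a contraction
   of w with the metric.  Hence every connection lc + T/2 with T a multiple of w
   is a multiple of w itself, and its curvature is a combination of p and of the
   curvature tensor of constant curvature; the torsion -(c/3) w makes w parallel,
   and the Bianchi identities and the equations of motion reduce to the
   contraction identities of w and p.  Pulled back to the product with a curve,
   w and p satisfy the same identities for the metric degenerate along e_0, so
   that the same computation applies, and the Lee form is a multiple of e_0.
   The uniqueness of the torsion comes from the spinors: the difference of two
   torsions acts on them as a Clifford element which must vanish. *)

(** Reduces a goal that is [k] times a known equation to a polynomial identity for [ring]. *)
Lemma lincomb (F : comPzRingType) (a b l r k : F) :
  l = r -> a - b = k * (l - r) -> a = b.
Proof. by move=> ->; rewrite subrr mulr0 => /eqP; rewrite subr_eq0 => /eqP. Qed.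

Definition kron (R : realType) n (i j : 'I_n) : R := (i == j)%:R.
Arguments kron {R n} i j.

Lemma kronC (R : realType) n (i j : 'I_n) : kron i j = kron j i :> R.
Proof. by rewrite /kron eq_sym. Qed.

Arguments kronC {R n} i j.

Lemma kron_sum (R : realType) n (a : 'I_n) (F : 'I_n -> R) :
  \sum_i kron i a * F i = F a.
Proof.
rewrite (bigD1 a) //= /kron eqxx mul1r big1 ?addr0 // => i /negPf ->.
by rewrite mul0r.
Qed.

(** * The Clifford module of the octonions *)

Section Clifford.
Variable R : realType.
Local Notation E := (@gamma7 R).
Implicit Types (s : seq 'I_7) (y : 'cV[R]_8) (K : 'M[R]_8).

Definition cprod s : 'M[R]_8 := foldr (fun i K => E i *m K) 1%:M s.

Definition qform K y : R := (y^T *m K *m y) 0 0.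

Definition qs s y : R := qform (cprod s) y.

Lemma E_skew i : (E i)^T = - E i.
Proof. exact: octL_skew. Qed.

Lemma E_anticomm i j : E i *m E j = - (E j *m E i) - (2 * kron i j)%:M.
Proof.
apply/eqP; rewrite -subr_eq0 opprD !opprK addrA octL_clifford.
by rewrite mulNr raddfN addNr.
Qed.

Lemma E_sqr i : E i *m E i = - 1%:M.
Proof.
have := octL_clifford R i i; rewrite eqxx mulr1 -mulr2n -scaler_nat => H.
apply: (scalerI (_ : 2 != 0 :> R)); first by rewrite pnatr_eq0.
by rewrite H scalerN scalemx1 -raddfN.
Qed.

Lemma cprod_cat s t : cprod (s ++ t) = cprod s *m cprod t.
Proof. by elim: s => [|i s IH] /=; rewrite ?mul1mx // IH mulmxA. Qed.

Lemma cprod_swap s i j t : cprod (s ++ i :: j :: t) =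
  - cprod (s ++ j :: i :: t) - (2 * kron i j) *: cprod (s ++ t).
Proof.
rewrite !cprod_cat /= !(mulmxA (E _)) E_anticomm mulmxBl mulmxBr mulNmx mulmxN.
by rewrite mul_scalar_mx -scalemxAr.
Qed.

Lemma cprod_tr s : (cprod s)^T = (-1) ^+ size s *: cprod (rev s).
Proof.
elim: s => [|i s IH]; first by rewrite /= trmx1 scale1r.
rewrite /= trmx_mul IH E_skew rev_cons -cats1 cprod_cat /= mulmx1 exprS.
by rewrite mulmxN -scalemxAl mulN1r scaleNr.
Qed.

Lemma qformZ c K y : qform (c *: K) y = c * qform K y.
Proof. by rewrite /qform -scalemxAr -scalemxAl mxE. Qed.
Lemma qformN K y : qform (- K) y = - qform K y.
Proof. by rewrite /qform mulmxN mulNmx mxE. Qed.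
Lemma qformD K K' y : qform (K + K') y = qform K y + qform K' y.
Proof. by rewrite /qform mulmxDr mulmxDl mxE. Qed.
Lemma qformT K y : qform K^T y = qform K y.
Proof.
have -> : qform K y = ((y^T *m K *m y)^T) 0 0 by rewrite mxE.
by rewrite !trmx_mul trmxK mulmxA.
Qed.
Lemma qform1 y : qform 1%:M y = dot y y.
Proof. by rewrite /qform mulmx1. Qed.

Lemma qs_swap s i j t y : qs (s ++ i :: j :: t) y =
  - qs (s ++ j :: i :: t) y - 2 * kron i j * qs (s ++ t) y.
Proof. by rewrite /qs cprod_swap qformD qformN qformN qformZ. Qed.

(** A scalar is its own transpose, and transposing a product of skew generators reverses it with one
    sign per factor. *)
Lemma qs_rev s y : qs (rev s) y = (-1) ^+ size s * qs s y.
Proof.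
rewrite /qs -[in RHS]qformT cprod_tr qformZ mulrA -exprD addnn.
by rewrite -signr_odd odd_double mul1r.
Qed.
Lemma qs1 i y : qs [:: i] y = 0.
Proof. by have := qs_rev [:: i] y; rewrite /rev /= => H; lra. Qed.

Lemma qs0 y : qs [::] y = dot y y.
Proof. exact: qform1. Qed.

Lemma qs2 i j y : qs [:: i; j] y = - (kron i j * dot y y).
Proof.
have := qs_swap [::] i j [::] y; have := qs_rev [:: i; j] y.
by rewrite /= /rev /= !qs0 => H1 H2; lra.
Qed.

Lemma qs_swap0 i j t y : qs (i :: j :: t) y =
  - qs (j :: i :: t) y - 2 * kron i j * qs t y.
Proof. exact: (qs_swap [::]). Qed.

(** The correction term of the swap is a form of one generator, which vanishes by [qs1]. Hence
    triple products are alternating even on repeated indices. *)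
Lemma qs3_swapl i j k y : qs [:: i; j; k] y = - qs [:: j; i; k] y.
Proof. by rewrite qs_swap0 qs1; ring. Qed.

Lemma qs3_swapr i j k y : qs [:: i; j; k] y = - qs [:: i; k; j] y.
Proof. by rewrite (qs_swap [:: i]) /= qs1; ring. Qed.

End Clifford.

(** The tensors are turned into variables so that [ring] meets a plain polynomial identity. *)
Ltac generalize_deltas := repeat match goal with
  |- context [@kron ?R ?n ?i ?j] =>
    let d := fresh "d" in generalize (@kron R n i j) => d end.

Ltac generalize_qs := repeat match goal with
  |- context [@qs ?R ?s ?y] => let d := fresh "u" in generalize (@qs R s y) => d end.

(** * Contraction identities of the 3-form and its dual *)

Section Contractions.
Variable R : realType.
Local Notation E := (@gamma7 R).
Implicit Types (s : seq 'I_7) (y : 'cV[R]_8) (K : 'M[R]_8).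

(* Reversing five generators by ten transpositions gives qs s plus shorter
   products, while qs_rev gives - qs s: twice qs s is a sum of shorter products. *)
Lemma qs5 i j k l m y : qs [:: i; j; k; l; m] y =
  - (kron i j * qs [:: k; l; m] y) + kron i k * qs [:: j; l; m] y
  - kron i l * qs [:: j; k; m] y + kron i m * qs [:: j; k; l] y
  - kron j k * qs [:: i; l; m] y + kron j l * qs [:: i; k; m] y
  - kron j m * qs [:: i; k; l] y - kron k l * qs [:: i; j; m] y
  + kron k m * qs [:: i; j; l] y - kron l m * qs [:: i; j; k] y.
Proof.
have sw := @qs_swap R.
have := qs_rev [:: i; j; k; l; m] y; rewrite /rev /= -signr_odd /= expr1 mulN1r.
rewrite (sw [:: m; l; k] j i) /= (sw [:: m; l] k i) /= (sw [:: m] l i) /=.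
rewrite (sw [::] m i) /= (sw [:: i; m; l] k j) /= (sw [:: i; m] l j) /=.
rewrite (sw [:: i] m j) /= (sw [:: i; j; m] l k) /= (sw [:: i; j] m k) /=.
rewrite (sw [:: i; j; k] m l) /=.
rewrite (kronC j i) (kronC k i) (kronC l i) (kronC m i) (kronC k j).
rewrite (kronC l j) (kronC m j) (kronC l k) (kronC m k) (kronC m l).
have C a b c : qs [:: a; b; c] y = - qs [:: c; b; a] y.
  have := qs_rev [:: a; b; c] y; rewrite /rev /= -signr_odd /= expr1; lra.
rewrite (C m l k) (C m l j) (C m k j) (C l k j) (qs3_swapr i m l).
rewrite (qs3_swapr i m k) (qs3_swapr i l k).
move=> H; apply: (mulfI (_ : 2 != 0 :> R)); first by rewrite pnatr_eq0.
apply: (lincomb (k := 1) H) => {H sw C}.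
generalize_deltas; generalize_qs.
by ring.
Qed.

Definition octframe y : 'M[R]_8 :=
  \matrix_(a, b) (if unlift ord0 b is Some i then (E i *m y) a 0 else y a 0).

Lemma dot_E i y : dot y (E i *m y) = 0.
Proof. by rewrite /dot mulmxA -[LHS]/(qform (E i) y) -(qs1 i y) /qs /= mulmx1. Qed.

Lemma dotE (N : nat) (u v : 'cV[R]_N) : dot u v = \sum_a u a 0 * v a 0.
Proof. by rewrite /dot mxE; apply: eq_bigr => a _; rewrite mxE. Qed.

Lemma dot_eq0 (N : nat) (u : 'cV[R]_N) : dot u u = 0 -> u = 0.
Proof.
rewrite dotE => /eqP; rewrite psumr_eq0 => [/allP H|a _]; last by rewrite -expr2 sqr_ge0.
apply/colP => a; rewrite mxE; apply/eqP.
by have := H a (mem_index_enum _); rewrite -expr2 sqrf_eq0.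
Qed.

Lemma octframe_ortho y : (octframe y)^T *m octframe y = (dot y y)%:M.
Proof.
apply/matrixP => i j; rewrite !mxE.
under eq_bigr do rewrite !mxE.
case: (unliftP ord0 i) => [i' ->|->]; case: (unliftP ord0 j) => [j' ->|->];
  rewrite -dotE.
- by rewrite dot_octL (inj_eq (@lift_inj _ _)) mulr_natl.
- by rewrite dotC (dot_E i') eq_sym (negPf (neq_lift _ _)) mulr0n.
- by rewrite (dot_E j') (negPf (neq_lift _ _)) mulr0n.
- by rewrite eqxx.
Qed.

(** Completeness of the orthogonal basis y, E_1 y, ..., E_7 y: a square matrix A with A^T A = |y|^2
    also has A A^T = |y|^2. The minus sign comes from (E_i y)^T = - y^T E_i. *)
Lemma octframe_complete y :
  y *m y^T - \sum_i E i *m y *m (y^T *m E i) = (dot y y)%:M.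
Proof.
have [/dot_eq0 ->|y0] := eqVneq (dot y y) 0.
  by rewrite mul0mx big1 ?subr0 => [|i _]; rewrite ?mulmx0 ?mul0mx //
     /dot trmx0 mul0mx mxE raddf0.
have -> : (dot y y)%:M = octframe y *m (octframe y)^T.
  have /mulmx1C : (octframe y)^T *m ((dot y y)^-1 *: octframe y) = 1%:M.
    by rewrite -scalemxAr octframe_ortho scale_scalar_mx mulVf.
  rewrite -scalemxAl => /(congr1 ( *:%R (dot y y))).
  by rewrite scalerA divff // scale1r scalemx1.
apply/matrixP => a b; rewrite [RHS]mxE; under [RHS]eq_bigr do rewrite !mxE.
rewrite [RHS]big_ord_recl unlift_none [LHS]mxE; congr (_ + _).
  by rewrite mxE big_ord1 mxE.
rewrite mxE summxE -sumrN; apply: eq_bigr => i _.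
rewrite liftK (_ : y^T *m E i = - (E i *m y)^T); last first.
  by rewrite trmx_mul E_skew mulmxN opprK.
by rewrite mulmxN [X in - X]mxE opprK [LHS]mxE big_ord1 [X in _ * X]mxE.
Qed.

(** Insert the completeness relation of [octframe_complete] between the products for [s] and [t].
    All contraction identities of the 3-form and the 4-form descend from this one. *)
Lemma qs_contract s t y :
  \sum_i qs (rcons s i) y * qs (i :: t) y =
  qs s y * qs t y - dot y y * qs (s ++ t) y.
Proof.
have H (A B : 'M[R]_8) : \sum_i qform (A *m E i) y * qform (E i *m B) y =
    qform A y * qform B y - dot y y * qform (A *m B) y.
  have Q (u v : 'M[R]_(1, 1)) : u 0 0 * v 0 0 = (u *m v) 0 0.
    by rewrite mxE big_ord1.
  rewrite /qform Q; apply/esym/eqP; rewrite subr_eq -subr_eq; apply/eqP.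
  have -> : dot y y * (y^T *m (A *m B) *m y) 0 0 =
      (y^T *m A *m (dot y y)%:M *m B *m y) 0 0.
    by rewrite mul_mx_scalar -!scalemxAl [RHS]mxE !mulmxA.
  rewrite -octframe_complete mulmxBr !mulmxBl [X in _ - X]mxE opprD addrA.
  rewrite !mulmxA subrr add0r [X in - X]mxE opprK mulmx_sumr !mulmx_suml summxE.
  by apply: eq_bigr => i _; rewrite Q !mulmxA.
have cprod_rcons i : cprod R (rcons s i) = cprod R s *m E i.
  by rewrite -cats1 cprod_cat /= mulmx1.
rewrite /qs cprod_cat -H; apply: eq_bigr => i _.
by rewrite cprod_rcons.
Qed.

Variable r : R.
Let rho := (r ^+ 2)^-1.

Definition sq y : R := rho * dot y y.
Definition w7 i j k y : R := - rho * qs [:: i; j; k] y.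
(** The subtracted term is the part of the product of four generators that survives on repeated
    indices; removing it makes [p7] alternating. *)
Definition p7 i j k l y : R := - rho * (qs [:: i; j; k; l] y
  - (kron i j * kron k l - kron i k * kron j l
     + kron i l * kron j k) * dot y y).

Lemma w7_swapl i j k y : w7 i j k y = - w7 j i k y.
Proof. by rewrite /w7 qs3_swapl mulrN. Qed.

Lemma w7_swapr i j k y : w7 i j k y = - w7 i k j y.
Proof. by rewrite /w7 qs3_swapr mulrN. Qed.

Lemma p7_swapl i j k l y : p7 i j k l y = - p7 j i k l y.
Proof.
rewrite /p7 qs_swap0 qs2 (kronC j i).
generalize_deltas; generalize_qs; move: (dot _ _) => *; ring.
Qed.

Lemma p7_swapm i j k l y : p7 i j k l y = - p7 i k j l y.
Proof.
rewrite /p7 (qs_swap [:: i]) qs2 (kronC k j) /=.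
generalize_deltas; generalize_qs; move: (dot _ _) => *; ring.
Qed.

Lemma p7_swapr i j k l y : p7 i j k l y = - p7 i j l k y.
Proof.
rewrite /p7 (qs_swap [:: i; j]) qs2 (kronC l k) /=.
generalize_deltas; generalize_qs; move: (dot _ _) => *; ring.
Qed.

Lemma w7_w7 i j k l y : \sum_s w7 i j s y * w7 k l s y =
  sq y * p7 i j k l y
  + sq y ^+ 2 * (kron i k * kron j l - kron i l * kron j k).
Proof.
transitivity (rho ^+ 2 * \sum_s qs (rcons [:: i; j] s) y * qs (s :: [:: k; l]) y).
  rewrite mulr_sumr; apply: eq_bigr => s _; rewrite (w7_swapr k) (w7_swapl k).
  by rewrite /w7 /=; generalize_qs => *; ring.
rewrite qs_contract !qs2 /p7 /sq /=.
generalize_deltas; generalize_qs; move: (dot _ _) => *; ring.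
Qed.

(** The contraction produces a form of five generators, which [qs5] reduces to forms of three. *)
Lemma w7_p7 i j k l m y : \sum_s w7 i j s y * p7 s k l m y =
  sq y * (kron i k * w7 j l m y - kron i l * w7 j k m y
          + kron i m * w7 j k l y - kron j k * w7 i l m y
          + kron j l * w7 i k m y - kron j m * w7 i k l y).
Proof.
(* The correction in [p7] contributes the sums with [kron], evaluated by [kron_sum]. *)
transitivity (rho ^+ 2 *
    (\sum_s qs (rcons [:: i; j] s) y * qs (s :: [:: k; l; m]) y
     - dot y y * (kron l m * \sum_s kron s k * qs [:: i; j; s] y
     - kron k m * (\sum_s kron s l * qs [:: i; j; s] y)
     + kron k l * \sum_s kron s m * qs [:: i; j; s] y))).
  rewrite !mulr_sumr -sumrB -big_split mulr_sumr -sumrB mulr_sumr.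
  apply: eq_bigr => s _ /=; rewrite /w7 /p7.
  generalize_deltas; generalize_qs; move: (dot _ _) => *; ring.
rewrite qs_contract !kron_sum /= qs5 qs2 /w7 /sq.
generalize_deltas; generalize_qs; move: (dot _ _) => *; ring.
Qed.

End Contractions.

(* The pointwise algebra of a G_2-structure w with dual 4-form p and metric d,
   allowing d to be degenerate so that it also covers the pull-backs to a
   product; q is |y|^2/r^2, which makes the identities homogeneous in y. *)
Record g2_tensors (R : realType) (n : nat) (d : 'I_n -> 'I_n -> R)
    (w : 'I_n -> 'I_n -> 'I_n -> R) (p : 'I_n -> 'I_n -> 'I_n -> 'I_n -> R)
    (q : R) : Prop := G2Tensors {
  g2_dC : forall i j, d i j = d j i ;
  g2_wl : forall i j k, w i j k = - w j i k ;
  g2_wr : forall i j k, w i j k = - w i k j ;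
  g2_pl : forall i j k l, p i j k l = - p j i k l ;
  g2_pm : forall i j k l, p i j k l = - p i k j l ;
  g2_pr : forall i j k l, p i j k l = - p i j l k ;
  g2_dd : forall i j, \sum_s d s i * d s j = d i j ;
  g2_dw : forall i j k, \sum_s d s i * w s j k = w i j k ;
  g2_dp : forall i j k l, \sum_s d s i * p s j k l = p i j k l ;
  g2_tr : \sum_s d s s = 7 ;
  g2_ww : forall i j k l, \sum_s w i j s * w k l s =
    q * p i j k l + q ^+ 2 * (d i k * d j l - d i l * d j k) ;
  g2_wp : forall i j k l m, \sum_s w i j s * p s k l m =
    q * (d i k * w j l m - d i l * w j k m + d i m * w j k l
         - d j k * w i l m + d j l * w i k m - d j m * w i k l) }.

(** * Algebra of the tensors w, p and d *)

Section TensorAlgebra.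
Variables (R : realType) (n : nat) (d : 'I_n -> 'I_n -> R).
Variables (w : 'I_n -> 'I_n -> 'I_n -> R).
Variables (p : 'I_n -> 'I_n -> 'I_n -> 'I_n -> R) (q : R).
Hypothesis G : g2_tensors d w p q.

Let dC := g2_dC G.
Let wl := g2_wl G.
Let wr := g2_wr G.
Let pl := g2_pl G.
Let pm := g2_pm G.
Let pr := g2_pr G.

Lemma skew_eq0 (x : R) : x = - x -> x = 0.
Proof. by move=> H; apply: (lincomb (k := 2^-1) H); field. Qed.

Lemma w_cyc i j k : w i j k = w j k i.
Proof. by rewrite wl wr opprK. Qed.

(** Packed as a multirule for [rewrite]: all components on three given indices become one atom for
    [ring]. [p_sort] does the same with the 23 nontrivial rearrangements of four indices. *)
Lemma w_sort i j k : (w j i k = - w i j k) * (w i k j = - w i j k)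
  * (w j k i = w i j k) * (w k i j = w i j k) * (w k j i = - w i j k).
Proof.
do !split; [exact: wl | exact: wr | exact/esym/w_cyc | exact: w_cyc |].
by rewrite wl -(w_cyc i).
Qed.

Lemma w_iij i j : w i i j = 0. Proof. exact/skew_eq0/wl. Qed.
Lemma w_ijj i j : w i j j = 0. Proof. exact/skew_eq0/wr. Qed.
Lemma w_iji i j : w i j i = 0. Proof. by rewrite wl w_ijj oppr0. Qed.

Lemma p_iijk i j k : p i i j k = 0. Proof. exact/skew_eq0/pl. Qed.
Lemma p_ijjk i j k : p i j j k = 0. Proof. exact/skew_eq0/pm. Qed.
Lemma p_ijkk i j k : p i j k k = 0. Proof. exact/skew_eq0/pr. Qed.
Lemma p_ijik i j k : p i j i k = 0. Proof. by rewrite pl p_ijjk oppr0. Qed.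
Lemma p_ijki i j k : p i j k i = 0. Proof. by rewrite pr p_ijik oppr0. Qed.
Lemma p_ijkj i j k : p i j k j = 0. Proof. by rewrite pr p_ijjk oppr0. Qed.

Lemma p_cyc i j k l : p i j k l = - p j k l i.
Proof. by rewrite pl pm pr !opprK. Qed.

Lemma p_pair i j k l : p i j k l = p k l i j.
Proof. by rewrite p_cyc p_cyc opprK. Qed.

Lemma p_sort i j k l : (p i j l k = - p i j k l) * (p i k j l = - p i j k l)
  * (p i k l j = p i j k l) * (p i l j k = p i j k l) * (p i l k j = - p i j k l)
  * (p j i k l = - p i j k l) * (p j i l k = p i j k l) * (p j k i l = p i j k l)
  * (p j k l i = - p i j k l) * (p j l i k = - p i j k l) * (p j l k i = p i j k l)
  * (p k i j l = p i j k l) * (p k i l j = - p i j k l) * (p k j i l = - p i j k l)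
  * (p k j l i = p i j k l) * (p k l i j = p i j k l) * (p k l j i = - p i j k l)
  * (p l i j k = - p i j k l) * (p l i k j = p i j k l) * (p l j i k = p i j k l)
  * (p l j k i = - p i j k l) * (p l k i j = - p i j k l) * (p l k j i = p i j k l).
Proof.
do !split.
- by rewrite (pr i j l k).
- by rewrite (pm i k j l).
- by rewrite (pr i k l j) (pm i k j l) !opprK.
- by rewrite (pm i l j k) (pr i j l k) !opprK.
- by rewrite (pm i l k j) (pr i k l j) (pm i k j l) !opprK.
- by rewrite (pl j i k l).
- by rewrite (pl j i l k) (pr i j l k) !opprK.
- by rewrite (pm j k i l) (pl j i k l) !opprK.
- by rewrite (pr j k l i) (pm j k i l) (pl j i k l) !opprK.
- by rewrite (pm j l i k) (pl j i l k) (pr i j l k) !opprK.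
- by rewrite (pm j l k i) (pr j k l i) (pm j k i l) (pl j i k l) !opprK.
- by rewrite (pl k i j l) (pm i k j l) !opprK.
- by rewrite (pl k i l j) (pr i k l j) (pm i k j l) !opprK.
- by rewrite (pl k j i l) (pm j k i l) (pl j i k l) !opprK.
- by rewrite (pl k j l i) (pr j k l i) (pm j k i l) (pl j i k l) !opprK.
- by rewrite (pm k l i j) (pl k i l j) (pr i k l j) (pm i k j l) !opprK.
- by rewrite (pm k l j i) (pl k j l i) (pr j k l i) (pm j k i l) (pl j i k l) !opprK.
- by rewrite (pl l i j k) (pm i l j k) (pr i j l k) !opprK.
- by rewrite (pl l i k j) (pm i l k j) (pr i k l j) (pm i k j l) !opprK.
- by rewrite (pl l j i k) (pm j l i k) (pl j i l k) (pr i j l k) !opprK.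
- by rewrite (pl l j k i) (pm j l k i) (pr j k l i) (pm j k i l) (pl j i k l) !opprK.
- by rewrite (pl l k i j) (pm k l i j) (pl k i l j) (pr i k l j) (pm i k j l) !opprK.
- by rewrite (pl l k j i) (pm k l j i) (pl k j l i) (pr j k l i) (pm j k i l) (pl j i k l) !opprK.
Qed.

Lemma d_w1 i j k : \sum_s d s i * w s j k = w i j k.
Proof. exact: g2_dw G _ _ _. Qed.
Lemma d_w2 i j k : \sum_s d s j * w i s k = w i j k.
Proof.
by rewrite wl -d_w1 -sumrN; apply: eq_bigr => s _; rewrite wl mulrN.
Qed.
Lemma d_w3 i j k : \sum_s d s k * w i j s = w i j k.
Proof.
by rewrite wr -d_w2 -sumrN; apply: eq_bigr => s _; rewrite wr mulrN.
Qed.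
Lemma d_p1 i j k l : \sum_s d s i * p s j k l = p i j k l.
Proof. exact: g2_dp G _ _ _ _. Qed.
Lemma d_p2 i j k l : \sum_s d s j * p i s k l = p i j k l.
Proof.
by rewrite pl -d_p1 -sumrN; apply: eq_bigr => s _; rewrite pl mulrN.
Qed.
Lemma d_p3 i j k l : \sum_s d s k * p i j s l = p i j k l.
Proof.
by rewrite pm -d_p2 -sumrN; apply: eq_bigr => s _; rewrite pm mulrN.
Qed.
Lemma d_p4 i j k l : \sum_s d s l * p i j k s = p i j k l.
Proof.
by rewrite pr -d_p3 -sumrN; apply: eq_bigr => s _; rewrite pr mulrN.
Qed.
Lemma d_d i j : \sum_s d s i * d s j = d i j.
Proof. exact: g2_dd G _ _. Qed.

Lemma sum_w_iab_w_jab i j : \sum_a \sum_b w i a b * w j a b = 6 * q ^+ 2 * d i j.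
Proof.
transitivity (\sum_a (q ^+ 2 * d i j * d a a - q ^+ 2 * (d a i * d a j))).
  by apply: eq_bigr => a _; rewrite (g2_ww G) p_ijkj (dC i a); ring.
by rewrite sumrB -!mulr_sumr d_d (g2_tr G); ring.
Qed.

Lemma sum_w : \sum_i \sum_j \sum_k w i j k * w i j k = 42 * q ^+ 2.
Proof.
under eq_bigr do rewrite sum_w_iab_w_jab.
by rewrite -mulr_sumr (g2_tr G); ring.
Qed.

(** In the trace of [g2_wp] the full trace of d gives 7, three contractions of d with w remove 1
    each, and the other two terms vanish by skewness: 7 - 3 = 4. *)
Lemma sum_w_iab_p_abkl i k l :
  \sum_a \sum_b w i a b * p a b k l = 4 * q * w i k l.
Proof.
transitivity (\sum_a (q * w i k l * d a a - q * (d a k * w i a l)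
    + q * (d a l * w i a k) - q * (d a i * w a k l))).
  apply: eq_bigr => a _.
  have -> : \sum_b w i a b * p a b k l = - \sum_b w i a b * p b a k l.
    by rewrite -sumrN; apply: eq_bigr => b _; rewrite pl mulrN.
  by rewrite (g2_wp G) !w_iij (dC i a); ring.
rewrite sumrB big_split sumrB /= -!mulr_sumr d_w1 !d_w2 (g2_tr G) (wr i l k); ring.
Qed.

(** Replace the first p by a contraction of w with w, using [g2_ww]. The double contraction then
    comes from [sum_w_iab_p_abkl], and the metric terms only relabel the indices of the second p. *)
Lemma sum_p_ijab_p_abkl i j k l : q = 1 ->
  \sum_a \sum_b p i j a b * p a b k l =
  4 * (d i k * d j l - d i l * d j k) + 2 * p i j k l.
Proof.
move=> q1.
transitivity (\sum_a \sum_b ((\sum_s w i j s * w a b s) * p a b k l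
    - (d a i * (d b j * p a b k l)) + d a j * (d b i * p a b k l))).
  apply: eq_bigr => a _; apply: eq_bigr => b _; rewrite (g2_ww G) q1.
  by rewrite (dC i a) (dC j b) (dC i b) (dC j a); ring.
under eq_bigr do rewrite big_split sumrB /= -!mulr_sumr !d_p2.
rewrite big_split sumrB /= !d_p1 (pl j).
have -> : \sum_a \sum_b (\sum_s w i j s * w a b s) * p a b k l =
    \sum_s w i j s * (4 * w k l s).
  under eq_bigr do under eq_bigr do rewrite mulr_suml.
  under eq_bigr do rewrite exchange_big /=.
  rewrite exchange_big; apply: eq_bigr => s _.
  rewrite -(w_cyc s k) -[4]mulr1 -[X in _ * X * _]q1 -sum_w_iab_p_abkl mulr_sumr.
  apply: eq_bigr => a _; rewrite mulr_sumr; apply: eq_bigr => b _.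
  by rewrite -(w_cyc s a) mulrA.
under eq_bigr do rewrite (mulrCA _ 4).
rewrite -mulr_sumr (g2_ww G) q1; ring.
Qed.

Lemma sum_p_iabc_p_jabc i j : q = 1 ->
  \sum_a \sum_b \sum_c p i a b c * p j a b c = 24 * d i j.
Proof.
move=> q1.
transitivity (\sum_a (4 * d i j * d a a - 4 * (d a i * d a j))).
  apply: eq_bigr => a _.
  transitivity (\sum_b \sum_c p i a b c * p b c j a).
    by do 2!apply: eq_bigr => ? _; rewrite (p_pair j).
  by rewrite sum_p_ijab_p_abkl // p_ijkj (dC i a); ring.
by rewrite sumrB -!mulr_sumr d_d (g2_tr G); ring.
Qed.

End TensorAlgebra.

(** * Exterior and covariant derivatives in components *)

Ltac generalize_analysis := repeat match goal with
  | |- context [@derive ?A ?B ?C ?f ?x ?v] => generalize (@derive A B C f x v)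
  | |- context [@bigop.body ?A ?B ?z ?r ?F] => generalize (@bigop.body A B z r F) end.

Definition form3 (R : realType) (V : normedModType R) n
    (w : 'I_n -> 'I_n -> 'I_n -> V -> R) : dform V n :=
  fun I => if I is [:: i; j; k] then w i j k else fun=> 0.

Definition form4 (R : realType) (V : normedModType R) n
    (p : 'I_n -> 'I_n -> 'I_n -> 'I_n -> V -> R) : dform V n :=
  fun I => if I is [:: i; j; k; l] then p i j k l else fun=> 0.

Section Expansions.
Variables (R : realType) (V : normedModType R) (n : nat) (M : framed V n).

Lemma extd1 (f : V -> R) i x : dfun M f [:: i] x = 'D_(fr M i x) f x.
Proof.
rewrite /dfun /extd big_ord1 /= [X in _ + X]big1 ?addr0; first by rewrite mul1r.
by move=> j _; rewrite big_pred0 // => l; rewrite (ord1 j) (ord1 l).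
Qed.

Lemma extd2 (a : dform V n) i j x : extd M a [:: i; j] x =
  'D_(fr M i x) (a [:: j]) x - 'D_(fr M j x) (a [:: i]) x
  - \sum_s struct M i j s x * a [:: s] x.
Proof.
rewrite /extd; under [X in _ + X]eq_bigr do rewrite big_mkcond.
rewrite !big_ord_recl !big_ord0 !(tnth_nth i) /= /del /= /bump /=.
generalize_analysis => *; ring.
Qed.

Lemma extd4 (a : dform V n) i j k l x : extd M a [:: i; j; k; l] x =
  'D_(fr M i x) (a [:: j; k; l]) x - 'D_(fr M j x) (a [:: i; k; l]) x
  + 'D_(fr M k x) (a [:: i; j; l]) x - 'D_(fr M l x) (a [:: i; j; k]) x
  - (\sum_s struct M i j s x * a [:: s; k; l] x
     - \sum_s struct M i k s x * a [:: s; j; l] x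
     + \sum_s struct M i l s x * a [:: s; j; k] x
     + \sum_s struct M j k s x * a [:: s; i; l] x
     - \sum_s struct M j l s x * a [:: s; i; k] x
     + \sum_s struct M k l s x * a [:: s; i; j] x).
Proof.
rewrite /extd; under [X in _ + X]eq_bigr do rewrite big_mkcond.
rewrite !big_ord_recl !big_ord0 !(tnth_nth i) /= /del /= /bump /=.
generalize_analysis => *; ring.
Qed.

Lemma extd5 (a : dform V n) i j k l m x : extd M a [:: i; j; k; l; m] x =
  'D_(fr M i x) (a [:: j; k; l; m]) x - 'D_(fr M j x) (a [:: i; k; l; m]) x
  + 'D_(fr M k x) (a [:: i; j; l; m]) x - 'D_(fr M l x) (a [:: i; j; k; m]) x
  + 'D_(fr M m x) (a [:: i; j; k; l]) x
  - (\sum_s struct M i j s x * a [:: s; k; l; m] x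
     - \sum_s struct M i k s x * a [:: s; j; l; m] x
     + \sum_s struct M i l s x * a [:: s; j; k; m] x
     - \sum_s struct M i m s x * a [:: s; j; k; l] x
     + \sum_s struct M j k s x * a [:: s; i; l; m] x
     - \sum_s struct M j l s x * a [:: s; i; k; m] x
     + \sum_s struct M j m s x * a [:: s; i; k; l] x
     + \sum_s struct M k l s x * a [:: s; i; j; m] x
     - \sum_s struct M k m s x * a [:: s; i; j; l] x
     + \sum_s struct M l m s x * a [:: s; i; j; k] x).
Proof.
rewrite /extd; under [X in _ + X]eq_bigr do rewrite big_mkcond.
rewrite !big_ord_recl !big_ord0 !(tnth_nth i) /= /del /= /bump /=.
generalize_analysis => *; ring.
Qed.

Lemma cov1 (G : connection V n) m (a : dform V n) i x : cov M G m a [:: i] x =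
  'D_(fr M m x) (a [:: i]) x - \sum_s G m i s x * a [:: s] x.
Proof. by rewrite /cov /= big_ord1 !(tnth_nth i). Qed.

Lemma cov3 (G : connection V n) m (a : dform V n) i j k x :
  cov M G m a [:: i; j; k] x =
  'D_(fr M m x) (a [:: i; j; k]) x
  - (\sum_s G m i s x * a [:: s; j; k] x
     + \sum_s G m j s x * a [:: i; s; k] x
     + \sum_s G m k s x * a [:: i; j; s] x).
Proof.
rewrite /cov !big_ord_recl !big_ord0 !(tnth_nth i) /=.
by rewrite addr0 addrA.
Qed.

Lemma cov4 (G : connection V n) m (a : dform V n) i j k l x :
  cov M G m a [:: i; j; k; l] x =
  'D_(fr M m x) (a [:: i; j; k; l]) x
  - (\sum_s G m i s x * a [:: s; j; k; l] x
     + \sum_s G m j s x * a [:: i; s; k; l] x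
     + \sum_s G m k s x * a [:: i; j; s; l] x
     + \sum_s G m l s x * a [:: i; j; k; s] x).
Proof.
rewrite /cov !big_ord_recl !big_ord0 !(tnth_nth i) /=.
by rewrite addr0 !addrA.
Qed.

End Expansions.

(** * Expansion of alternating sums and wedge products *)

Section Alternation.

(** [lift_perm ord0 j s] sends 0 to j and follows s on the remaining places, so the permuted list is
    entry j followed by a permutation of the list without it. This is one step of Laplace
    expansion. *)
Lemma map_lift_perm (T : Type) (k : nat) (I : k.+1.-tuple T) (j : 'I_k.+1)
    (s : 'S_k) (J : k.-tuple T) : J = del j I :> seq T ->
  [seq tnth I (lift_perm ord0 j s i) | i <- enum 'I_k.+1] =
  tnth I j :: [seq tnth J (s i) | i <- enum 'I_k].
Proof.
move=> JE; rewrite enum_ordSl /= lift_perm_id; congr (_ :: _).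
rewrite -map_comp; apply: eq_map => i /=; rewrite lift_perm_lift.
set x0 := tnth I j; rewrite !(tnth_nth x0) JE /del nth_cat size_take size_tuple.
rewrite ltn_ord /= /bump nth_drop.
have [ji|ij] := leqP j (s i).
  by rewrite add1n addSn subnKC.
by rewrite add0n nth_take.
Qed.

Lemma size_del (T : Type) (k : nat) (I : k.+1.-tuple T) (j : 'I_k.+1) :
  size (del j I) == k.
Proof.
rewrite size_cat size_take size_drop size_tuple ltn_ord subSS.
by rewrite subnKC // -ltnS.
Qed.

Definition alt (R : pzRingType) (T : Type) (f : seq T -> R) k (I : k.-tuple T) : R :=
  \sum_(s : 'S_k) (-1) ^+ s * f [seq tnth I (s i) | i <- enum 'I_k].

(** Laplace expansion along the first slot. For a concrete [k] it unfolds into explicit terms, which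
    the sum over ['S_k] does not. [x0] is the default of [nth]. *)
Fixpoint altrec (R : pzRingType) (T : Type) (x0 : T) (f : seq T -> R) k (I : seq T) : R :=
  if k is k'.+1 then
    \sum_(j < k) (-1) ^+ j *
      altrec x0 (fun J => f (nth x0 I j :: J)) k' (del j I)
  else f [::].

Lemma perm_split_inj k :
  injective (fun js : 'I_k.+1 * 'S_k => lift_perm ord0 js.1 js.2).
Proof.
move=> [j s] [j' s'] /= E.
have jE : j = j' by move: (congr1 (fun t : 'S_k.+1 => t ord0) E); rewrite !lift_perm_id.
rewrite -jE in E *; congr (_, _); apply/permP => i.
move: (congr1 (fun t : 'S_k.+1 => t (lift ord0 i)) E).
by rewrite !lift_perm_lift => /lift_inj.
Qed.

(** Every permutation is uniquely [lift_perm ord0 j s], and its sign is (-1)^j times the sign of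
    s. *)
Lemma alt_rec (R : pzRingType) (T : Type) (x0 : T) (f : seq T -> R) k
    (I : k.-tuple T) : alt f I = altrec x0 f k I.
Proof.
elim: k f I => [|k IH] f I.
  rewrite /alt (bigD1 1%g) //= big1 ?addr0 => [|s /negP[]]; last first.
    by apply/eqP/permP => -[].
  rewrite odd_perm1 mul1r; congr f; apply: size0nil.
  by rewrite size_map -cardE card_ord.
rewrite /alt (reindex (fun js : 'I_k.+1 * 'S_k => lift_perm ord0 js.1 js.2)) /=.
  rewrite -(pair_bigA _ (fun (j : 'I_k.+1) (s : 'S_k) => (-1) ^+ lift_perm ord0 j s *
     f [seq tnth I (lift_perm ord0 j s i) | i <- enum 'I_k.+1])) /=.
  apply: eq_bigr => j _; rewrite -(IH _ (Tuple (size_del I j))) /alt mulr_sumr.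
  apply: eq_bigr => s _; rewrite (map_lift_perm _ (J := Tuple (size_del I j))) //.
  by rewrite odd_lift_perm /= signr_addb signr_odd mulrA (tnth_nth x0).
apply: onW_bij; apply: inj_card_bij; first exact: perm_split_inj.
by rewrite card_prod card_ord !card_Sn factS.
Qed.

End Alternation.

Section Wedge.
Variables (R : realType) (V : normedModType R) (n : nat).
Implicit Types (a b : dform V n).

(** The definition of [wedge] sums over ['S_(size I)]; for a tuple the size is replaced by [k],
    which makes [alt_rec] applicable. *)
Lemma wedge_alt p k a b (I : k.-tuple 'I_n) x :
  wedge p a b I x = ((p`! * (k - p)`!)%:R)^-1 *
    alt (fun J => a (take p J) x * b (drop p J) x) I.
Proof.
rewrite /alt /wedge; case: I => I sI; have Ik : size I = k := eqP sI.
by case: k / Ik sI => sI; have -> : Tuple sI = in_tuple I by apply: val_inj.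
Qed.

Lemma wedge22 b i j k l x : (forall u v, b [:: u; v] x = - b [:: v; u] x) ->
  wedge 2 b b [:: i; j; k; l] x =
  2 * (b [:: i; j] x * b [:: k; l] x - b [:: i; k] x * b [:: j; l] x
       + b [:: i; l] x * b [:: j; k] x).
Proof.
move=> bC; rewrite (wedge_alt 2 b b [tuple i; j; k; l] x) (alt_rec i).
rewrite (_ : (2`! * (4 - 2)`!)%N = 4%N) //=.
rewrite !big_ord_recl !big_ord0 /= /del /= /bump /=.
rewrite (bC j i) (bC k i) (bC l i) (bC k j) (bC l j) (bC l k).
move: (b [:: i; j] x) (b [:: i; k] x) (b [:: i; l] x) (b [:: j; k] x)
  (b [:: j; l] x) (b [:: k; l] x) => *; by field.
Qed.

Lemma wedge13 a b i j k l x :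
  (forall u v t, b [:: u; v; t] x = - b [:: v; u; t] x) ->
  (forall u v t, b [:: u; v; t] x = - b [:: u; t; v] x) ->
  wedge 1 a b [:: i; j; k; l] x =
  a [:: i] x * b [:: j; k; l] x - a [:: j] x * b [:: i; k; l] x
  + a [:: k] x * b [:: i; j; l] x - a [:: l] x * b [:: i; j; k] x.
Proof.
move=> bl br; rewrite (wedge_alt 1 a b [tuple i; j; k; l] x) (alt_rec i).
rewrite (_ : (1`! * (4 - 1)`!)%N = 6%N) //=.
rewrite !big_ord_recl !big_ord0 /= /del /= /bump /=.
have bC u v t : [/\ b [:: v; u; t] x = - b [:: u; v; t] x,
    b [:: u; t; v] x = - b [:: u; v; t] x, b [:: v; t; u] x = b [:: u; v; t] x,
    b [:: t; u; v] x = b [:: u; v; t] x & b [:: t; v; u] x = - b [:: u; v; t] x].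
  rewrite (bl v) (br u t) (br v t) (bl v u) (bl t u) (br u t) (bl t v) (br v t).
  by rewrite (bl v u) !opprK.
have [-> -> -> -> ->] := bC j k l; have [-> -> -> -> ->] := bC i k l.
have [-> -> -> -> ->] := bC i j l; have [-> -> -> -> ->] := bC i j k.
move: (b [:: j; k; l] x) (b [:: i; k; l] x) (b [:: i; j; l] x) (b [:: i; j; k] x)
  (a [:: i] x) (a [:: j] x) (a [:: k] x) (a [:: l] x) => *; by field.
Qed.

End Wedge.

Lemma sum_ltn_half (R : realType) n (F : 'I_n -> 'I_n -> R) :
  (forall a b, F a b = F b a) -> (forall a, F a a = 0) ->
  \sum_(a < n) \sum_(b < n | (a < b)%N) F a b = 2^-1 * \sum_a \sum_b F a b.
Proof.
move=> FC F0; apply: (mulfI (_ : 2 != 0)); first by rewrite pnatr_eq0.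
rewrite mulrA divff ?pnatr_eq0 // mul1r mulr2n mulrDl mul1r.
have E a : \sum_b F a b =
    \sum_(b < n | (a < b)%N) F a b + \sum_(b < n | (b < a)%N) F a b.
  rewrite (bigID (fun b : 'I_n => (a < b)%N)) /=; congr (_ + _).
  rewrite (bigD1 a) ?ltnn //= F0 add0r; apply: eq_bigl => b.
  by rewrite -leqNgt ltn_neqAle andbC.
under [RHS]eq_bigr do rewrite E.
rewrite big_split /=; congr (_ + _).
rewrite (exchange_big_dep xpredT) //=; apply: eq_bigr => a _.
by apply: eq_bigr => b _; rewrite FC.
Qed.

(** * Geometry of a frame with structure functions c w *)

(** Only q = 1 is confined to D. The other fields hold at every point of V, so that what is computed
    from them is an equality of functions and can be differentiated. *)
Record g2_frame (R : realType) (V : normedModType R) n (M : framed V n) (D : set V)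
    (c : R) (d : 'I_n -> 'I_n -> R) (w : 'I_n -> 'I_n -> 'I_n -> V -> R)
    (p : 'I_n -> 'I_n -> 'I_n -> 'I_n -> V -> R) (q : V -> R) : Prop := G2Frame {
  g2f_tensors : forall y, g2_tensors d (fun i j k => w i j k y)
    (fun i j k l => p i j k l y) (q y) ;
  g2f_q : forall y, D y -> q y = 1 ;
  g2f_struct : forall i j k y, struct M i j k y = c * w i j k y ;
  g2f_Dq : forall m y, is_derive y (fr M m y) q 0 ;
  g2f_Dw : forall m i j k y, is_derive y (fr M m y) (w i j k) (c * p m i j k y) ;
  g2f_Dp : forall m i j k l y, is_derive y (fr M m y) (p i j k l)
    (- c * (d m i * w j k l y - d m j * w i k l y + d m k * w i j l y
            - d m l * w i j k y)) }.

Section Geometry.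
Variables (R : realType) (V : normedModType R) (n : nat) (M : framed V n).
Variables (D : set V) (c : R) (d : 'I_n -> 'I_n -> R).
Variables (w : 'I_n -> 'I_n -> 'I_n -> V -> R).
Variables (p : 'I_n -> 'I_n -> 'I_n -> 'I_n -> V -> R) (q : V -> R).
Hypothesis G : g2_frame M D c d w p q.

Let T y := g2f_tensors G y.

Definition Delta i j k l : R := d i k * d j l - d j k * d i l.

(** By total skewness of w the three terms in Koszul's formula are c w, - c w and c w. *)
Lemma g2_lc i j k x : lc M i j k x = c / 2 * w i j k x.
Proof.
rewrite /lc !(g2f_struct G) (w_cyc (T x) k i j) (w_cyc (T x) i j k); ring.
Qed.

Definition w3form t : dform V n := fun I y =>
  if I is [:: i; j; k] then t * w i j k y else 0.

Lemma g2_tconn t : tconn M (w3form t) = fun i j k y => (c / 2 + t / 2) * w i j k y.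
Proof.
apply/funext => i; apply/funext => j; apply/funext => k; apply/funext => y.
by rewrite /tconn /= g2_lc; ring.
Qed.

(** The derivatives contribute 2 c g p. The quadratic terms and the bracket term are contractions of
    w with w, which bring the powers of q; these are kept because the curvature is differentiated in
    [D_g2_curv]. *)
Lemma g2_curv g m l a b y : curv M (fun i j k y => g * w i j k y) m l a b y =
  (g ^+ 2 - c * g) * q y ^+ 2 * Delta m l a b
  + (2 * c * g - (2 * g ^+ 2 + c * g) * q y) * p m l a b y.
Proof.
have DG i j k e : 'D_(fr M i y) (fun y => g * w j k e y) y = g * (c * p i j k e y).
  have H : is_derive y (fr M i y) (w j k e) (c * p i j k e y) by exact: g2f_Dw G _ _ _ _ _.
  have -> : (fun y => g * w j k e y) = g *: w j k e by [].
  by rewrite deriveZ ?derive_val.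
rewrite /curv !DG.
transitivity (2 * c * g * p m l a b y
   + g ^+ 2 * (- (\sum_s w l a s y * w m b s y) + \sum_s w m a s y * w l b s y)
   - c * g * \sum_s w m l s y * w a b s y).
  congr (_ + _ - _).
  - by rewrite (g2_pl (T y) l); ring.
  - rewrite -sumrN -big_split mulr_sumr; apply: eq_bigr => s _ /=.
    by rewrite (g2_wr (T y) m s) (g2_wr (T y) l s); ring.
  - rewrite mulr_sumr; apply: eq_bigr => s _.
    by rewrite (g2f_struct G) (w_cyc (T y) s); ring.
rewrite !(g2_ww (T y)) (g2_pm (T y) l a) (g2_pl (T y) l m) (g2_pm (T y) m a).
by rewrite (g2_dC (T y) l m) (g2_dC (T y) a m) (g2_dC (T y) a l) /Delta; ring.
Qed.

Lemma D_w3form t m i j k y :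
  'D_(fr M m y) (w3form t [:: i; j; k]) y = t * c * p m i j k y.
Proof.
have H := g2f_Dw G m i j k y.
have -> : w3form t [:: i; j; k] = t *: w i j k by [].
by rewrite deriveZ ?derive_val //; exact: mulrA.
Qed.

(** Each of the four derivatives gives t c p and each of the six bracket terms removes t c q p; the
    metric parts of the latter cancel. *)
Lemma extd_w3form t i j k l y : extd M (w3form t) [:: i; j; k; l] y =
  t * c * (4 - 6 * q y) * p i j k l y.
Proof.
have S a b e f : \sum_s struct M a b s y * (t * w s e f y) =
    t * c * (q y * p a b e f y + q y ^+ 2 * Delta a b e f).
  rewrite /Delta (mulrC (d b e)) -(g2_ww (T y)) mulr_sumr; apply: eq_bigr => s _.
  by rewrite (g2f_struct G) (w_cyc (T y) s); ring.
rewrite extd4 !D_w3form /= !S (g2_pl (T y) j i) (g2_pl (T y) k i) (g2_pm (T y) i k j).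
rewrite (g2_pl (T y) l i) (g2_pm (T y) i l j) (g2_pr (T y) i j l k).
rewrite (g2_pm (T y) j k i) (g2_pl (T y) j i).
rewrite (g2_pm (T y) j l i) (g2_pl (T y) j i) (g2_pr (T y) i j l k).
rewrite (p_pair (T y) k) /Delta (g2_dC (T y) l k) (g2_dC (T y) k j).
rewrite (g2_dC (T y) l j) (g2_dC (T y) j i) (g2_dC (T y) k i) (g2_dC (T y) l i).
by ring.
Qed.

Definition gcurv A B : curvature V n := fun m l a b y =>
  A * Delta m l a b + B * p m l a b y.

Lemma gcurv_skewl A B m l a b y : gcurv A B m l a b y = - gcurv A B l m a b y.
Proof. by rewrite /gcurv /Delta (g2_pl (T y) m); ring. Qed.

Lemma gcurv_skewr A B m l a b y : gcurv A B m l a b y = - gcurv A B m l b a y.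
Proof. by rewrite /gcurv /Delta (g2_pr (T y) m); ring. Qed.

Lemma gcurv_pair A B m l a b y : gcurv A B m l a b y = gcurv A B a b m l y.
Proof.
rewrite /gcurv /Delta (p_pair (T y) m) !(g2_dC (T y) m) !(g2_dC (T y) l); ring.
Qed.

Lemma d_gcurv1 A B m l a b y :
  \sum_s d s m * gcurv A B s l a b y = gcurv A B m l a b y.
Proof.
rewrite /gcurv -[in RHS](d_p1 (T y)) /Delta.
rewrite -[d m a](d_d (T y)) -[d m b](d_d (T y)) !mulr_suml mulrBr !mulr_sumr.
rewrite -sumrB -big_split /=; apply: eq_bigr => s _.
by ring.
Qed.

Lemma d_gcurv2 A B m l a b y :
  \sum_s d s l * gcurv A B m s a b y = gcurv A B m l a b y.
Proof.
rewrite gcurv_skewl -d_gcurv1 -sumrN; apply: eq_bigr => s _.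
by rewrite gcurv_skewl mulrN.
Qed.

Lemma d_gcurv3 A B m l a b y :
  \sum_s d s a * gcurv A B m l s b y = gcurv A B m l a b y.
Proof.
by rewrite gcurv_pair -d_gcurv1; apply: eq_bigr => s _; rewrite (gcurv_pair _ _ m).
Qed.

Lemma d_gcurv4 A B m l a b y :
  \sum_s d s b * gcurv A B m l a s y = gcurv A B m l a b y.
Proof.
by rewrite gcurv_pair -d_gcurv2; apply: eq_bigr => s _; rewrite (gcurv_pair _ _ m).
Qed.

Lemma sum_gcurv A B y i j k l : q y = 1 ->
  \sum_a \sum_b gcurv A B i j a b y * gcurv A B k l a b y =
  (2 * A ^+ 2 + 4 * B ^+ 2) * Delta i j k l + (4 * A * B + 2 * B ^+ 2) * p i j k l y.
Proof.
move=> q1.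
transitivity (\sum_a \sum_b (
    A * (d a i * (d b j * gcurv A B k l a b y)) - A * (d a j * (d b i * gcurv A B k l a b y))
    + B * A * (d a k * (d b l * p i j a b y)) - B * A * (d a l * (d b k * p i j a b y))
    + B ^+ 2 * (p i j a b y * p a b k l y))).
  apply: eq_bigr => a _; apply: eq_bigr => b _; rewrite -(p_pair (T y) k) /gcurv /Delta.
  rewrite !(g2_dC (T y) _ a) !(g2_dC (T y) _ b); ring.
under eq_bigr do rewrite big_split sumrB big_split sumrB /= -!mulr_sumr
  !d_gcurv4 !(d_p4 (T y)).
rewrite big_split sumrB big_split sumrB /= -!mulr_sumr.
rewrite !d_gcurv3 !(d_p3 (T y)) (sum_p_ijab_p_abkl (T y)) //.
rewrite (gcurv_skewr _ _ _ _ j) (g2_pr (T y) i j l) (gcurv_pair _ _ k) /gcurv /Delta.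
by ring.
Qed.

(** Of the three pairings in the wedge square, the [Delta] parts cancel by the first Bianchi
    identity for constant curvature, and the p parts agree, which gives three times the coefficient
    in [sum_gcurv]. *)
Lemma TrFF_gcurv A B i j k l y : q y = 1 ->
  TrFF (gcurv A B) [:: i; j; k; l] y = (12 * A * B + 6 * B ^+ 2) * p i j k l y.
Proof.
move=> q1; rewrite /TrFF.
pose F a b : R := wedge 2 (curv2form (gcurv A B) a b) (curv2form (gcurv A B) a b)
  [:: i; j; k; l] y.
have FE a b : F a b = 2 * (gcurv A B i j a b y * gcurv A B k l a b y
    - gcurv A B i k a b y * gcurv A B j l a b y + gcurv A B i l a b y * gcurv A B j k a b y).
  by rewrite /F wedge22 // => u v; exact: gcurv_skewl.
have FC a b : F a b = F b a.
  by rewrite !FE !(gcurv_skewr _ _ _ _ a b); ring.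
have F0 a : F a a = 0.
  have H u v : gcurv A B u v a a y = 0 by apply/skew_eq0/gcurv_skewr.
  by rewrite FE !H; ring.
transitivity (2^-1 * \sum_a \sum_b F a b); first exact: sum_ltn_half.
under eq_bigr do under eq_bigr do rewrite FE.
under eq_bigr do rewrite -mulr_sumr big_split sumrB /=.
rewrite -mulr_sumr big_split sumrB /= !sum_gcurv // (g2_pm (T y) i k).
rewrite (g2_pm (T y) i l) (g2_pr (T y) i j l) /Delta.
rewrite (g2_dC (T y) k j) (g2_dC (T y) l j) (g2_dC (T y) l k).
by field.
Qed.

(** With q = 1 the connection g w differentiates w to (c - 3 g) p, so g = c/3; as g = c/2 + t/2, the
    torsion coefficient is t = - c/3. *)
Definition g2_torsion : dform V n := w3form (- (c / 3)).

Lemma g2_tconn_torsion : tconn M g2_torsion = fun i j k y => (c / 3) * w i j k y.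
Proof.
rewrite g2_tconn; do 3 apply/funext => ?; apply/funext => y.
by congr (_ * _); field.
Qed.

Lemma g2_tconn_opp_torsion : tconn M (fun J y => - g2_torsion J y) =
  fun i j k y => (2 * c / 3) * w i j k y.
Proof.
do 3 apply/funext => ?; apply/funext => y.
by rewrite /tconn /= g2_lc; field.
Qed.

Lemma g2_curv_torsion m l a b y : D y ->
  curv M (tconn M g2_torsion) m l a b y = gcurv (- (2 * c ^+ 2 / 9)) (c ^+ 2 / 9) m l a b y.
Proof.
by move=> Dy; rewrite g2_tconn_torsion g2_curv (g2f_q G) // /gcurv; field.
Qed.

Lemma g2_curv_opp_torsion m l a b y : D y ->
  curv M (tconn M (fun J y => - g2_torsion J y)) m l a b y =
  gcurv (- (2 * c ^+ 2 / 9)) (- (2 * c ^+ 2 / 9)) m l a b y.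
Proof.
by move=> Dy; rewrite g2_tconn_opp_torsion g2_curv (g2f_q G) // /gcurv; field.
Qed.

Lemma eq_TrFF (F F' : curvature V n) I y :
  (forall m l a b, F m l a b y = F' m l a b y) -> TrFF F I y = TrFF F' I y.
Proof.
move=> FF'; apply: eq_bigr => a _; apply: eq_bigr => b _.
have E J : curv2form F a b J y = curv2form F' a b J y.
  by case: J => [|m [|l []]] //=.
by rewrite /wedge; congr (_ * _); apply: eq_bigr => s _; rewrite !E.
Qed.

Hypothesis c_neq0 : c != 0.

(** Here dT = (2/3) c^2 p and, with A = -(2/9) c^2 and B = c^2/9, the trace is (12 A B + 6 B^2) p =
    -(2/9) c^4 p. *)
Lemma g2_bianchi1 : bianchi1 M D g2_torsion (curv M (tconn M g2_torsion))
  (- (3 / (2 * c ^+ 2))).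
Proof.
move=> y [|i [|j [|k [|l []]]]] // Dy _.
rewrite (eq_TrFF (F' := gcurv (- (2 * c ^+ 2 / 9)) (c ^+ 2 / 9))); last first.
  by move=> *; exact: g2_curv_torsion.
rewrite TrFF_gcurv ?extd_w3form ?(g2f_q G) //.
by move: (p _ _ _ _ _) => u; field.
Qed.

(** For the opposite torsion A = B = -(2/9) c^2, so its trace is (8/9) c^4 p and the difference of
    traces is -(10/9) c^4 p. *)
Lemma g2_bianchi2 : bianchi2 M D g2_torsion (curv M (tconn M g2_torsion))
  (- (3 / (10 * c ^+ 2))).
Proof.
move=> y [|i [|j [|k [|l []]]]] // Dy _.
rewrite (eq_TrFF (F' := gcurv (- (2 * c ^+ 2 / 9)) (c ^+ 2 / 9))); last first.
  by move=> *; exact: g2_curv_torsion.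
rewrite (eq_TrFF (F := curv M (tconn M (fun J y => - g2_torsion J y)))
  (F' := gcurv (- (2 * c ^+ 2 / 9)) (- (2 * c ^+ 2 / 9)))); last first.
  by move=> *; exact: g2_curv_opp_torsion.
rewrite !TrFF_gcurv ?extd_w3form ?(g2f_q G) //.
by move: (p _ _ _ _ _) => u; field.
Qed.

Lemma cov_w m i j k y : D y ->
  cov M (tconn M g2_torsion) m (w3form 1) [:: i; j; k] y = 0.
Proof.
move=> Dy; have q1 := g2f_q G Dy; rewrite cov3 D_w3form g2_tconn_torsion /=.
have S (u v s e : 'I_n) (f : 'I_n -> R) : (forall s', f s' = w s e s' y) ->
    \sum_s' c / 3 * w u v s' y * (1 * f s') = c / 3 * (p u v s e y + Delta u v s e).
  move=> fE; transitivity (c / 3 * \sum_s' w u v s' y * w s e s' y).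
    by rewrite mulr_sumr; apply: eq_bigr => s' _; rewrite fE; ring.
  by rewrite (g2_ww (T y)) q1 /Delta; ring.
rewrite (S m i j k) => [|s]; last by rewrite (w_cyc (T y) s).
rewrite (S m j k i) => [|s]; last by rewrite (w_cyc (T y) k).
rewrite (S m k i j) // (g2_pr (T y) m j k) (g2_pm (T y) m j i) (g2_pm (T y) m k i).
rewrite (g2_pr (T y) m i k j) /Delta (g2_dC (T y) k j) (g2_dC (T y) k i) (g2_dC (T y) j i).
by field.
Qed.

End Geometry.

(** * Equations of motion for a dilaton whose gradient lies in the kernel of d *)

Section EquationsOfMotion.
Variables (R : realType) (V : normedModType R) (n : nat) (M : framed V n).
Variables (D : set V) (c : R) (d : 'I_n -> 'I_n -> R).
Variables (w : 'I_n -> 'I_n -> 'I_n -> V -> R).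
Variables (p : 'I_n -> 'I_n -> 'I_n -> 'I_n -> V -> R) (q : V -> R).
Hypothesis G : g2_frame M D c d w p q.
Hypothesis c_neq0 : c != 0.
Variables (phi : V -> R) (f : 'I_n -> R).
Hypothesis Dphi : forall m y, is_derive y (fr M m y) phi (f m).
Hypothesis Dexp : forall m y, is_derive y (fr M m y)
  (fun y => expR (- 2 * phi y)) (- 2 * f m * expR (- 2 * phi y)).
Hypothesis f_d : forall m i, f m * d m i = 0.
Hypothesis f_sqr : \sum_m f m ^+ 2 = 49 / 36 * c ^+ 2.

Let T y := g2f_tensors G y.

(** w is unchanged by contraction with d, which the gradient annihilates. This removes the dilaton
    from the flux equation, and [f_gcurv] removes it from the gauge equation. *)
Lemma f_w m i j y : f m * w m i j y = 0.
Proof.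
rewrite -(d_w1 (T y)) mulr_sumr big1 // => s _.
by rewrite (g2_dC (T y)) mulrA f_d mul0r.
Qed.

Lemma f_gcurv m A B i j k y : f m * gcurv d p A B m i j k y = 0.
Proof.
rewrite -(d_gcurv1 G) mulr_sumr big1 // => s _.
by rewrite (g2_dC (T y)) mulrA f_d mul0r.
Qed.

(** The p part of the curvature has no trace. The rest is constant curvature c^2/4, whose trace is
    (7 - 1) c^2/4. *)
Lemma g2_ricci m l y : D y -> ricci M m l y = 3 / 2 * c ^+ 2 * d m l.
Proof.
move=> Dy; have q1 := g2f_q G Dy; rewrite /ricci.
have -> : lc M = fun i j k y => c / 2 * w i j k y.
  by do 3 apply/funext => ?; apply/funext => z; exact: (g2_lc G).
transitivity (- (c ^+ 2 / 4) * (\sum_s d s l * d s m - d m l * \sum_s d s s)).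
  rewrite mulr_sumr -sumrB mulr_sumr; apply: eq_bigr => s _.
  rewrite (g2_curv G) q1 /Delta (p_ijki (T y)) (g2_dC (T y) m s); by field.
by rewrite (d_d (T y)) (g2_tr (T y)) (g2_dC (T y) l); field.
Qed.

(** The components of the gradient are constant, and the connection term contracts the gradient with
    w. *)
Lemma g2_hess m l y : hess M phi m l y = 0.
Proof.
have DE i z : dfun M phi [:: i] z = f i by rewrite extd1; case: (Dphi i z).
rewrite /hess cov1.
have -> : dfun M phi [:: l] = fun=> f l by apply/funext => z; exact: DE.
rewrite derive_cst big1 ?subr0 // => s _.
rewrite DE (g2_lc G) (w_cyc (T y)) (w_cyc (T y)) mulrC mulrCA f_w mulr0 //.
Qed.

Lemma g2_sum_trF m l y : D y ->
  \sum_s trF (curv M (tconn M (g2_torsion c w))) m s l s y = 4 / 9 * c ^+ 4 * d m l.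
Proof.
move=> Dy; have q1 := g2f_q G Dy.
pose F := gcurv d p (- (2 * c ^+ 2 / 9)) (c ^+ 2 / 9).
have E s : trF (curv M (tconn M (g2_torsion c w))) m s l s y =
    2^-1 * \sum_a \sum_b F m s a b y * F l s a b y.
  rewrite /trF -sum_ltn_half => [|a b|a].
  - do 2!apply: eq_bigr => ? _.
    by rewrite !(g2_curv_torsion G).
  - by rewrite /F !(gcurv_skewr G _ _ _ _ a); ring.
  - have H u v : F u v a a y = 0 by apply/skew_eq0/(gcurv_skewr G).
    by rewrite !H mul0r.
under eq_bigr do rewrite E (sum_gcurv G) // /Delta (p_ijkj (T y)).
transitivity (2^-1 * ((2 * (- (2 * c ^+ 2 / 9)) ^+ 2 + 4 * (c ^+ 2 / 9) ^+ 2)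
   * (d m l * (\sum_s d s s) - \sum_s d s l * d s m))).
  rewrite mulr_sumr -sumrB mulr_sumr mulr_sumr; apply: eq_bigr => s _.
  by rewrite (g2_dC (T y) m s); ring.
by rewrite (d_d (T y)) (g2_tr (T y)) (g2_dC (T y) l); field.
Qed.

Let A := - (2 * c ^+ 2 / 9).
Let B := c ^+ 2 / 9.

(** The curvature 2-form lies in g_2: its contraction with w is (2 A + 4 B) w, and 2 A + 4 B = 0.
    This is also what the gaugino equation rests on. *)
Lemma sum_w_gcurv_eq0 l a b y : D y ->
  \sum_i \sum_j w l i j y * gcurv d p A B i j a b y = 0.
Proof.
move=> Dy; have q1 := g2f_q G Dy.
transitivity (\sum_i (A * (d i a * w l i b y - d i b * w l i a y)
   + B * \sum_j w l i j y * p i j a b y)).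
  apply: eq_bigr => i _; rewrite mulr_sumr.
  transitivity (\sum_j (A * d i a * (d j b * w l i j y) - A * d i b * (d j a * w l i j y)
      + B * (w l i j y * p i j a b y))).
    by apply: eq_bigr => j _; rewrite /gcurv /Delta; by ring.
  rewrite big_split sumrB /= -!mulr_sumr !(d_w3 (T y)); by ring.
rewrite big_split /= -mulr_sumr sumrB !(d_w2 (T y)) -mulr_sumr.
rewrite (sum_w_iab_p_abkl (T y)) q1 (g2_wr (T y) l b) /A /B; by field.
Qed.

Lemma sum_w_gcurv_mixed l a b y : D y ->
  \sum_i \sum_j w i a j y * gcurv d p A B i l j b y = (A - 4 * B) * w l a b y.
Proof.
move=> Dy; have q1 := g2f_q G Dy.
transitivity (\sum_i (- A * (d i b * w i a l y) + B * \sum_j w a i j y * p i j l b y)).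
  apply: eq_bigr => i _; rewrite mulr_sumr.
  transitivity (\sum_j (A * d l b * (d j i * w i a j y) - A * d i b * (d j l * w i a j y)
      + B * (w a i j y * p i j l b y))).
    apply: eq_bigr => j _; rewrite /gcurv /Delta (g2_pm (T y) i l) (g2_wl (T y) i).
    by rewrite (g2_dC (T y) i j) (g2_dC (T y) l j); ring.
  rewrite big_split sumrB /= -!mulr_sumr !(d_w3 (T y)) (w_iji (T y)); by ring.
rewrite big_split /= -!mulr_sumr (d_w1 (T y)) (sum_w_iab_p_abkl (T y)) q1.
rewrite !(w_sort (T y) l a b) /A /B; by field.
Qed.

(** Off D the curvature depends on q, but q is constant along the frame; so only p is
    differentiated, and its coefficient becomes B where q = 1. *)
Lemma D_g2_curv s m l a b y : D y ->
  is_derive y (fr M s y) (curv M (tconn M (g2_torsion c w)) m l a b)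
    (- c * B * (d s m * w l a b y - d s l * w m a b y
                + d s a * w m l b y - d s b * w m l a y)).
Proof.
move=> Dy; have q1 := g2f_q G Dy.
have H2 := g2f_Dp G s m l a b y; have H3 := g2f_Dq G s y.
have -> : curv M (tconn M (g2_torsion c w)) m l a b =
    (((c / 3) ^+ 2 - c * (c / 3)) * Delta d m l a b) *: (q * q)
    + (2 * c * (c / 3)) *: p m l a b
    - (2 * (c / 3) ^+ 2 + c * (c / 3)) *: (q * p m l a b).
  apply/funext => z; rewrite (g2_tconn_torsion G) (g2_curv G).
  rewrite -[RHS]/(((c / 3) ^+ 2 - c * (c / 3)) * Delta d m l a b * (q z * q z)
    + (2 * c * (c / 3)) * p m l a b z
    - (2 * (c / 3) ^+ 2 + c * (c / 3)) * (q z * p m l a b z)).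
  by ring.
have K := is_deriveB (is_deriveD (is_deriveZ (((c / 3) ^+ 2 - c * (c / 3))
    * Delta d m l a b) (is_deriveM H3 H3)) (is_deriveZ (2 * c * (c / 3)) H2))
  (is_deriveZ (2 * (c / 3) ^+ 2 + c * (c / 3)) (is_deriveM H3 H2)).
apply: is_derive_eq K _; rewrite q1 !scaler0 addr0 scale1r /GRing.scale /= /B.
by rewrite mulr0; field.
Qed.

Lemma D_exp_g2_curv m l a b x : D x ->
  'D_(fr M m x) (fun y => expR (- 2 * phi y)
        * curv M (tconn M (g2_torsion c w)) m l a b y) x =
  - c * B * expR (- 2 * phi x) * (w l a b x * d m m - d m l * w m a b x
                   + d m a * w m l b x - d m b * w m l a x).
Proof.
move=> Dx; have H1 := Dexp m x; have H2 := D_g2_curv m m l a b Dx.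
have -> : (fun y => expR (- 2 * phi y) * curv M (tconn M (g2_torsion c w)) m l a b y)
  = (fun y => expR (- 2 * phi y)) * curv M (tconn M (g2_torsion c w)) m l a b by [].
rewrite deriveM // !derive_val (g2_curv_torsion G) //.
rewrite -[LHS]/(expR (-2 * phi x) * (- c * B * (d m m * w l a b x - d m l * w m a b x
   + d m a * w m l b x - d m b * w m l a x)) + gcurv d p A B m l a b x * (-2 * f m * expR (-2 * phi x))).
have -> : gcurv d p A B m l a b x * (-2 * f m * expR (-2 * phi x)) =
  (-2 * expR (-2 * phi x)) * (f m * gcurv d p A B m l a b x) by ring.
by rewrite f_gcurv; ring.
Qed.

Lemma g2_equations_of_motion :
  equations_of_motion M D (g2_torsion c w) (tconn M (g2_torsion c w)) phi
    (- (3 / (2 * c ^+ 2))).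
Proof.
split.
- move=> x m l Dx; have q1 := g2f_q G Dx.
  rewrite g2_ricci // g2_hess g2_sum_trF //=.
  have -> : \sum_i \sum_j - (c / 3) * w m i j x * (- (c / 3) * w l i j x) =
      (c / 3) ^+ 2 * (6 * d m l).
    transitivity ((c / 3) ^+ 2 * \sum_i \sum_j w m i j x * w l i j x).
      rewrite mulr_sumr; apply: eq_bigr => i _; rewrite mulr_sumr.
      by apply: eq_bigr => j _; ring.
    by rewrite (sum_w_iab_w_jab (T x)) q1 expr1n mulr1.
  (* In units of c^2 d the three nonzero terms are 3/2, - 1/6 and - 4/3. *)
  by move: (d m l) => dml; by field.
(* The flux equation holds for each m separately: p with a repeated index vanishes, and the two
   surviving connection terms cancel each other. *)
- move=> x l e Dx; rewrite big1 // => m _; rewrite cov3 /=.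
  have -> : 'D_(fr M m x) (fun y => expR (- 2 * phi y) * (- (c / 3) * w m l e y)) x = 0.
    have H1 := Dexp m x; have H2 := g2f_Dw G m m l e x.
    have -> : (fun y => expR (- 2 * phi y) * (- (c / 3) * w m l e y)) =
        (fun y => expR (- 2 * phi y)) * (- (c / 3) *: w m l e) by [].
    rewrite deriveM // deriveZ // !derive_val (p_iijk (T x)) mulr0 !scaler0 add0r.
    rewrite -[LHS]/(- (c / 3) * w m l e x * (- 2 * f m * expR (- 2 * phi x))).
    transitivity (2 * (c / 3) * expR (- 2 * phi x) * (f m * w m l e x)); first by ring.
    by rewrite f_w mulr0.
  rewrite [X in X + _ + _]big1 => [|s _]; last by rewrite (g2_lc G) (w_iij (T x)); ring.
  rewrite sub0r add0r -big_split big1 ?oppr0 // => s _ /=; rewrite !(g2_lc G).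
  by rewrite (g2_wr (T x) m s); ring.
- move=> x l a b Dx; have q1 := g2f_q G Dx.
  have FE i j u v : curv M (tconn M (g2_torsion c w)) i j u v x = gcurv d p A B i j u v x.
    exact: (g2_curv_torsion G).
  rewrite [X in _ + X](_ : _ = 0) ?addr0; last first.
    transitivity (2^-1 * expR (- 2 * phi x) * (- (c / 3) *
        \sum_i \sum_j w l i j x * gcurv d p A B i j a b x)).
      congr (_ * _); rewrite mulr_sumr; apply: eq_bigr => i _; rewrite mulr_sumr.
      by apply: eq_bigr => j _; rewrite FE /= mulrA.
    by rewrite sum_w_gcurv_eq0 // !mulr0.
  set e := expR (- 2 * phi x).
  (* The Levi-Civita term on the contracted index vanishes because w_mm = 0. The three sums are the
     Levi-Civita term on l and the two gauge terms. *)
  transitivity (\sum_m e * (- c * B * (w l a b x * d m m - d m l * w m a b x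
      + d m a * w m l b x - d m b * w m l a x)
    + c / 2 * (\sum_i w l m i x * gcurv d p A B m i a b x)
    - c / 3 * (\sum_i w m a i x * gcurv d p A B m l i b x)
    + c / 3 * (\sum_i w m b i x * gcurv d p A B m l i a x))).
    apply: eq_bigr => m _; rewrite /gauge_cov.
    rewrite D_exp_g2_curv // !mulr_sumr.
    transitivity (e * (- c * B * (w l a b x * d m m - d m l * w m a b x
      + d m a * w m l b x - d m b * w m l a x))
      - \sum_i (- (e * (c / 2 * (w l m i x * gcurv d p A B m i a b x)
         - c / 3 * (w m a i x * gcurv d p A B m l i b x)
         + c / 3 * (w m b i x * gcurv d p A B m l i a x))))).
      congr (_ - _); first by rewrite /e; ring.
      apply: eq_bigr => i _; rewrite !FE !(g2_lc G) (w_iij (T x)).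
      rewrite (g2_tconn_torsion G) (gcurv_skewr G _ _ m l a i) (g2_wl (T x) m l).
      rewrite /e; move: (gcurv _ _ _ _ m i a b x) (gcurv _ _ _ _ m l i b x).
      by move: (gcurv _ _ _ _ m l i a x) (expR _) => *; ring.
    by rewrite sumrN opprK -[X in _ + X]mulr_sumr -mulrDr big_split sumrB /= !addrA.
  rewrite -mulr_sumr big_split sumrB big_split /= -!mulr_sumr.
  rewrite (sum_w_gcurv_eq0 l a b) // !sum_w_gcurv_mixed //.
  rewrite sumrB big_split sumrB /= -mulr_sumr !(d_w1 (T x)) (g2_tr (T x)).
  (* The derivatives give - c B (7 - 3) w and the two gauge terms - (2/3) c (A - 4 B) w; they cancel
     since A = - 2 B. *)
  rewrite !(w_sort (T x) l a b) /A /B; move: (w l a b x) => u; by field.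
- move=> x Dx; have q1 := g2f_q G Dx; rewrite /scalar_curv.
  under eq_bigr do rewrite g2_ricci //.
  under [X in _ + 4 * X]eq_bigr do rewrite g2_hess.
  have Df m : 'D_(fr M m x) phi x = f m by case: (Dphi m x).
  under [X in _ - 4 * X]eq_bigr => m _ do rewrite Df.
  have -> : \sum_m \sum_s trF (curv M (tconn M (g2_torsion c w))) m s m s x =
      4 / 9 * c ^+ 4 * 7.
    rewrite -(g2_tr (T x)) mulr_sumr; apply: eq_bigr => m _; exact: g2_sum_trF.
  have -> : \sum_m \sum_i \sum_j g2_torsion c w [:: m; i; j] x ^+ 2 = (c / 3) ^+ 2 * 42.
    transitivity ((c / 3) ^+ 2 * \sum_m \sum_i \sum_j w m i j x * w m i j x).
      rewrite mulr_sumr; apply: eq_bigr => m _; rewrite mulr_sumr.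
      apply: eq_bigr => i _; rewrite mulr_sumr; apply: eq_bigr => j _ /=; by ring.
    by rewrite (sum_w (T x)) q1 expr1n mulr1.
  (* In units of c^2 the scalar curvature is 21/2, the flux term - 7/18 and the gauge term - 14/3.
     They leave 49/9, which equals four times the squared gradient; this is the origin of
     [f_sqr]. *)
  by rewrite -mulr_sumr (g2_tr (T x)) big1_eq f_sqr; field.
Qed.

End EquationsOfMotion.

(** * Derivatives along the frame of the sphere *)

Section Derivatives.
Variable R : realType.

Lemma is_derive_linear (V W : normedModType R) (f : V -> W) (x v : V) :
  linear f -> is_derive x v f (f v).
Proof.
move=> lf.
have E (h : R) : h != 0 -> h^-1 *: (f (h *: v + x) - f x) = f v.
  by move=> h0; rewrite lf addrK scalerA mulVf // scale1r.
have C : (fun h : R => h^-1 *: (f (h *: v + x) - f x)) @ 0^' --> f v.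
  apply: cvg_near_cst.
  by near=> h; rewrite E //; near: h; exact: nbhs_dnbhs_neq.
apply: DeriveDef; first by apply/cvg_ex; exists (f v).
exact: cvg_lim C.
Unshelve. all: end_near. Qed.

Lemma is_derive_coord (N : nat) (a : 'I_N) (x v : 'cV[R]_N) :
  is_derive x v (fun y : 'cV[R]_N => y a 0) (v a 0).
Proof. by apply: (is_derive_linear (W := R^o)) => k u z; rewrite !mxE. Qed.

Lemma is_derive_qform (K : 'M[R]_8) (x v : 'cV[R]_8) :
  is_derive x v (qform K) ((v^T *m K *m x) 0 0 + (x^T *m K *m v) 0 0).
Proof.
have E : qform K = \sum_(a < 8) \sum_(b < 8) K a b *:
    ((fun y : 'cV[R]_8 => y a 0) * (fun y : 'cV[R]_8 => y b 0)).
  apply/funext => y; rewrite /qform mxE fct_sumE.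
  under eq_bigr do rewrite mxE mulr_suml.
  rewrite exchange_big; apply: eq_bigr => a _; rewrite fct_sumE.
  by apply: eq_bigr => b _ /=; rewrite !mxE mulrAC [RHS]mulrC.
have -> : (v^T *m K *m x) 0 0 + (x^T *m K *m v) 0 0 =
    \sum_(a < 8) \sum_(b < 8) K a b *: (x a 0 *: v b 0 + x b 0 *: v a 0).
  have F (u z : 'cV[R]_8) : (u^T *m K *m z) 0 0 =
      \sum_(a < 8) \sum_(b < 8) K a b * (u a 0 * z b 0).
    rewrite mxE; under eq_bigr do rewrite mxE mulr_suml.
    rewrite exchange_big; apply: eq_bigr => a _; apply: eq_bigr => b _ /=.
    by rewrite !mxE mulrAC mulrC.
  rewrite !F -big_split; apply: eq_bigr => a _ /=.
  by rewrite -big_split; apply: eq_bigr => b _ /=; rewrite /GRing.scale /=; ring.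
rewrite E; apply: is_derive_sum => a; apply: is_derive_sum => b.
exact: is_deriveZ (is_deriveM (is_derive_coord _ _ _) (is_derive_coord _ _ _)).
Qed.

Lemma is_derive_dot (x v : 'cV[R]_8) :
  is_derive x v (fun y => dot y y) (2 * dot x v).
Proof.
have -> : (fun y : 'cV[R]_8 => dot y y) = qform 1%:M.
  by apply/funext => y; rewrite qform1.
apply: is_derive_eq (is_derive_qform _ _ _) _.
by rewrite !mulmx1 -/(dot v x) -/(dot x v) dotC; ring.
Qed.

(** As E_m is skew, differentiating the form of K along E_m x gives the form of the commutator K E_m
    - E_m K. *)
Lemma is_derive_qs s m (a : R) (x : 'cV[R]_8) :
  is_derive x (a *: (octL R (lift ord0 m) *m x)) (qs s)
    (a * (qs (rcons s m) x - qs (m :: s) x)).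
Proof.
apply: is_derive_eq (is_derive_qform _ _ _) _.
set L := octL R _.
have -> : (a *: (L *m x))^T = - a *: (x^T *m L).
  rewrite scaleNr -scalerN -mulmxN -E_skew -trmx_mul.
  by apply/matrixP => u z; rewrite !mxE.
rewrite -!scalemxAl -scalemxAr [X in X + _]mxE [X in _ + X]mxE /qs /qform.
by rewrite -cats1 cprod_cat /= mulmx1 !mulmxA; ring.
Qed.

Variable r : R.
Hypothesis r_neq0 : r != 0.
Let c := - (2 / r).

Lemma is_derive_sq m (x : 'cV[R]_8) : is_derive x (fr (sphere7 r) m x) (sq r) 0.
Proof.
have -> : sq r = (r ^- 2) *: (fun y : 'cV[R]_8 => dot y y) by [].
apply: is_derive_eq (is_deriveZ _ (is_derive_dot _ _)) _.
by rewrite /= dotC dotZl dotC (dot_E m) !mulr0 scaler0.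
Qed.

(** E_m anticommutes with a product of three generators up to shorter products, so the commutator
    doubles the product of four. This factor, with the 1/r of the frame, gives c = - 2/r. *)
Lemma is_derive_w7 m i j k (x : 'cV[R]_8) :
  is_derive x (fr (sphere7 r) m x) (w7 r i j k) (c * p7 r m i j k x).
Proof.
have -> : w7 r i j k = (- r ^- 2) *: qs [:: i; j; k] by [].
apply: is_derive_eq (is_deriveZ _ (is_derive_qs _ _ _ _)) _.
rewrite /p7 /c /= (qs_swap [:: i; j]) (qs_swap [:: i]) (qs_swap [::]) /= !qs2.
rewrite (kronC i m) (kronC j m) (kronC k m) /GRing.scale /=.
generalize_deltas; generalize_qs; move: (dot _ _) => *; by field.
Qed.

(** E_m commutes with a product of four generators up to shorter products, so only triple products
    remain. *)
Lemma is_derive_p7 m i j k l (x : 'cV[R]_8) :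
  is_derive x (fr (sphere7 r) m x) (p7 r i j k l)
   (- c * (kron m i * w7 r j k l x - kron m j * w7 r i k l x
           + kron m k * w7 r i j l x - kron m l * w7 r i j k x)).
Proof.
pose b : R := kron i j * kron k l - kron i k * kron j l + kron i l * kron j k.
have -> : p7 r i j k l = (- r ^- 2) *: (qs [:: i; j; k; l]
   - b *: (fun y : 'cV[R]_8 => dot y y)) by [].
apply: is_derive_eq (is_deriveZ _ (is_deriveB (is_derive_qs _ _ _ _)
  (is_deriveZ _ (is_derive_dot _ _)))) _.
rewrite dotC dotZl dotC (dot_E m) !mulr0 scaler0 subr0 /= !qs5 /w7 /c.
rewrite (kronC i m) (kronC j m) (kronC k m) (kronC l m) /GRing.scale /=.
have C u v : qs [:: m; u; v] x = qs [:: u; v; m] x.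
  by rewrite qs3_swapl qs3_swapr opprK.
rewrite (C k l) (C j l) (C i l) (C j k) (C i k) (C i j).
generalize_deltas; generalize_qs => *; by field.
Qed.

Lemma sphere7_struct i j k y : struct (sphere7 r) i j k y = c * w7 r i j k y.
Proof.
(* The frame fields are linear, so their bracket is read off from the products of the matrices E_i
   and E_j in the two orders. *)
have D (m : 'I_7) (v : 'cV[R]_8) x : 'D_v (fr (sphere7 r) m) x = fr (sphere7 r) m v.
  have H : is_derive x v (fr (sphere7 r) m) (fr (sphere7 r) m v).
    by apply: is_derive_linear => a u z /=; rewrite mulmxDr scalerDr -scalemxAr !scalerA mulrC.
  by case: H.
have Q (a b : 'I_7) : dot (octL R (lift ord0 k) *m y)
    (r^-1 *: (octL R (lift ord0 a) *m (r^-1 *: (octL R (lift ord0 b) *m y)))) =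
    - (r ^- 2 * qs [:: k; a; b] y).
  rewrite dotC dotZl -scalemxAr dotZl dotC mulrA -invfM -expr2 -mulrN; congr (_ * _).
  by rewrite /dot trmx_mul E_skew !mulmxN !mulNmx mxE /qs /qform /= mulmx1 !mulmxA.
rewrite /struct /lie !D [LHS]dotC dotZl.
have -> (u v z : 'cV[R]_8) : dot u (v - z) = dot u v - dot u z.
  by rewrite /dot mulmxBr !mxE.
rewrite !Q (qs3_swapl k i) (qs3_swapl k j) (qs3_swapr i k) (qs3_swapr j k).
rewrite (qs3_swapl j i) /w7 /c; generalize_qs => *; by field.
Qed.

Lemma sphere7_g2_frame :
  g2_frame (sphere7 r) (pts (sphere7 r)) c kron (w7 r) (p7 r) (sq r).
Proof.
split.
- move=> y; split.
  + exact: kronC.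
  + by move=> *; exact: w7_swapl.
  + by move=> *; exact: w7_swapr.
  + by move=> *; exact: p7_swapl.
  + by move=> *; exact: p7_swapm.
  + by move=> *; exact: p7_swapr.
  + by move=> i j; rewrite kron_sum.
  + by move=> i j k; rewrite kron_sum.
  + by move=> i j k l; rewrite kron_sum.
  + under eq_bigr do rewrite /kron eqxx.
    by rewrite sumr_const card_ord.
  + by move=> i j k l; rewrite w7_w7.
  + by move=> i j k l m; rewrite w7_p7.
- by move=> y /= Hy; rewrite /sq Hy mulVf // expf_neq0.
- exact: sphere7_struct.
- exact: is_derive_sq.
- exact: is_derive_w7.
- exact: is_derive_p7.
Qed.

End Derivatives.

(** * Sums over tuples and finite verifications *)

Section TupleSums.
Variables (Z : nmodType) (T : finType).

Lemma sum_tupleS k (F : seq T -> Z) :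
  \sum_(J : k.+1.-tuple T) F J = \sum_a \sum_(J : k.-tuple T) F (a :: J).
Proof.
rewrite pair_bigA /= (reindex (fun aJ : T * k.-tuple T => [tuple of aJ.1 :: aJ.2])) //.
exists (fun J : k.+1.-tuple T => (thead J, [tuple of behead J])) => [[a J]|J] _ /=.
  by congr (_, _); apply: val_inj.
by rewrite [RHS]tuple_eta; apply: val_inj.
Qed.

Lemma sum_tuple0 (F : seq T -> Z) :
  \sum_(J : 0.-tuple T) F J = F [::].
Proof.
rewrite (bigD1 [tuple]) //= big1 ?addr0 // => J /negP[].
by rewrite [J]tuple0.
Qed.

Lemma sum_tuple3 (F : seq T -> Z) : \sum_(J : 3.-tuple T) F J =
  \sum_i \sum_j \sum_k F [:: i; j; k].
Proof.
rewrite sum_tupleS; apply: eq_bigr => i _.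
rewrite (sum_tupleS _ (fun J => F (i :: J))); apply: eq_bigr => j _.
rewrite (sum_tupleS _ (fun J => F [:: i, j & J])); apply: eq_bigr => k _.
by rewrite (sum_tuple0 (fun J => F [:: i, j, k & J])).
Qed.

Lemma sum_tuple4 (F : seq T -> Z) : \sum_(J : 4.-tuple T) F J =
  \sum_i \sum_j \sum_k \sum_l F [:: i; j; k; l].
Proof.
rewrite sum_tupleS; apply: eq_bigr => i _.
by rewrite (sum_tuple3 (fun J => F (i :: J))).
Qed.

Lemma sum_tuple_cat k l (F : seq T -> Z) :
  \sum_(J : (k + l).-tuple T) F J =
  \sum_(K : k.-tuple T) \sum_(L : l.-tuple T) F (K ++ L).
Proof.
elim: k F => [|k IH] F.
  by rewrite (sum_tuple0 (fun K => \sum_(L : l.-tuple T) F (K ++ L))).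
rewrite addSn sum_tupleS (sum_tupleS _ (fun K => \sum_(L : l.-tuple T) F (K ++ L))).
by apply: eq_bigr => a _; rewrite (IH (fun J => F (a :: J))).
Qed.

End TupleSums.

Lemma sum_tuple_lift (Z : nmodType) n k (F : seq 'I_n.+1 -> Z) :
  (forall J, ord0 \in J -> F J = 0) ->
  \sum_(J : k.-tuple 'I_n.+1) F J = \sum_(J : k.-tuple 'I_n) F (map (lift ord0) J).
Proof.
elim: k F => [|k IH] F F0.
  by rewrite sum_tuple0 (sum_tuple0 (fun J : seq 'I_n => F (map (lift ord0) J))).
rewrite sum_tupleS big_ord_recl big1 ?add0r => [|J _]; last by rewrite F0 ?inE.
rewrite (sum_tupleS _ (fun J : seq 'I_n => F (map (lift ord0) J))).
apply: eq_bigr => a _; rewrite (IH (fun J => F (lift ord0 a :: J))) // => J J0.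
by rewrite F0 // inE J0 orbT.
Qed.

(** Identities between the tables are checked by [vm_compute] over natural numbers in [iota] and
    transferred to ordinals by this lemma. *)
Lemma all_ordP (m : nat) (P : pred nat) : all P (iota 0 m) -> forall i : 'I_m, P i.
Proof. by move=> /allP H i; apply: H; rewrite mem_iota /=. Qed.

Lemma foldr_iota (R : nmodType) (F : nat -> R) m k :
  foldr (fun l s => F l + s) 0 (iota m k) = \sum_(l < k) F (m + l)%N.
Proof.
elim: k m => [|k IH] m; first by rewrite big_ord0.
rewrite big_ord_recl addn0 /= IH; congr (_ + _).
by apply: eq_bigr => l _; rewrite /bump add1n addSnnS.
Qed.

(* Phi0 is a third of the sum of the squares of the 2-forms given by the left
   multiplications by e_1, ..., e_7. *)
Lemma Phi0_octL (a b c d : 'I_8) : 3 * Phi0 [:: a; b; c; d] =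
  \sum_(l < 7) (oct l.+1 b a * oct l.+1 d c - oct l.+1 c a * oct l.+1 d b
                + oct l.+1 d a * oct l.+1 c b).
Proof.
have H : all (fun a => all (fun b => all (fun c => all (fun d =>
    3 * altform ([seq (t.1, 0%N :: t.2) | t <- omega_table] ++ staromega_table)
      [:: a; b; c; d]
    == foldr (fun l s => (oct l b a * oct l d c - oct l c a * oct l d b
                + oct l d a * oct l c b) + s) 0 (iota 1 7))
  (iota 0 8)) (iota 0 8)) (iota 0 8)) (iota 0 8) by vm_compute.
have := all_ordP (all_ordP (all_ordP (all_ordP H a) b) c) d => /eqP.
by rewrite foldr_iota.
Qed.

(** * The G_2-structure of the sphere *)

Section SphereOmega.
Variables (R : realType) (r : R).
Local Notation E := (@gamma7 R).

Lemma eval8_4 (b : seq 'I_8 -> int) (u0 u1 u2 u3 : 'cV[R]_8) :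
  eval8 b [:: u0; u1; u2; u3] = \sum_i \sum_j \sum_k \sum_l
    (b [:: i; j; k; l])%:~R * (u0 i 0 * u1 j 0 * u2 k 0 * u3 l 0).
Proof.
rewrite /eval8 /=.
pose F (J : seq 'I_8) : R := (b J)%:~R *
  \prod_(k < 4) tnth [tuple u0; u1; u2; u3] k (nth ord0 J k) 0.
transitivity (\sum_(J : 4.-tuple 'I_8) F J).
  apply: eq_bigr => J _; congr (_ * _); apply: eq_bigr => k _.
  by rewrite (tnth_nth ord0) !(tnth_nth 0).
rewrite sum_tuple4; do 4 (apply: eq_bigr => ? _); rewrite /F.
by rewrite !big_ord_recl big_ord0 /= !(tnth_nth 0) /= mulr1 !mulrA.
Qed.

Lemma gamma7E l a b : E l a b = (oct l.+1 b a)%:~R.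
Proof. by rewrite mxE lift0. Qed.

Definition Ebil l (u v : 'cV[R]_8) : R := (u^T *m (E l *m v)) 0 0.

Lemma EbilE l u v : Ebil l u v = \sum_a \sum_b E l a b * (u a 0 * v b 0).
Proof.
rewrite /Ebil mxE; apply: eq_bigr => a _; rewrite [X in X * _]mxE mxE mulr_sumr.
by apply: eq_bigr => b _; rewrite mulrCA.
Qed.

Lemma eval8_Phi0 (u0 u1 u2 u3 : 'cV[R]_8) :
  3 * eval8 Phi0 [:: u0; u1; u2; u3] =
  \sum_(l < 7) (Ebil l u0 u1 * Ebil l u2 u3 - Ebil l u0 u2 * Ebil l u1 u3
                + Ebil l u0 u3 * Ebil l u1 u2).
Proof.
pose U a b c d : R := u0 a 0 * u1 b 0 * u2 c 0 * u3 d 0.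
have T1 l : Ebil l u0 u1 * Ebil l u2 u3 =
    \sum_a \sum_b \sum_c \sum_d E l a b * E l c d * U a b c d.
  rewrite !EbilE !mulr_suml; apply: eq_bigr => a _.
  rewrite !mulr_suml; apply: eq_bigr => b _.
  rewrite !mulr_sumr; apply: eq_bigr => c _; rewrite !mulr_sumr; apply: eq_bigr => d _.
  by rewrite /U; move: (E l a b) (E l c d) (u0 a 0) (u1 b 0) (u2 c 0) (u3 d 0) => *; ring.
have T2 l : Ebil l u0 u2 * Ebil l u1 u3 =
    \sum_a \sum_b \sum_c \sum_d E l a c * E l b d * U a b c d.
  rewrite !EbilE !mulr_suml; apply: eq_bigr => a _.
  rewrite [RHS]exchange_big !mulr_suml; apply: eq_bigr => c _.
  rewrite !mulr_sumr; apply: eq_bigr => b _; rewrite !mulr_sumr; apply: eq_bigr => d _.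
  by rewrite /U; move: (E l a c) (E l b d) (u0 a 0) (u1 b 0) (u2 c 0) (u3 d 0) => *; ring.
have T3 l : Ebil l u0 u3 * Ebil l u1 u2 =
    \sum_a \sum_b \sum_c \sum_d E l a d * E l b c * U a b c d.
  rewrite !EbilE !mulr_suml; apply: eq_bigr => a _.
  under [RHS]eq_bigr do rewrite exchange_big.
  rewrite [RHS]exchange_big !mulr_suml; apply: eq_bigr => d _.
  rewrite !mulr_sumr; apply: eq_bigr => b _; rewrite !mulr_sumr; apply: eq_bigr => c _.
  by rewrite /U; move: (E l a d) (E l b c) (u0 a 0) (u1 b 0) (u2 c 0) (u3 d 0) => *; ring.
under [RHS]eq_bigr do rewrite T1 T2 T3.
rewrite eval8_4 mulr_sumr.
transitivity (\sum_a \sum_b \sum_c \sum_d \sum_(l < 7)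
    (E l a b * E l c d - E l a c * E l b d + E l a d * E l b c) * U a b c d).
  do 4 (apply: eq_bigr => ? _; rewrite ?mulr_sumr).
  rewrite mulrA -(intrM _ 3) Phi0_octL rmorph_sum mulr_suml; apply: eq_bigr => l _.
  by rewrite /= rmorphD rmorphB !rmorphM /= -!gamma7E.
under [LHS]eq_bigr do under eq_bigr do under eq_bigr do rewrite exchange_big.
under [LHS]eq_bigr do under eq_bigr do rewrite exchange_big.
under [LHS]eq_bigr do rewrite exchange_big.
rewrite [LHS]exchange_big; apply: eq_bigr => l _ /=.
rewrite -sumrB -big_split; apply: eq_bigr => a _; rewrite -sumrB -big_split.
apply: eq_bigr => b _; rewrite -sumrB -big_split; apply: eq_bigr => c _.
rewrite -sumrB -big_split; apply: eq_bigr => d _ /=.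
by rewrite mulrDl mulrBl.
Qed.

(** With y in the first slot every term of [eval8_Phi0] contains <y, E_l E_m y> = - delta_lm |y|^2.
    The sum over l leaves three equal terms, which cancel the factor 3. The form has degree four in
    y and [w7] degree two, whence the factor [sq]. *)
Lemma sphere7_omegaE (i j k : 'I_7) (y : 'cV[R]_8) :
  sphere7_omega r [:: i; j; k] y = sq r y * w7 r i j k y.
Proof.
have B0 l (m : 'I_7) : Ebil l y (E m *m y) = - (kron l m * dot y y).
  by rewrite -qs2 /qs /qform /= mulmx1 /Ebil -!mulmxA.
have B1 l (m u : 'I_7) : Ebil l (E m *m y) (E u *m y) = - qs [:: m; l; u] y.
  by rewrite /Ebil trmx_mul E_skew mulmxN !mulNmx [LHS]mxE /qs /qform /= mulmx1 !mulmxA.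
have BZ l (a b : R) u v : Ebil l (a *: u) (b *: v) = a * b * Ebil l u v.
  rewrite !EbilE mulr_sumr; apply: eq_bigr => c _; rewrite mulr_sumr.
  apply: eq_bigr => d _; rewrite !mxE.
  by move: (E l c d) (u c 0) (v d 0) => *; ring.
apply: (mulfI (_ : 3 != 0 :> R)); first by rewrite pnatr_eq0.
rewrite eval8_Phi0.
transitivity (\sum_(l < 7) (r^-1 ^+ 4 * (- dot y y) *
   (kron l i * - qs [:: j; l; k] y - kron l j * - qs [:: i; l; k] y
    + kron l k * - qs [:: i; l; j] y))).
  apply: eq_bigr => l _; rewrite /= !BZ !B0 !B1.
  by generalize_deltas; generalize_qs; move: (dot y y) (r^-1) => *; ring.
rewrite -mulr_sumr big_split sumrB /= !kron_sum /sq /w7.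
rewrite (qs3_swapl j i) (qs3_swapr i k).
by rewrite -exprVn; generalize_qs; move: (dot y y) (r^-1) => *; ring.
Qed.
End SphereOmega.

(** * Signs of permutations from adjacent swaps *)

Section AdjacentSwaps.
Variables (R : comPzRingType) (V : lmodType R) (T : Type).
Implicit Types (C : seq T -> Prop) (f : seq T -> V).

(** The domain C is there because products of Clifford generators change sign under a swap only when
    the indices are distinct. *)
Definition swap_closed C := forall s x y t,
  C (s ++ x :: y :: t) -> C (s ++ y :: x :: t).

Definition swap_skew C f := forall s x y t,
  C (s ++ x :: y :: t) -> f (s ++ x :: y :: t) = - f (s ++ y :: x :: t).

Lemma swap_skew_front C f s x t : swap_closed C -> swap_skew C f ->
  C (s ++ x :: t) -> f (s ++ x :: t) = (-1) ^+ size s *: f (x :: s ++ t).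
Proof.
move=> Cc fs; elim/last_ind: s t => [|s z IH] t; first by rewrite scale1r.
rewrite cat_rcons => Ct; rewrite fs // IH; last exact: Cc.
by rewrite cat_rcons size_rcons exprS mulN1r scaleNr.
Qed.

Lemma swap_closed_front C s x t : swap_closed C -> C (s ++ x :: t) -> C (x :: s ++ t).
Proof.
move=> Cc; elim/last_ind: s t => [|s z IH] t //.
by rewrite !cat_rcons => Ct; apply: IH; exact: Cc.
Qed.

Lemma lift_perm_onto k (s : 'S_k.+1) :
  exists (j : 'I_k.+1) (t : 'S_k), s = lift_perm ord0 j t.
Proof.
have [g _ gK] : bijective (fun js : 'I_k.+1 * 'S_k => lift_perm ord0 js.1 js.2).
  apply: inj_card_bij; first exact: perm_split_inj.
  by rewrite card_prod card_ord !card_Sn factS.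
by exists (g s).1, (g s).2; rewrite gK.
Qed.

(** Induction on k: entry j moves to the front with sign (-1)^j and the rest is permuted. The
    untouched tail [t] carries the free indices of a Hodge star. *)
Lemma swap_skew_perm C f k (I : k.-tuple T) (s : 'S_k) (t : seq T) :
  swap_closed C -> swap_skew C f -> C (I ++ t) ->
  f ([seq tnth I (s i) | i <- enum 'I_k] ++ t) = (-1) ^+ s *: f (I ++ t).
Proof.
elim: k C f I s => [|k IH] C f I s Cc fs CI.
  have -> : s = 1%g by apply/permP => -[].
  rewrite odd_perm1 scale1r; congr (f (_ ++ _)).
  by rewrite [I]tuple0; apply: size0nil; rewrite size_map -cardE card_ord.
have [j [s' ->]] := lift_perm_onto s.
rewrite (map_lift_perm _ (J := Tuple (size_del I j))) //=.
have IE : I ++ t = take j I ++ tnth I j :: drop j.+1 I ++ t.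
  rewrite -[in LHS](cat_take_drop j I) -catA (drop_nth (tnth I j)) ?size_tuple //.
  by rewrite -tnth_nth.
rewrite (IH (fun u => C (tnth I j :: u)) (fun u => f (tnth I j :: u))).
- rewrite /= IE (swap_skew_front Cc) // -?IE // /del size_take size_tuple ltn_ord.
  rewrite odd_lift_perm /= signr_addb signr_odd scalerA catA.
  rewrite mulrAC -exprD addnn.
  by rewrite -(signr_odd _ _.*2) odd_double mul1r.
- by move=> u x y v; exact: (Cc (_ :: u)).
- by move=> u x y v; exact: (fs (_ :: u)).
- by rewrite /= /del -catA; apply: swap_closed_front => //; rewrite -IE.
Qed.

End AdjacentSwaps.

Lemma ninv_swap s x y t : x != y ->
  odd (ninv (s ++ x :: y :: t)) = ~~ odd (ninv (s ++ y :: x :: t)).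
Proof.
move=> xy; elim: s => [|z s IH] /=.
  rewrite !oddD; case: (ltngtP x y) xy => //= _ _;
  by case: (odd _); case: (odd _); case: (odd _).
by rewrite oddD IH !count_cat /= (addnCA (x < z)%N (y < z)%N) addbN -oddD.
Qed.

Lemma mono_iota n L : mono (iota 0 n) L =
  if perm_eq L (iota 0 n) then (-1) ^+ ninv L else 0.
Proof.
rewrite /mono; case: ifP => // /perm_mem LE.
rewrite (_ : [seq index i (iota 0 n) | i <- L] = L) //.
rewrite -[RHS]map_id; apply/eq_in_map => i; rewrite LE mem_iota add0n /= => ltin.
by rewrite -{1}[i](nth_iota 0 0 ltin) // index_uniq ?iota_uniq ?size_iota.
Qed.

Lemma mono_swap n s x y t :
  mono (iota 0 n) (s ++ x :: y :: t) = - mono (iota 0 n) (s ++ y :: x :: t).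
Proof.
rewrite !mono_iota.
have /permPl-> : perm_eq (s ++ y :: x :: t) (s ++ x :: y :: t).
  by rewrite perm_cat2l; exact/permPl/(perm_catCA [:: y] [:: x]).
case: ifP => [/perm_uniq|_]; last by rewrite oppr0.
rewrite iota_uniq cat_uniq /= inE !negb_or => /and3P[_ _ /andP[+ _]] => /andP[xy _].
by rewrite -signr_odd ninv_swap // -[X in _ = - X]signr_odd signrN.
Qed.

(** * The Clifford volume element and the Hodge star of the 3-form *)

Section Volume.
Variable R : realType.
Local Notation E := (@gamma7 R).

Lemma cprod_swap_skew : swap_skew (fun L : seq 'I_7 => uniq L) (cprod R).
Proof.
move=> s x y t; rewrite cat_uniq /= inE !negb_or => /and3P[_ _ /andP[+ _]] => /andP[xy _].
by rewrite cprod_swap /kron (negPf xy) mulr0 scale0r subr0.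
Qed.

Lemma uniq_swap_closed (T : eqType) : swap_closed (fun L : seq T => uniq L).
Proof.
move=> s x y t; rewrite (perm_uniq (_ : perm_eq _ (s ++ y :: x :: t))) //.
by rewrite perm_cat2l; exact/permPl/(perm_catCA [:: x] [:: y]).
Qed.

(** The action of the generators on lists of integers, so that products of generators can be
    evaluated by [vm_compute]. *)
Definition octrow (l : nat) (u : seq int) (a : nat) : int :=
  foldr (fun b z => oct l b a * nth 0 u b + z) 0 (iota 0 8).

Fixpoint octapp (L : seq nat) (v : seq int) : seq int :=
  if L is l :: L' then map (octrow l (octapp L' v)) (iota 0 8) else v.

Lemma octappE (L : seq 'I_7) (v : seq int) (a : 'I_8) : size v = 8 ->
  ((nth 0 (octapp [seq (nat_of_ord i).+1 | i <- L] v) a)%:~R : R) =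
  (cprod R L *m \col_b (nth 0 v b)%:~R) a 0.
Proof.
move=> v8; elim: L a => [|l L IH] a; first by rewrite /= mul1mx mxE.
rewrite map_cons; set L' := [seq _ | i <- L].
have -> : octapp (l.+1 :: L') v = map (octrow l.+1 (octapp L' v)) (iota 0 8) by [].
rewrite (nth_map 0%N) ?size_iota // nth_iota // /octrow.
rewrite (foldr_iota (fun b => oct l.+1 b a * (octapp L' v)`_b)) rmorph_sum.
rewrite -[cprod R (l :: L)]/(E l *m cprod R L) -mulmxA mxE.
by apply: eq_bigr => b _; rewrite add0n rmorphM /= -gamma7E -IH.
Qed.

(** The value is + 1 and not - 1; this sign is what makes the dual of [w7] equal to + [p7]. *)
Lemma cprod_vol : cprod R (enum 'I_7) = 1%:M.
Proof.
have H : all (fun b => octapp (iota 1 7) [seq (a == b)%:R | a <- iota 0 8] ==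
    [seq (a == b)%:R | a <- iota 0 8]) (iota 0 8) by vm_compute.
apply/matrixP => a b; have /eqP := all_ordP H b => {H}.
set v := [seq _ | _ <- _].
have vE (c : 'I_8) : v`_c = ((c : nat) == b)%:R.
  by rewrite /v (nth_map 0%N) ?size_iota // nth_iota.
have EL : [seq (nat_of_ord i).+1 | i <- enum 'I_7] = iota 1 7.
  by rewrite (map_comp S val) val_enum_ord.
have v8 : size v = 8 by rewrite /v size_map size_iota.
move=> Hb; have := octappE (enum 'I_7) a v8; rewrite EL Hb vE => {Hb} Ho.
rewrite [RHS]mxE in Ho.
move: Ho; rewrite (bigD1 b) // big1 => [|c cb].
  by rewrite mxE vE eqxx mulr1 /= addr0 => <-; rewrite mxE -val_eqE /=; case: eqP.
by rewrite mxE vE (negPf (_ : (c : nat) != b)) // mulr0.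
Qed.

Lemma cprod_mono (L : seq 'I_7) : perm_eq L (enum 'I_7) ->
  cprod R L = (mono (iota 0 7) [seq val i | i <- L])%:~R *: 1%:M.
Proof.
move=> LE; have /tuple_permP[s Ls] : perm_eq L (enum_tuple 'I_7) by [].
have C : uniq (enum_tuple 'I_7 ++ [::]) by rewrite cats0 enum_uniq.
have := swap_skew_perm s (@uniq_swap_closed _) cprod_swap_skew C.
rewrite !cats0 cprod_vol => Es.
have mono_skew : swap_skew (fun=> True)
    (fun L : seq 'I_7 => mono (iota 0 7) [seq val i | i <- L] : int^o).
  by move=> s' x y t _; rewrite !map_cat; exact: mono_swap.
have := swap_skew_perm (C := fun=> True) (t := [::]) (I := enum_tuple 'I_7) s
  (fun _ _ _ _ _ => I) mono_skew I.
rewrite !cats0 val_enum_ord (_ : mono (iota 0 7) (iota 0 7) = 1) // => Em.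
have {}Ls : L = [seq tnth (enum_tuple 'I_7) (s i) | i <- enum 'I_#|'I_7|] by [].
rewrite -Ls in Es Em; have {}Em := etrans Em (mulr1 ((-1) ^+ s : int)).
by rewrite Es Em rmorphXn /= rmorphN1.
Qed.

Lemma cprod_orth (L : seq 'I_7) : (cprod R L)^T *m cprod R L = 1%:M.
Proof.
elim: L => [|i L IH] /=; first by rewrite trmx1 mulmx1.
rewrite trmx_mul -mulmxA (mulmxA (E i)^T) E_skew mulNmx E_sqr opprK mul1mx.
exact: IH.
Qed.

(** The algebraic form of Hodge duality. If J and I are complementary, E_J E_I is a sign; E_I is
    orthogonal, so E_J is that sign times E_I^T, which has the same quadratic form as E_I. The
    square on the right covers the case where both sides vanish. *)
Lemma qs_mono (J I : seq 'I_7) y :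
  (mono (iota 0 7) [seq val i | i <- J ++ I])%:~R * qs J y =
  (mono (iota 0 7) [seq val i | i <- J ++ I])%:~R ^+ 2 * qs I y :> R.
Proof.
have [LE|LE] := boolP (perm_eq (J ++ I) (enum 'I_7)); last first.
  rewrite mono_iota (_ : perm_eq _ _ = false) ?mul0r ?expr0n ?mul0r //.
  apply/negbTE; apply: contra LE; rewrite -val_enum_ord => LE.
  exact: perm_map_inj val_inj _ _ LE.
have := cprod_mono LE; rewrite cprod_cat; set e := _%:~R => H.
have : cprod R J = e *: (cprod R I)^T.
  have /mulmx1C HI := cprod_orth I.
  by rewrite -[LHS]mulmx1 -HI mulmxA H -scalemxAl mul1mx.
move=> HJ; rewrite /qs -[qform (cprod R I) y]qformT HJ qformZ; ring.
Qed.

End Volume.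

Section StarCount.
Variables (R : realType) (n : nat).

Definition eps (L : seq 'I_n) : R := (mono (iota 0 n) [seq val i | i <- L])%:~R.

Lemma eps_sqr L : size L = n -> eps L ^+ 2 = (uniq L)%:R.
Proof.
move=> Ln; rewrite /eps mono_iota -val_enum_ord.
have -> : perm_eq [seq val i | i <- L] [seq val i | i <- enum 'I_n] = uniq L.
  apply/idP/idP => [/(perm_map_inj val_inj)/perm_uniq->|Lu]; first exact: enum_uniq.
  apply: perm_map; apply: uniq_perm => //; first exact: enum_uniq.
  apply: (uniq_min_size Lu _ _).2 => [i _|]; first by rewrite mem_enum.
  by rewrite Ln -cardE card_ord.
case: ifP => _; last by rewrite expr0n.
by rewrite rmorphXn /= rmorphN1 sqrr_sign.
Qed.

(** J runs over the k! orderings of the complement of I, provided that I has no repetition. *)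
Lemma sum_eps_sqr k (I : seq 'I_n) : (k + size I)%N = n ->
  \sum_(J : k.-tuple 'I_n) eps (J ++ I) ^+ 2 = (k`! * uniq I)%:R.
Proof.
move=> kn; under eq_bigr do rewrite eps_sqr ?size_cat ?size_tuple //.
rewrite -natr_sum; congr _%:R.
have [Iu|nIu] := boolP (uniq I); last first.
  by rewrite muln0 big1 // => J _; rewrite cat_uniq (negPf nIu) !andbF.
have Ik : #|[predC I]| = k.
  by apply/eqP; rewrite -(eqn_add2l #|I|) cardC card_ord (card_uniqP Iu) addnC kn.
rewrite muln1 -ffactnn -[X in X ^_ _]Ik.
rewrite -card_uniq_tuples -sum1_card. rewrite [RHS]big_mkcond.
apply: eq_bigr => J _.
rewrite inE cat_uniq Iu andbT andbC.
have -> : all [predC I] J = ~~ has [in J] I.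
  rewrite -all_predC; apply/allP/allP => H i iI; apply/negP => iJ.
    by move/negP: (H i iJ).
  by move/negP: (H i iJ).
by case: ifP.
Qed.

End StarCount.

Section StarG2.
Variables (R : realType) (r : R).
Hypothesis r_neq0 : r != 0.
Local Notation eps := (@eps R 7).

Lemma w3form_qs t (J : 3.-tuple 'I_7) y : w3form (w7 r) t J y = t * (- r ^- 2 * qs J y).
Proof. by case: J => [[|a [|b [|c [|e s]]]]]. Qed.

Lemma p7_uniq i j k l y : uniq [:: i; j; k; l] ->
  p7 r i j k l y = - r ^- 2 * qs [:: i; j; k; l] y.
Proof.
rewrite /= !inE !negb_or /p7 /kron => /and4P[/and3P[/negPf-> /negPf-> /negPf->]].
by rewrite !(mul0r, subr0, addr0).
Qed.

Lemma p7_nuniq i j k l y : ~~ uniq [:: i; j; k; l] -> p7 r i j k l y = 0.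
Proof.
have T := g2f_tensors (sphere7_g2_frame r_neq0) y.
rewrite /= !inE !negb_and !negb_or !negb_and !negbK.
case/or4P => [/or3P[]|/orP[]| |//] /eqP->.
- apply: (p_iijk T).
- apply: (p_ijik T).
- apply: (p_ijki T).
- apply: (p_ijjk T).
- apply: (p_ijkj T).
- apply: (p_ijkk T).
Qed.

Lemma eps_qs J I y : (size J + size I)%N = 7 -> eps (J ++ I) * qs J y =
  (uniq (J ++ I))%:R * qs I y.
Proof. by move=> JI; rewrite qs_mono eps_sqr // size_cat. Qed.

(** By [qs_mono] each of the 3! orderings of the complement contributes the same product of four
    generators. In [sum_eps_p7] there are 4! orderings. *)
Lemma sum_eps_w7 i j k l y :
  \sum_(J : 3.-tuple 'I_7) eps (J ++ [:: i; j; k; l]) * w3form (w7 r) 1 J y =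
  6 * p7 r i j k l y.
Proof.
have [Iu|nIu] := boolP (uniq [:: i; j; k; l]); last first.
  rewrite p7_nuniq // mulr0 big1 // => J _; apply/eqP; rewrite mulf_eq0.
  rewrite -(sqrf_eq0 (eps _)) eps_sqr ?size_cat ?size_tuple //.
  by rewrite cat_uniq (negPf nIu) !andbF eqxx.
transitivity (- r ^- 2 * \sum_(J : 3.-tuple 'I_7)
    eps (J ++ [:: i; j; k; l]) ^+ 2 * qs [:: i; j; k; l] y).
  rewrite mulr_sumr; apply: eq_bigr => J _.
  rewrite eps_sqr ?size_cat ?size_tuple // -eps_qs ?size_tuple //.
  by rewrite w3form_qs; ring.
by rewrite -mulr_suml sum_eps_sqr // Iu muln1 p7_uniq // mulrCA.
Qed.

Lemma sum_eps_p7 i j k y :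
  \sum_(J : 4.-tuple 'I_7) eps (J ++ [:: i; j; k]) * form4 (p7 r) J y = 24 * w7 r i j k y.
Proof.
have [Iu|nIu] := boolP (uniq [:: i; j; k]); last first.
  have T := g2f_tensors (sphere7_g2_frame r_neq0) y.
  have -> : w7 r i j k y = 0.
    move: nIu; rewrite /= !inE andbT negb_and !negb_or negb_and !negbK.
    case/orP => [/orP[]|] /eqP->; [apply: (w_iij T)|apply: (w_iji T)|apply: (w_ijj T)].
  rewrite mulr0 big1 // => J _; apply/eqP; rewrite mulf_eq0.
  rewrite -(sqrf_eq0 (eps _)) eps_sqr ?size_cat ?size_tuple //.
  by rewrite cat_uniq (negPf nIu) !andbF eqxx.
transitivity (- r ^- 2 * \sum_(J : 4.-tuple 'I_7)
    eps (J ++ [:: i; j; k]) ^+ 2 * qs [:: i; j; k] y).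
  rewrite mulr_sumr; apply: eq_bigr => J _.
  have [Ju|nJu] := boolP (uniq J); last first.
    have -> : eps (J ++ [:: i; j; k]) = 0.
      apply/eqP; rewrite -sqrf_eq0 eps_sqr ?size_cat ?size_tuple //.
      by rewrite cat_uniq (negPf nJu).
    by rewrite expr0n !mul0r mulr0.
  rewrite eps_sqr ?size_cat ?size_tuple // -eps_qs ?size_tuple //.
  rewrite mulrCA; congr (_ * _).
  by case: J Ju => [[|a [|b [|c [|d [|e s]]]]]] // ? Ju; exact: p7_uniq.
by rewrite -mulr_suml sum_eps_sqr // Iu muln1 /w7 mulrCA.
Qed.

Lemma star_w7 i j k l y : star 3 (w3form (w7 r) 1) [:: i; j; k; l] y = p7 r i j k l y.
Proof.
have := sum_eps_w7 i j k l y; rewrite /star /eps => ->.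
by rewrite (_ : 3`! = 6%N) // mulKf ?pnatr_eq0.
Qed.

Lemma star_sphere7_omega i j k l y :
  star 3 (sphere7_omega r) [:: i; j; k; l] y = sq r y * p7 r i j k l y.
Proof.
rewrite -star_w7 /star mulrCA; congr (_ * _); rewrite mulr_sumr.
apply: eq_bigr => [[[|a [|b [|c [|e s]]]]]] // ? _ /=.
by rewrite sphere7_omegaE mul1r mulrCA.
Qed.

End StarG2.

(** * Smooth functions *)

Section Smoothness.
Variable R : realType.
Implicit Types V W : normedModType R.

Lemma near_eq_differentiable V W (f g : V -> W) (x : V) :
  (\forall y \near x, f y = g y) -> differentiable f x -> differentiable g x.
Proof.
move=> fg /diff_locallyP[cf ef].
have fgx : f x = g x by exact: nbhs_singleton fg.
have eg : g \o shift x = cst (g x) + 'd f x +o_ (0 : V) id.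
  apply/eqaddoP => e e0; move/eqaddoP: ef => /(_ e e0) H.
  rewrite -fgx; near=> h.
  have -> : (g \o shift x - (cst (f x) + 'd f x)) h =
      (f \o shift x - (cst (f x) + 'd f x)) h.
    rewrite -[LHS]/(g (h + x) - (f x + 'd f x h)).
    rewrite -[RHS]/(f (h + x) - (f x + 'd f x h)); congr (_ - _).
    near: h; move: fg; rewrite (near_shift 0 x) => fg.
    near=> h; apply/esym.
    suff: (fun y => f y = g y) ((shift x) h) by [].
    near: h; apply: filterS fg => z /=; by rewrite subr0.
  by near: h.
apply/diff_locallyP; rewrite (diff_unique cf eg).
by split.
Unshelve. all: end_near. Qed.

Definition iterD V W (vs : seq V) (f : V -> W) : V -> W :=
  foldr (fun v g => 'D_v g) f vs.

(** Bounding the order allows the product and quotient rules to be proved by induction on it, for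
    all functions at once. *)
Definition smooth_upto n V W (U : set V) (f : V -> W) : Prop :=
  forall (vs : seq V) (x : V), (size vs <= n)%N -> U x ->
    differentiable (iterD vs f) x.

Lemma smooth_onP V W (U : set V) (f : V -> W) :
  smooth_on U f <-> forall n, smooth_upto n U f.
Proof.
split=> [fs n vs x _ Ux|fs vs x Ux]; first exact: fs.
exact: (fs (size vs)).
Qed.

Lemma iterD_eq V W (U : set V) (f g : V -> W) vs : open U ->
  {in U, f =1 g} -> {in U, iterD vs f =1 iterD vs g}.
Proof.
move=> Uo fg; elim: vs => // v vs IH x /set_mem Ux /=.
apply: near_eq_derive; apply: filterS (open_nbhs_nbhs (conj Uo Ux)) => y Uy.
by apply: IH; exact: mem_set.
Qed.

Lemma smooth_upto_eq n V W (U : set V) (f g : V -> W) : open U ->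
  {in U, f =1 g} -> smooth_upto n U f -> smooth_upto n U g.
Proof.
move=> Uo fg fs vs x vn Ux; apply: near_eq_differentiable (fs vs x vn Ux).
apply: filterS (open_nbhs_nbhs (conj Uo Ux)) => y Uy.
by apply: iterD_eq fg _ (mem_set Uy).
Qed.

(** The innermost derivative is split off, which is the last entry of the list of directions. *)
Lemma smooth_uptoS n V W (U : set V) (f : V -> W) :
  smooth_upto n.+1 U f <->
  (forall x, U x -> differentiable f x) /\ forall v, smooth_upto n U ('D_v f).
Proof.
have E v vs : iterD (rcons vs v) f = iterD vs ('D_v f) by rewrite /iterD foldr_rcons.
split=> [fs|[f0 fs] vs x]; last first.
  case: (lastP vs) => [|us v]; first by move=> _; exact: f0.
  by rewrite size_rcons E => un Ux; exact: fs.
split=> [x Ux|v vs x vn Ux]; first exact: (fs [::]).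
by rewrite -E; apply: fs; rewrite ?size_rcons.
Qed.

Lemma smooth_upto_diff n V W (U : set V) (f : V -> W) x :
  smooth_upto n U f -> U x -> differentiable f x.
Proof. by move=> fs; exact: (fs [::]). Qed.

Lemma smooth_uptoW n V W (U : set V) (f : V -> W) :
  smooth_upto n.+1 U f -> smooth_upto n U f.
Proof. by move=> fs vs x vn; apply: fs; exact: leqW. Qed.

Lemma smooth_upto_cst n V W (U : set V) (c : W) : smooth_upto n U (fun=> c).
Proof.
move=> vs x _ _; suff [d ->] : exists d, iterD vs (fun=> c) = (fun=> d : W).
  exact: differentiable_cst.
elim: vs => [|v vs [d /= ->]]; first by exists c.
by exists 0; apply/funext => y; exact: derive_cst.
Qed.

Lemma smooth_uptoD n V (U : set V) (f g : V -> R) : open U ->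
  smooth_upto n U f -> smooth_upto n U g -> smooth_upto n U (f + g).
Proof.
move=> Uo; elim: n f g => [|n IH] f g fs gs.
  move=> [|//] x _ Ux; apply: differentiableD;
    [exact: smooth_upto_diff fs Ux|exact: smooth_upto_diff gs Ux].
have [f0 f1] := (@smooth_uptoS _ _ _ _ _).1 fs; have [g0 g1] := (@smooth_uptoS _ _ _ _ _).1 gs.
apply/smooth_uptoS; split=> [x Ux|v]; first by apply: differentiableD; [exact: f0|exact: g0].
apply: smooth_upto_eq (IH _ _ (f1 v) (g1 v)) => // x /set_mem Ux.
by rewrite deriveD //; apply: diff_derivable; [exact: f0|exact: g0].
Qed.

Lemma smooth_uptoM n V (U : set V) (f g : V -> R) : open U ->
  smooth_upto n U f -> smooth_upto n U g -> smooth_upto n U (f * g).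
Proof.
move=> Uo; elim: n f g => [|n IH] f g fs gs.
  move=> [|//] x _ Ux; apply: differentiableM;
    [exact: smooth_upto_diff fs Ux|exact: smooth_upto_diff gs Ux].
have [f0 f1] := (@smooth_uptoS _ _ _ _ _).1 fs; have [g0 g1] := (@smooth_uptoS _ _ _ _ _).1 gs.
apply/smooth_uptoS; split=> [x Ux|v]; first by apply: differentiableM; [exact: f0|exact: g0].
apply: smooth_upto_eq (smooth_uptoD Uo (IH _ _ (smooth_uptoW fs) (g1 v))
  (IH _ _ (smooth_uptoW gs) (f1 v))) => // x /set_mem Ux.
by rewrite deriveM //; apply: diff_derivable; [exact: f0|exact: g0].
Qed.

Lemma smooth_uptoV n V (U : set V) (f : V -> R) : open U ->
  (forall x, U x -> f x != 0) ->
  smooth_upto n U f -> smooth_upto n U (fun x => (f x)^-1).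
Proof.
move=> Uo fn0; elim: n => [|n IH] fs.
  move=> [|//] x _ Ux; apply: differentiableV; [exact: smooth_upto_diff fs Ux|exact: fn0].
have [f0 f1] := (@smooth_uptoS _ _ _ _ _).1 fs.
apply/smooth_uptoS; split=> [x Ux|v]; first by apply: differentiableV; [exact: f0|exact: fn0].
have Vs := IH (smooth_uptoW fs).
have Cs : smooth_upto n U (fun=> - 1 : R) by exact: smooth_upto_cst.
apply: smooth_upto_eq (smooth_uptoM Uo Cs (smooth_uptoM Uo (smooth_uptoM Uo Vs Vs)
  (f1 v))) => // x /set_mem Ux.
rewrite deriveV; [|exact: fn0|by apply: diff_derivable; exact: f0].
rewrite -[LHS]/(- 1 * (((f x)^-1 * (f x)^-1) * 'D_v f x)) mulN1r scaleNr.
by rewrite -expr2 exprVn.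
Qed.

Lemma smooth_onD V (U : set V) (f g : V -> R) : open U ->
  smooth_on U f -> smooth_on U g -> smooth_on U (fun x => f x + g x).
Proof.
move=> Uo /smooth_onP fs /smooth_onP gs; apply/smooth_onP => n.
exact: smooth_uptoD.
Qed.

Lemma smooth_onM V (U : set V) (f g : V -> R) : open U ->
  smooth_on U f -> smooth_on U g -> smooth_on U (fun x => f x * g x).
Proof.
move=> Uo /smooth_onP fs /smooth_onP gs; apply/smooth_onP => n.
exact: smooth_uptoM.
Qed.

Lemma smooth_on_cst V W (U : set V) (c : W) : smooth_on U (fun=> c).
Proof. by apply/smooth_onP => n; exact: smooth_upto_cst. Qed.

Lemma smooth_onV V (U : set V) (f : V -> R) : open U ->
  (forall x, U x -> f x != 0) ->
  smooth_on U f -> smooth_on U (fun x => (f x)^-1).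
Proof.
by move=> Uo fn0 /smooth_onP fs; apply/smooth_onP => n; exact: smooth_uptoV.
Qed.

Lemma smooth_on_sum V (U : set V) n (f : 'I_n -> V -> R) : open U ->
  (forall i, smooth_on U (f i)) -> smooth_on U (fun x => \sum_i f i x).
Proof.
move=> Uo; elim: n f => [|n IH] f fs.
  by under eq_fun do rewrite big_ord0; exact: smooth_on_cst.
under eq_fun do rewrite big_ord_recl.
by apply: smooth_onD => //; exact: IH.
Qed.

Lemma smooth_on_linear V W (U : set V) (f : V -> W) :
  linear f -> continuous f -> smooth_on U f.
Proof.
move=> lf cf.
pose fl := GRing.isLinear.Build _ _ _ _ _ lf.
pose F : {linear V -> W} := HB.pack f fl.
have df x : differentiable f x by exact: (@linear_differentiable _ _ _ F).
apply/smooth_onP => -[|n]; first by move=> [|//] x _ _; exact: df.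
apply/smooth_uptoS; split=> // v.
have -> : 'D_v f = fun=> f v.
  by apply/funext => x; case: (is_derive_linear x v lf).
exact: smooth_upto_cst.
Qed.

Lemma smooth_on_coord (U : set 'cV[R]_8) a :
  smooth_on U (fun y : 'cV[R]_8 => y a 0 : R).
Proof.
apply: smooth_on_linear => [k u v|]; first by rewrite !mxE.
exact: coord_continuous.
Qed.

(** The difference quotients of f o L along v are those of f along L v, so iterated derivatives of
    the composite are composites of iterated derivatives. *)
Lemma linear_smooth_comp V V' W (U : set V) (f : V -> W) (L : V' -> V) :
  linear L -> continuous L -> smooth_on U f ->
  smooth_on (L @^-1` U) (f \o L).
Proof.
move=> lL cL fs vs z Uz.
pose Ll := GRing.isLinear.Build _ _ _ _ _ lL.
pose F : {linear V' -> V} := HB.pack L Ll.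
have E v (g : V -> W) : 'D_v (g \o L) = 'D_(L v) g \o L.
  apply/funext => x; rewrite /derive /= (_ : (fun h => _) =
    fun h : R => h^-1 *: (g (h *: L v + L x) - g (L x))) //.
  by apply/funext => h; rewrite lL.
have -> : foldr (fun v g => 'D_v g) (f \o L) vs =
    foldr (fun v g => 'D_v g) f (map L vs) \o L.
  by elim: vs => // v vs IH /=; rewrite IH E.
apply: differentiable_comp; first exact: (@linear_differentiable _ _ _ F).
exact: fs.
Qed.

Lemma linear_fst V V' : linear (fst : V * V' -> V).
Proof. by []. Qed.
Lemma linear_snd V V' : linear (snd : V * V' -> V').
Proof. by []. Qed.
Lemma continuous_fst V V' : continuous (fst : V * V' -> V).
Proof. by move=> z; exact: cvg_fst. Qed.
Lemma continuous_snd V V' : continuous (snd : V * V' -> V').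
Proof. by move=> z; exact: cvg_snd. Qed.

Lemma smooth_on_qform (U : set 'cV[R]_8) K : open U -> smooth_on U (qform K).
Proof.
move=> Uo; have -> : qform K = fun y => \sum_a \sum_b y a 0 * K a b * y b 0.
  apply/funext => y; rewrite /qform mxE.
  under eq_bigr do rewrite mxE mulr_suml.
  rewrite exchange_big; apply: eq_bigr => a _; apply: eq_bigr => b _.
  by rewrite !mxE.
apply: smooth_on_sum => // a; apply: smooth_on_sum => // b.
apply: smooth_onM => //; last exact: smooth_on_coord.
by apply: smooth_onM => //; [exact: smooth_on_coord|exact: smooth_on_cst].
Qed.

Lemma smooth_on_w7 (U : set 'cV[R]_8) r i j k : open U -> smooth_on U (w7 r i j k).
Proof.
move=> Uo; apply: smooth_onM => //; first exact: smooth_on_cst.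
exact: smooth_on_qform.
Qed.

Lemma is_derive_comp V (f : V -> R) (h : R -> R) (dh : R) (x v : V) :
  differentiable f x -> is_derive (f x) 1 h dh ->
  is_derive x v (fun y => h (f y)) (dh * 'D_v f x).
Proof.
move=> df hd; have dh' : differentiable h (f x) by apply/derivable1_diffP; case: hd.
have dc : differentiable (h \o f) x by exact: differentiable_comp.
apply: DeriveDef; first exact: diff_derivable.
rewrite (deriveE _ dc) diff_comp // diff1E //= (deriveE _ df) derive1E.
by case: hd => _ ->; rewrite mulrC.
Qed.

(** The derivative of atan o f is D f divided by 1 + f^2, so one differentiation reduces the claim
    to products and reciprocals. It serves the angle function on the circle. *)
Lemma smooth_on_atan V (U : set V) (f : V -> R) : open U ->
  smooth_on U f -> smooth_on U (fun x => atan (f x)).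
Proof.
move=> Uo /smooth_onP fs; apply/smooth_onP => n.
have da x : U x -> differentiable f x by move=> Ux; exact: smooth_upto_diff (fs 0%N) Ux.
have dat x : U x -> differentiable (fun y => atan (f y)) x.
  move=> Ux; apply: (differentiable_comp (g := @atan R)); first exact: da.
  by apply/derivable1_diffP; exact: derivable_atan.
case: n => [|n]; first by move=> [|//] x _ Ux; exact: dat.
apply/smooth_uptoS; split=> // v.
have [_ f1] := (@smooth_uptoS _ _ _ _ _).1 (fs n.+1).
have Vs : smooth_upto n U (fun x => (1 + f x * f x)^-1).
  apply: smooth_uptoV => // [x _|].
    by rewrite gt_eqF // ltr_wpDr // -expr2 sqr_ge0.
  have Cs : smooth_upto n U (fun=> 1 : R) by exact: smooth_upto_cst.
  exact: smooth_uptoD Cs (smooth_uptoM Uo (fs n) (fs n)).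
apply: smooth_upto_eq (smooth_uptoM Uo Vs (f1 v)) => // x /set_mem Ux.
have [_ ->] := is_derive_comp v (da _ Ux) (is_derive1_atan (f x)).
by rewrite expr2.
Qed.

End Smoothness.

(** * Local rotations to the standard G_2-form *)

Section LocalModel.
Variable R : realType.
Local Notation E := (@gamma7 R).
Local Notation e0 := (delta_mx ord0 ord0 : 'cV[R]_8).

Definition Evec (u : 'cV[R]_7) : 'M[R]_8 := \sum_i u i 0 *: E i.

(* Minus the reflection in the hyperplane orthogonal to u: the rotation of R^7
   induced by conjugation with u. *)
Definition half_turn (u : 'cV[R]_7) : 'M[R]_7 :=
  (2 / dot u u) *: (u *m u^T) - 1%:M.

Lemma half_turn_tr u : (half_turn u)^T = half_turn u.
Proof. by rewrite /half_turn linearB linearZ /= trmx_mul trmxK trmx1. Qed.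

Lemma outer_sqr (u : 'cV[R]_7) : u *m u^T *m (u *m u^T) = dot u u *: (u *m u^T).
Proof.
rewrite -mulmxA (mulmxA u^T) [u^T *m u]mx11_scalar -/(dot u u) mul_scalar_mx.
by rewrite -scalemxAr.
Qed.

Lemma half_turn_orth u : dot u u != 0 -> half_turn u *m (half_turn u)^T = 1%:M.
Proof.
move=> u0; rewrite half_turn_tr /half_turn mulmxBl !mulmxBr !mul1mx !mulmx1.
rewrite -scalemxAl -scalemxAr outer_sqr !scalerA opprB addrA.
by rewrite -mulrA divfK // mulr_natr mulr2n scalerDl addrK addrAC subrr add0r.
Qed.

(** Two block factorizations of P show that 1 - a u u^T has determinant 1 - a |u|^2 = - 1; the
    overall sign in dimension seven turns this into + 1. *)
Lemma det_half_turn u : dot u u != 0 -> \det (half_turn u) = 1.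
Proof.
move=> u0; set a := 2 / dot u u.
pose P : 'M[R]_(1 + 7) := block_mx 1%:M u^T (a *: u) 1%:M.
have H1 : \det P = \det (1%:M - a *: (u *m u^T)).
  have -> : P = block_mx 1%:M 0 (a *: u) 1%:M *m
      block_mx 1%:M u^T 0 (1%:M - a *: (u *m u^T)).
    rewrite mulmx_block !(mul1mx, mulmx1, mul0mx, mulmx0, addr0) -scalemxAl.
    by rewrite addrC subrK.
  by rewrite det_mulmx det_lblock det_ublock !det1 !mul1r.
have H2 : \det P = - 1.
  have -> : P = block_mx (1%:M - a *: (u^T *m u)) u^T 0 1%:M *m
      block_mx 1%:M 0 (a *: u) 1%:M.
    rewrite mulmx_block !(mul1mx, mulmx1, mul0mx, mulmx0, add0r) -scalemxAr.
    by rewrite subrK.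
  rewrite det_mulmx det_lblock det_ublock !det1 !mulr1 [u^T *m u]mx11_scalar.
  rewrite -/(dot u u) scale_scalar_mx divfK // -raddfB det_scalar1.
  by ring.
have -> : half_turn u = - (1%:M - a *: (u *m u^T)) by rewrite opprB.
rewrite -scaleN1r detZ -H1 H2 -signr_odd /= expr1; ring.
Qed.

Lemma sum_scalar_mx n (F : 'I_7 -> R) : (\sum_j F j)%:M = \sum_j (F j)%:M :> 'M[R]_n.
Proof. exact: (raddf_sum (@scalar_mx R n)). Qed.

Lemma Evec_anticomm u i : Evec u *m E i = - (E i *m Evec u) - (2 * u i 0)%:M.
Proof.
rewrite /Evec mulmx_suml mulmx_sumr -sumrN.
transitivity (\sum_j (- (E i *m (u j 0 *: E j)) - (kron j i * (2 * u j 0))%:M)).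
  apply: eq_bigr => j _; rewrite -scalemxAl -scalemxAr E_anticomm scalerBr scalerN.
  by rewrite scale_scalar_mx /kron; congr (_ - _%:M); ring.
by rewrite sumrB -[in RHS](kron_sum i (fun j => 2 * u j 0)) sum_scalar_mx.
Qed.

Lemma Evec_tr u : (Evec u)^T = - Evec u.
Proof.
rewrite /Evec raddf_sum -sumrN; apply: eq_bigr => i _ /=.
by rewrite linearZ /= E_skew scalerN.
Qed.

Lemma Evec_sqr u : Evec u *m Evec u = - (dot u u)%:M.
Proof.
have H : Evec u *m Evec u = - (Evec u *m Evec u) - (2 * dot u u)%:M.
  rewrite {2}/Evec mulmx_sumr.
  transitivity (\sum_i (- (u i 0 *: E i *m Evec u) - (2 * (u i 0 * u i 0))%:M)).
    apply: eq_bigr => i _; rewrite -scalemxAr Evec_anticomm scalerBr scalerN scalemxAl.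
    by rewrite scale_scalar_mx; congr (_ - _%:M); ring.
  by rewrite sumrB sumrN -mulmx_suml -mulmx_sumr dotE mulr_sumr sum_scalar_mx.
apply: (scalerI (_ : 2 != 0 :> R)); first by rewrite pnatr_eq0.
rewrite scalerN scale_scalar_mx scaler_nat mulr2n {1}H.
by rewrite addrAC addNr add0r.
Qed.

Lemma Evec_orth u : (Evec u)^T *m Evec u = (dot u u)%:M.
Proof. by rewrite Evec_tr mulNmx Evec_sqr opprK. Qed.

Lemma Evec_conj u i : dot u u != 0 -> (Evec u)^T *m E i *m Evec u =
  dot u u *: \sum_j half_turn u j i *: E j.
Proof.
move=> u0; rewrite Evec_tr !mulNmx Evec_anticomm mulmxBl mulNmx -mulmxA Evec_sqr.
rewrite mulmxN opprK mul_mx_scalar mul_scalar_mx opprB.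
transitivity (\sum_j (u j 0 * (2 * u i 0) - dot u u * kron j i) *: E j).
  under eq_bigr do rewrite scalerBl.
  rewrite sumrB; congr (_ - _).
    by rewrite /Evec scaler_sumr; apply: eq_bigr => j _; rewrite scalerA mulrC.
  rewrite (bigD1 i) //= big1 ?addr0 => [|j /negPf ji].
    by rewrite /kron eqxx mulr1.
  by rewrite /kron ji mulr0 scale0r.
rewrite scaler_sumr; apply: eq_bigr => j _; rewrite scalerA; congr (_ *: _).
by rewrite /half_turn !mxE big_ord1 !mxE /kron; field.
Qed.

Lemma qform_sum n (K : 'I_n -> 'M[R]_8) y : qform (\sum_i K i) y = \sum_i qform (K i) y.
Proof. by rewrite /qform mulmx_sumr mulmx_suml summxE. Qed.

(** Inserting g g^T = N between consecutive generators lets each of them be conjugated on its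
    own. *)
Lemma qs_rotate (g : 'M[R]_8) (A : 'M[R]_7) (N : R) (v : 'cV[R]_8) i j k : N != 0 ->
  g^T *m g = N%:M -> (forall i, g^T *m E i *m g = N *: \sum_j A j i *: E j) ->
  qs [:: i; j; k] (g *m v) =
  N * \sum_a \sum_b \sum_c A a i * A b j * A c k * qs [:: a; b; c] v.
Proof.
move=> N0 gg gE.
have gg' : g *m g^T = N%:M.
  have /mulmx1C : g^T *m (N^-1 *: g) = 1%:M.
    by rewrite -scalemxAr gg scale_scalar_mx mulVf.
  by rewrite -scalemxAl => /(congr1 ( *:%R N)); rewrite scalerA divff // scale1r scalemx1.
have -> : qs [:: i; j; k] (g *m v) = N ^- 2 *
    qform ((g^T *m E i *m g) *m (g^T *m E j *m g) *m (g^T *m E k *m g)) v.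
  have -> : (g^T *m E i *m g) *m (g^T *m E j *m g) *m (g^T *m E k *m g) =
      g^T *m (E i *m (g *m g^T) *m E j *m (g *m g^T) *m E k) *m g.
    by rewrite !mulmxA.
  rewrite gg' !mul_mx_scalar -!(scalemxAl, scalemxAr) scalerA qformZ mulrA.
  rewrite -expr2 mulVf ?expf_neq0 // mul1r /qs /qform /= mulmx1 trmx_mul !mulmxA.
  by [].
rewrite !gE -!(scalemxAl, scalemxAr) !scalerA qformZ mulrA.
have -> : N ^- 2 * (N * (N * N)) = N by field.
congr (_ * _); rewrite -mulmxA mulmx_suml qform_sum; apply: eq_bigr => a _.
rewrite mulmx_suml mulmx_sumr qform_sum; apply: eq_bigr => b _.
rewrite !mulmx_sumr qform_sum; apply: eq_bigr => c _.
by rewrite -!(scalemxAl, scalemxAr) !scalerA qformZ /qs /= mulmx1.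
Qed.

Lemma sum_E_dot (y x : 'cV[R]_8) :
  \sum_i dot (E i *m y) x *: (E i *m y) = dot y y *: x - dot y x *: y.
Proof.
have := congr1 (mulmx^~ x) (octframe_complete y).
rewrite /= mulmxBl mul_scalar_mx => <-.
rewrite -mulmxA [y^T *m x]mx11_scalar -/(dot y x) mul_mx_scalar addrAC subrr add0r.
rewrite mulmx_suml -sumrN; apply: eq_bigr => i _.
rewrite -(mulmxA _ _ x) (_ : y^T *m E i *m x = - (dot (E i *m y) x)%:M).
  by rewrite mulmxN mul_mx_scalar opprK.
rewrite -raddfN [LHS]mx11_scalar; congr (_%:M).
by rewrite /dot trmx_mul E_skew mulmxN mulNmx [in RHS]mxE opprK.
Qed.

Definition coefs (z x : 'cV[R]_8) : 'cV[R]_7 := \col_i dot (E i *m z) x.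

Lemma Evec_coefs z x : dot z x = 0 -> Evec (coefs z x) *m z = dot z z *: x.
Proof.
move=> zx; rewrite /Evec mulmx_suml -[RHS]subr0 -[X in _ - X](scale0r z) -zx -sum_E_dot.
by apply: eq_bigr => i _; rewrite mxE scalemxAl.
Qed.

Lemma dot_coefs z x : dot z x = 0 -> dot (coefs z x) (coefs z x) = dot z z * dot x x.
Proof.
move=> zx; rewrite -dotZl -[_ *: x]subr0 -[X in _ - X](scale0r z) -zx -sum_E_dot.
rewrite [RHS]dotC {2}/dot mulmx_sumr summxE dotE; apply: eq_bigr => i _.
by rewrite [in LHS]mxE -[RHS]/(dot x (dot (E i *m z) x *: (E i *m z))) [RHS]dotC dotZl.
Qed.

(** The standard form is the 3-form of the unit sphere at e0; a conjugation carrying e0 to a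
    multiple of x therefore brings the form at x to the standard one. *)
Lemma omega0E (a b c : 'I_7) :
  ((omega0 [:: a; b; c])%:~R : R) = - qs [:: a; b; c] e0.
Proof.
have H : all (fun a => all (fun b => all (fun c =>
    altform omega_table [:: a.+1; b.+1; c.+1] ==
    - nth 0 (octapp [:: a.+1; b.+1; c.+1] [:: 1; 0; 0; 0; 0; 0; 0; 0]) 0)
  (iota 0 7)) (iota 0 7)) (iota 0 7) by vm_compute.
have /eqP := all_ordP (all_ordP (all_ordP H a) b) c => {H}.
rewrite /omega0 => ->; rewrite rmorphN /=; congr (- _).
have := octappE R [:: a; b; c] (v := [:: 1; 0; 0; 0; 0; 0; 0; 0]) ord0 erefl.
move=> ->; rewrite /qs /qform -mulmxA.
have -> : \col_b0 ([:: 1; 0; 0; 0; 0; 0; 0; 0]`_b0)%:~R = e0.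
  apply/colP => -[m lm]; rewrite !mxE /= andbT.
  by move: m lm; do 8?[case=> //].
rewrite (_ : e0^T = delta_mx 0 0) ?trmx_delta //.
by rewrite -rowE [RHS]mxE.
Qed.

Lemma conj_comp (g1 g2 : 'M[R]_8) (A1 A2 : 'M[R]_7) (N1 N2 : R) :
  (forall i, g1^T *m E i *m g1 = N1 *: \sum_j A1 j i *: E j) ->
  (forall i, g2^T *m E i *m g2 = N2 *: \sum_j A2 j i *: E j) ->
  forall i, (g1 *m g2)^T *m E i *m (g1 *m g2) =
    (N1 * N2) *: \sum_j (A2 *m A1) j i *: E j.
Proof.
move=> H1 H2 i.
have -> : (g1 *m g2)^T *m E i *m (g1 *m g2) = g2^T *m (g1^T *m E i *m g1) *m g2.
  by rewrite trmx_mul !mulmxA.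
rewrite H1 -scalemxAr -scalemxAl -scalerA; congr (_ *: _).
rewrite mulmx_sumr mulmx_suml.
under eq_bigr do rewrite -scalemxAr -scalemxAl H2 scalerA mulrC -scalerA.
rewrite -scaler_sumr; congr (_ *: _).
under eq_bigr do rewrite scaler_sumr.
rewrite exchange_big; apply: eq_bigr => j _ /=; rewrite mxE scaler_suml.
by apply: eq_bigr => k _; rewrite scalerA mulrC.
Qed.

Lemma orth_comp (n : nat) (g1 g2 : 'M[R]_n) (N1 N2 : R) :
  g1^T *m g1 = N1%:M -> g2^T *m g2 = N2%:M ->
  (g1 *m g2)^T *m (g1 *m g2) = (N1 * N2)%:M.
Proof.
move=> H1 H2; rewrite trmx_mul -mulmxA (mulmxA g1^T) H1 mul_scalar_mx.
by rewrite -scalemxAr H2 scale_scalar_mx.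
Qed.

Variables (a b : 'I_8) (k : 'I_7).
Hypotheses (ab : a != b) (ka : lift ord0 k != a) (kb : lift ord0 k != b).

Let ek : 'cV[R]_7 := delta_mx k 0.
Let wk : 'cV[R]_8 := E k *m e0.
Let zab (x : 'cV[R]_8) : 'cV[R]_8 := \col_i (kron i b * x a 0 - kron i a * x b 0).

(* E_k, Evec (coefs wk z) and Evec (coefs z x) send e0 to wk, wk to z and z to x,
   up to scale, for z = zab x; it is orthogonal to wk and x, and z != 0 as soon as
   x_a != 0, which makes this choice smooth near x. *)
Definition local_rot (x : 'cV[R]_8) : 'M[R]_7 :=
  half_turn ek *m (half_turn (coefs wk (zab x)) *m half_turn (coefs (zab x) x)).

Lemma dot_zab x : dot (zab x) x = 0.
Proof.
rewrite dotE; transitivity (\sum_i (kron i b * (x a 0 * x i 0) - kron i a * (x b 0 * x i 0))).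
  by apply: eq_bigr => i _; rewrite mxE; ring.
by rewrite sumrB !kron_sum mulrC subrr.
Qed.

Lemma zabE x i : zab x i 0 = kron i b * x a 0 - kron i a * x b 0.
Proof. by rewrite mxE. Qed.

Lemma zab_sqr x : dot (zab x) (zab x) = x a 0 ^+ 2 + x b 0 ^+ 2.
Proof.
rewrite dotE; transitivity (\sum_i (kron i b * (x a 0 * zab x i 0)
   - kron i a * (x b 0 * zab x i 0))).
  apply: eq_bigr => i _; rewrite {1}zabE mulrBl !mulrA.
  by congr (_ - _).
rewrite sumrB !kron_sum !zabE /kron !eqxx (negPf ab) eq_sym (negPf ab).
by rewrite !(mul1r, mul0r) subr0 sub0r mulrN opprK -!expr2.
Qed.

Lemma dot_e0 : dot e0 e0 = 1.
Proof. by rewrite dotE (bigD1 ord0) //= big1 ?mxE ?mulr1 ?addr0 // => i /negPf i0;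
  rewrite mxE i0 mul0r. Qed.

Lemma wk_sqr : dot wk wk = 1.
Proof. by rewrite /wk dot_octL eqxx mul1r dot_e0. Qed.

Lemma wkE : wk = delta_mx (lift ord0 k) 0.
Proof.
apply/colP => i; rewrite /wk -colE !mxE lift0 andbT.
have H : all (fun k => all (fun i => oct k.+1 0 i == (i == k.+1)%:R) (iota 0 8)) (iota 0 7).
  by vm_compute.
have /eqP -> := all_ordP (all_ordP H k) i.
by rewrite -val_eqE [val (lift _ _)]lift0; case: eqP.
Qed.

Lemma dot_wk x : dot wk (zab x) = 0.
Proof.
rewrite wkE dotE (bigD1 (lift ord0 k)) //= big1 ?addr0 => [|i /negPf ik].
  by rewrite !mxE /kron (negPf ka) (negPf kb) !mul0r subrr mulr0.
by rewrite mxE ik mul0r.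
Qed.

Lemma ek_sqr : dot ek ek = 1.
Proof.
rewrite dotE (bigD1 k) //= big1 ?addr0 => [|i /negPf ik]; first by rewrite mxE !eqxx mulr1.
by rewrite mxE ik mul0r.
Qed.

Lemma Evec_ek : Evec ek = E k.
Proof.
rewrite /Evec (bigD1 k) //= big1 ?addr0 => [|i /negPf ik]; first by rewrite mxE !eqxx scale1r.
by rewrite mxE ik scale0r.
Qed.

Lemma zab_neq0 (x : 'cV[R]_8) : x a 0 != 0 -> dot (zab x) (zab x) != 0.
Proof.
move=> xa; rewrite zab_sqr gt_eqF // ltr_pwDl ?sqr_ge0 //.
by rewrite lt_neqAle eq_sym sqrf_eq0 xa sqr_ge0.
Qed.

Lemma local_rotP (r : R) (x : 'cV[R]_8) : r != 0 -> dot x x = r ^+ 2 -> x a 0 != 0 ->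
  [/\ local_rot x *m (local_rot x)^T = 1%:M, \det (local_rot x) = 1 &
    forall i j l, w7 r i j l x = \sum_c \sum_e \sum_f (omega0 [:: c; e; f])%:~R
      * (local_rot x c i * local_rot x e j * local_rot x f l)].
Proof.
move=> r0 xr xa; have z0 := zab_neq0 xa.
have xx : dot x x != 0 by rewrite xr expf_neq0.
have u0 : dot (coefs (zab x) x) (coefs (zab x) x) != 0.
  by rewrite dot_coefs ?dot_zab // mulf_neq0.
have v0 : dot (coefs wk (zab x)) (coefs wk (zab x)) != 0.
  by rewrite dot_coefs ?dot_wk // wk_sqr mul1r.
have k0 : dot ek ek != 0 by rewrite ek_sqr oner_neq0.
split.
- rewrite /local_rot !trmx_mul -!mulmxA.
  rewrite (mulmxA (half_turn (coefs (zab x) x))) half_turn_orth // mul1mx.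
  by rewrite (mulmxA (half_turn (coefs wk (zab x)))) half_turn_orth // mul1mx half_turn_orth.
- by rewrite !det_mulmx !det_half_turn // !mulr1.
move=> i j l; set N := dot (zab x) (zab x).
pose g := Evec (coefs (zab x) x) *m Evec (coefs wk (zab x)) *m Evec ek.
have ge0 : g *m e0 = N *: x.
  rewrite /g -!mulmxA Evec_ek -/wk Evec_coefs ?dot_wk // wk_sqr scale1r.
  by rewrite Evec_coefs // dot_zab.
have gg := orth_comp (orth_comp (Evec_orth (coefs (zab x) x)) (Evec_orth (coefs wk (zab x))))
  (Evec_orth ek).
have gE := conj_comp (conj_comp (fun i => Evec_conj i u0) (fun i => Evec_conj i v0))
  (fun i => Evec_conj i k0).
have Ntot : dot (coefs (zab x) x) (coefs (zab x) x)
    * dot (coefs wk (zab x)) (coefs wk (zab x)) * dot ek ek = N ^+ 2 * r ^+ 2.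
  by rewrite !dot_coefs ?dot_zab ?dot_wk // wk_sqr ek_sqr xr mul1r mulr1 -/N mulrAC.
rewrite Ntot in gg gE.
have := qs_rotate e0 i j l _ gg gE.
rewrite mulf_neq0 ?expf_neq0 // => /(_ isT); rewrite -/g ge0.
have -> : qs [:: i; j; l] (N *: x) = N ^+ 2 * qs [:: i; j; l] x.
  rewrite /qs /qform -scalemxAr (_ : (N *: x)^T = N *: x^T) ?linearZ //.
  by rewrite -!scalemxAl scalerA mxE.
rewrite -mulrA => /(mulfI (expf_neq0 2 z0)) H.
rewrite /w7 H mulrA mulNr mulVf ?expf_neq0 // mulN1r -sumrN; apply: eq_bigr => c _.
rewrite -sumrN; apply: eq_bigr => e _; rewrite -sumrN; apply: eq_bigr => f _.
by rewrite omega0E mulrC mulNr.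
Qed.

Definition smooth_mx (U : set 'cV[R]_8) m n (F : 'cV[R]_8 -> 'M[R]_(m, n)) : Prop :=
  forall i j, smooth_on U (fun y => F y i j).

Lemma smooth_mulmx (U : set 'cV[R]_8) m n p (F : 'cV[R]_8 -> 'M[R]_(m, n)) (G : 'cV[R]_8 -> 'M[R]_(n, p)) :
  open U -> smooth_mx U F -> smooth_mx U G -> smooth_mx U (fun y => F y *m G y).
Proof.
move=> Uo Fs Gs i j; under eq_fun do rewrite mxE.
by apply: smooth_on_sum => // l; apply: smooth_onM.
Qed.

Lemma smooth_mx_cst (U : set 'cV[R]_8) m n (A : 'M[R]_(m, n)) : smooth_mx U (fun=> A).
Proof. by move=> i j; exact: smooth_on_cst. Qed.

Lemma smooth_mx_tr (U : set 'cV[R]_8) m n (F : 'cV[R]_8 -> 'M[R]_(m, n)) :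
  smooth_mx U F -> smooth_mx U (fun y => (F y)^T).
Proof. by move=> Fs i j; under eq_fun do rewrite mxE; exact: Fs. Qed.

Lemma smooth_dot (U : set 'cV[R]_8) n (F G : 'cV[R]_8 -> 'cV[R]_n) : open U ->
  smooth_mx U F -> smooth_mx U G -> smooth_on U (fun y => dot (F y) (G y)).
Proof. by move=> Uo Fs Gs; apply: smooth_mulmx => //; exact: smooth_mx_tr. Qed.

Lemma smooth_half_turn (U : set 'cV[R]_8) (F : 'cV[R]_8 -> 'cV[R]_7) : open U ->
  (forall y, U y -> dot (F y) (F y) != 0) ->
  smooth_mx U F -> smooth_mx U (fun y => half_turn (F y)).
Proof.
move=> Uo F0 Fs i j.
have -> : (fun y => half_turn (F y) i j) = (fun y =>
    2 * (dot (F y) (F y))^-1 * (F y *m (F y)^T) i j + - kron i j).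
  by apply/funext => y; rewrite /half_turn !mxE.
apply: smooth_onD => //; last exact: smooth_on_cst.
apply: smooth_onM => //; last by apply: smooth_mulmx => //; exact: smooth_mx_tr.
apply: smooth_onM => //; first exact: smooth_on_cst.
by apply: smooth_onV => //; exact: smooth_dot.
Qed.

Lemma smooth_coefs (U : set 'cV[R]_8) (F G : 'cV[R]_8 -> 'cV[R]_8) : open U ->
  smooth_mx U F -> smooth_mx U G -> smooth_mx U (fun y => coefs (F y) (G y)).
Proof.
move=> Uo Fs Gs i j; under eq_fun do rewrite mxE.
by apply: smooth_dot => //; apply: smooth_mulmx => //; exact: smooth_mx_cst.
Qed.

Lemma smooth_id_mx (U : set 'cV[R]_8) : smooth_mx U id.
Proof. by move=> i j; rewrite (ord1 j); exact: smooth_on_coord. Qed.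

Lemma smooth_zab (U : set 'cV[R]_8) : open U -> smooth_mx U zab.
Proof.
move=> Uo i j; under eq_fun do rewrite mxE -mulNr.
by apply: smooth_onD => //; apply: smooth_onM => //;
  first [exact: smooth_on_cst|exact: smooth_on_coord].
Qed.

Lemma smooth_local_rot : smooth_mx [set x | x a 0 != 0] local_rot.
Proof.
have Uo : open [set x : 'cV[R]_8 | x a 0 != 0].
  have -> : [set x : 'cV[R]_8 | x a 0 != 0] = (fun x : 'cV[R]_8 => x a 0) @^-1` [set y | y != 0].
    by [].
  apply: open_comp; last exact: open_neq.
  by move=> y _; exact: coord_continuous.
have zs := smooth_zab Uo.
apply: smooth_mulmx => //.
  exact: smooth_mx_cst.
apply: smooth_mulmx => //; apply: smooth_half_turn => //.
- by move=> y ya; rewrite dot_coefs ?dot_wk // wk_sqr mul1r zab_neq0.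
- by apply: smooth_coefs => //; exact: smooth_mx_cst.
- move=> y ya; rewrite dot_coefs ?dot_zab // mulf_neq0 ?zab_neq0 //.
  by apply: contra_neq ya => /dot_eq0 ->; rewrite mxE.
- by apply: smooth_coefs => //; exact: smooth_id_mx.
Qed.

End LocalModel.

Lemma prod_tnth_zip (R : comPzRingType) n k (A : 'I_n -> 'I_n -> R) (J I : k.-tuple 'I_n) :
  \prod_(l < k) A (tnth J l) (tnth I l) = \prod_(q <- zip J I) A q.1 q.2.
Proof.
elim: k J I => [|k IH] [[|j J] // sJ] [[|i I] // sI]; first by rewrite big_ord0 big_nil.
rewrite big_ord_recl big_cons; have [/= sJ' sI'] := (eqP sJ, eqP sI).
have := IH (Tuple (introT eqP (eq_add_S _ _ sJ'))) (Tuple (introT eqP (eq_add_S _ _ sI'))).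
move=> /= <-; congr (_ * _); apply: eq_bigr => l _.
by rewrite !(tnth_nth i).
Qed.

Section Sphere7Model.
Variables (R : realType) (r : R).
Hypothesis r_neq0 : r != 0.

Lemma sphere7_locally_modelled :
  locally_modelled_on (pts (sphere7 r)) 3 omega0 (sphere7_omega r).
Proof.
move=> x xr.
have [a xa] : exists a, x a 0 != 0.
  apply/existsP; apply: contraT; rewrite negb_exists => /forallP x0.
  have /eqP : dot x x = r ^+ 2 by [].
  rewrite (_ : x = 0) ?dotE ?big1 => [|i _|]; first by rewrite eq_sym sqrf_eq0 (negPf r_neq0).
    by rewrite mxE mul0r.
  by apply/colP => i; rewrite mxE; apply/eqP; have := x0 i; rewrite negbK.
(* The unit E_k e0 must differ from the basis vectors a and b', which span the plane of [zab], in
   order to be orthogonal to it. *)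
have [b' [k [ab ka kb]]] : exists b (k : 'I_7), [/\ a != b, lift ord0 k != a & lift ord0 k != b].
  have H : all (fun a => has (fun b => has (fun k => [&& a != b, k.+1 != a & k.+1 != b])
    (iota 0 7)) (iota 0 8)) (iota 0 8) by vm_compute.
  have /hasP[b0 b8 /hasP[k0 k7 /and3P[H1 H2 H3]]] := all_ordP H a.
  move: b8 k7; rewrite !mem_iota /= !add0n => b8 k7.
  by exists (Ordinal b8), (Ordinal k7); split.
exists [set x : 'cV[R]_8 | x a 0 != 0], (local_rot a b' k); split=> //.
- have -> : [set x : 'cV[R]_8 | x a 0 != 0] = (fun x : 'cV[R]_8 => x a 0) @^-1` [set y | y != 0].
    by [].
  apply: open_comp; last exact: open_neq.
  by move=> y _; exact: coord_continuous.
- exact: smooth_local_rot.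
move=> y yr ya; have [H1 H2 H3] := local_rotP ab ka kb r_neq0 yr ya.
split=> // -[[|i [|j [|l [|? ?]]]]] //= sI.
rewrite sphere7_omegaE // (_ : sq r y = 1); last first.
  by rewrite /sq yr mulVf // expf_neq0.
rewrite mul1r H3.
under [RHS]eq_bigr do rewrite prod_tnth_zip.
rewrite (sum_tupleS _ (fun J : seq 'I_7 =>
  (omega0 J)%:~R * \prod_(q <- zip J [:: i; j; l]) local_rot a b' k y q.1 q.2)).
apply: eq_bigr => c1 _; rewrite (sum_tupleS _ (fun J : seq 'I_7 =>
  (omega0 (c1 :: J))%:~R * \prod_(q <- zip (c1 :: J) [:: i; j; l]) local_rot a b' k y q.1 q.2)).
apply: eq_bigr => c2 _; rewrite (sum_tupleS _ (fun J : seq 'I_7 =>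
  (omega0 [:: c1, c2 & J])%:~R * \prod_(q <- zip [:: c1, c2 & J] [:: i; j; l]) local_rot a b' k y q.1 q.2)).
apply: eq_bigr => c3 _; rewrite (sum_tuple0 (fun J : seq 'I_7 =>
  (omega0 [:: c1, c2, c3 & J])%:~R * \prod_(q <- zip [:: c1, c2, c3 & J] [:: i; j; l]) local_rot a b' k y q.1 q.2)).
by rewrite /= !big_cons big_nil mulr1 mulrA.
Qed.
End Sphere7Model.

(** * Forms multiplied by a function that is constant along the frame *)

Section RescaledForms.
Variables (R : realType) (V : normedModType R) (n : nat) (M : framed V n).
Variables (q : V -> R).
Hypothesis Dq : forall m y, is_derive y (fr M m y) q 0.

Lemma derive_qM (f : V -> R) m y : derivable f y (fr M m y) ->
  'D_(fr M m y) (fun z => q z * f z) y = q y * 'D_(fr M m y) f y.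
Proof.
move=> df; have H := is_deriveM (Dq m y) (derivableP df).
have -> : (fun z => q z * f z) = q * f by [].
by case: H => _ ->; rewrite scaler0 addr0.
Qed.

Variables (k : nat) (a b : dform V n).
Hypothesis ab : forall I, size I = k -> a I = fun z => q z * b I z.
Hypothesis db : forall m y I, size I = k -> derivable (b I) y (fr M m y).

(** The 3-form of the sphere is [sq] times [w7] on all of R^8. As [sq] has no derivative along the
    frame, it can be pulled out of d, and likewise out of the covariant derivative. *)
Lemma extd_qM I y : size I = k.+1 -> extd M a I y = q y * extd M b I y.
Proof.
move=> Ik; rewrite /extd mulrDr !mulr_sumr.
have Id (j : 'I_(size I)) : size (del j I) = k.
  by have := @size_del _ _ (Tuple (introT eqP Ik)) (cast_ord Ik j) => /eqP.
congr (_ + _).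
  apply: eq_bigr => j _; rewrite (ab (Id j)) derive_qM; last exact: db (Id j).
  exact: mulrCA.
apply: eq_bigr => j _; rewrite [RHS]mulr_sumr; apply: eq_bigr => l jl.
rewrite [RHS]mulrCA; congr (_ * _); rewrite [RHS]mulr_sumr; apply: eq_bigr => p _.
rewrite ab; first exact: mulrCA.
have jk : (j < k)%N by rewrite (leq_trans jl) // -ltnS -Ik.
rewrite /= size_cat size_take size_drop Id jk -addSn subnKC //.
Qed.

Lemma cov_qM (G : connection V n) m I y : size I = k -> cov M G m a I y = q y * cov M G m b I y.
Proof.
move=> Ik; rewrite /cov mulrBr ab // derive_qM; last exact: db.
congr (_ - _); rewrite [RHS]mulr_sumr; apply: eq_bigr => j _.
rewrite [RHS]mulr_sumr; apply: eq_bigr => p _; rewrite ab; first exact: mulrCA.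
by rewrite size_set_nth; rewrite (maxn_idPr (ltn_ord j)).
Qed.

End RescaledForms.

(** * Spinors and the uniqueness of the torsion *)

Section Spinors.
Variable R : realType.
Local Notation E := (@gamma7 R).

Lemma kron_scale n (W : lmodType R) (a : 'I_n) (F : 'I_n -> W) :
  \sum_i kron i a *: F i = F a.
Proof.
rewrite (bigD1 a) //= /kron eqxx scale1r big1 ?addr0 // => i /negPf ->.
by rewrite scale0r.
Qed.

Lemma E_comm2 m p q : E m *m (E p *m E q) =
  E p *m E q *m E m + (2 * kron q m) *: E p - (2 * kron p m) *: E q.
Proof.
rewrite mulmxA (E_anticomm R m p) mulmxBl mulNmx -[E p *m E m *m _]mulmxA.
rewrite (E_anticomm R m q) mulmxBr mulmxN mulmxA opprB mul_mx_scalar mul_scalar_mx.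
rewrite (kronC m q) (kronC m p).
by rewrite opprK; congr (_ - _); rewrite addrC.
Qed.

Lemma cliff2_comm (B : 'I_7 -> 'I_7 -> R) m : (forall p q, B p q = - B q p) ->
  E m *m cliff2 E B = cliff2 E B *m E m - 4 *: \sum_q B m q *: E q.
Proof.
move=> BC; rewrite /cliff2 mulmx_sumr mulmx_suml.
transitivity (\sum_p ((\sum_q B p q *: (E p *m E q)) *m E m
    + 2 *: (B p m *: E p) - kron p m *: (2 *: \sum_q B p q *: E q))).
  apply: eq_bigr => p _; rewrite mulmx_sumr mulmx_suml !scaler_sumr.
  rewrite -(kron_scale m (fun q => 2 *: (B p q *: E p))) -big_split -sumrB /=.
  apply: eq_bigr => q _; rewrite -scalemxAr E_comm2 scalerBr scalerDr !scalerA -scalemxAl.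
  by congr (_ + _ *: _ - _ *: _); ring.
rewrite sumrB big_split /= kron_scale -addrA -scaler_sumr; congr (_ + _).
have -> : \sum_i B i m *: E i = - \sum_q B m q *: E q.
  by rewrite -sumrN; apply: eq_bigr => i _; rewrite BC scaleNr.
by rewrite scalerN -opprD -scalerDl; congr (- (_ *: _)); ring.
Qed.

Lemma cliff3E (B : 'I_7 -> 'I_7 -> 'I_7 -> R) :
  cliff3 E B = \sum_m E m *m cliff2 E (B m).
Proof.
apply: eq_bigr => m _; rewrite /cliff2 mulmx_sumr; apply: eq_bigr => p _.
by rewrite mulmx_sumr; apply: eq_bigr => q _; rewrite -scalemxAr mulmxA.
Qed.

(** Moving E_m across a triple product costs three signs, and each of the three slots of B
    contributes 2 times the 2-form B m. *)
Lemma cliff3_anticomm (B : 'I_7 -> 'I_7 -> 'I_7 -> R) m :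
  (forall p q s, B p q s = - B q p s) -> (forall p q s, B p q s = - B p s q) ->
  E m *m cliff3 E B = - (cliff3 E B *m E m) - 6 *: cliff2 E (B m).
Proof.
move=> Bl Br; rewrite cliff3E mulmx_sumr mulmx_suml.
have -> : cliff2 E (B m) = \sum_j kron j m *: cliff2 E (B j) by rewrite kron_scale.
transitivity (\sum_j (- (E j *m cliff2 E (B j) *m E m) - 2 *: (kron j m *: cliff2 E (B j))
    - 4 *: (\sum_q B m j q *: (E j *m E q)))).
  apply: eq_bigr => j _; rewrite mulmxA (E_anticomm R m j) mulmxBl mulNmx.
  rewrite -[E j *m E m *m _]mulmxA (cliff2_comm m (Br j)) mulmxBr mulmxA opprB.
  rewrite mul_scalar_mx (kronC m j) -scalerA.
  have -> : E j *m (4 *: \sum_q B j m q *: E q) = - (4 *: \sum_q B m j q *: (E j *m E q)).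
    rewrite -scalemxAr -scalerN -sumrN mulmx_sumr; congr (_ *: _); apply: eq_bigr => q _.
    by rewrite -scalemxAr -scaleNr Bl.
  by rewrite -[LHS]addrA [LHS]addrC.
rewrite sumrB sumrB sumrN -!scaler_sumr kron_scale -addrA -opprD -scalerDl.
by congr (_ - _ *: _); ring.
Qed.

(** Transposition gives three signs from skewness and reverses the product; reversing the indices of
    a 3-form gives one more sign. *)
Lemma cliff3_tr (B : 'I_7 -> 'I_7 -> 'I_7 -> R) :
  (forall p q s, B p q s = - B q p s) -> (forall p q s, B p q s = - B p s q) ->
  (cliff3 E B)^T = cliff3 E B.
Proof.
move=> Bl Br; rewrite /cliff3 raddf_sum /=.
under eq_bigr do rewrite raddf_sum /=.
under eq_bigr do under eq_bigr do rewrite raddf_sum /=.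
rewrite [RHS](eq_bigr _ (fun m _ => exchange_big _ _ _ _ _ _)) /=.
rewrite [RHS]exchange_big /=; apply: eq_bigr => m _.
rewrite [RHS]exchange_big; apply: eq_bigr => p _; apply: eq_bigr => q _.
rewrite linearZ /= !trmx_mul !E_skew !mulNmx !mulmxN !opprK mulmxA.
by rewrite scalerN -scaleNr (Bl m) (Br p) (Bl p) !opprK.
Qed.

Variables (r : R) (x : 'cV[R]_8).
Hypotheses (r_neq0 : r != 0) (xr : dot x x = r ^+ 2).

(** The expansion of E_p E_q x in the orthogonal basis x, E_1 x, ..., E_7 x. Through it the Clifford
    action of a 2-form on x becomes its contraction with w. *)
Lemma E_E_spinor p q : E p *m E q *m x = \sum_i w7 r p q i x *: (E i *m x) - kron p q *: x.
Proof.
apply: (scalerI (_ : r ^+ 2 != 0)); first by rewrite expf_neq0.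
rewrite -{1}xr; have := sum_E_dot x (E p *m E q *m x).
move/eqP; rewrite eq_sym subr_eq => /eqP ->.
rewrite scalerBr scaler_sumr; congr (_ + _).
  apply: eq_bigr => i _; rewrite scalerA; congr (_ *: _).
  rewrite (w7_swapr r p) (w7_swapl r p) opprK /w7 /dot trmx_mul E_skew mulmxN mulNmx mxE.
  rewrite mulrA mulrN divff ?expf_neq0 // mulN1r /qs /qform /=.
  by rewrite mulmx1 !mulmxA.
rewrite scalerA -scaleNr; congr (_ *: _).
by rewrite -xr mulrC -(qs2 p q x) /qs /qform /= mulmx1 /dot !mulmxA.
Qed.

Lemma cliff2_spinor (B : 'I_7 -> 'I_7 -> R) : (forall p q, B p q = - B q p) ->
  cliff2 E B *m x = \sum_i (\sum_p \sum_q B p q * w7 r p q i x) *: (E i *m x).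
Proof.
move=> BC; rewrite /cliff2 mulmx_suml.
transitivity (\sum_p (\sum_i (\sum_q B p q * w7 r p q i x) *: (E i *m x) - B p p *: x)).
  apply: eq_bigr => p _; rewrite mulmx_suml -(kron_sum p (B p)) scaler_suml.
  under [X in X - _]eq_bigr do rewrite scaler_suml.
  rewrite exchange_big -sumrB; apply: eq_bigr => q _ /=.
  rewrite -scalemxAl E_E_spinor scalerBr scaler_sumr !scalerA (kronC p q) [B p q * _]mulrC.
  by congr (_ - _); apply: eq_bigr => i _; rewrite scalerA.
rewrite sumrB -scaler_suml.
have -> : \sum_i B i i = 0 by rewrite big1 // => i _; exact/skew_eq0/BC.
rewrite scale0r subr0 exchange_big; apply: eq_bigr => i _ /=.
by rewrite -scaler_suml.
Qed.

Lemma E_spinor_eq0 (K : 'M[R]_8) : K *m x = 0 -> (forall i, K *m (E i *m x) = 0) -> K = 0.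
Proof.
move=> K0 KE; apply: (scalerI (_ : r ^+ 2 != 0)); first by rewrite expf_neq0.
rewrite scaler0 -[K]mulmx1 scalemxAr scalemx1 -xr -octframe_complete mulmxBr mulmxA.
rewrite K0 mul0mx sub0r mulmx_sumr big1 ?oppr0 // => i _.
by rewrite [LHS]mulmxA KE mul0mx.
Qed.

Lemma spinor_coefs0 (a : 'I_7 -> R) : \sum_i a i *: (E i *m x) = 0 -> forall i, a i = 0.
Proof.
move=> a0 j; have : dot (\sum_i a i *: (E i *m x)) (E j *m x) = 0.
  by rewrite a0 /dot trmx0 mul0mx mxE.
rewrite dotC /dot mulmx_sumr summxE => H; apply: (mulfI (_ : r ^+ 2 != 0)).
  by rewrite expf_neq0.
rewrite mulr0 -H -(kron_sum j a) mulr_sumr; apply: eq_bigr => i _.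
by rewrite -scalemxAr mxE -/(dot _ _) dot_octL xr (kronC i) /kron; ring.
Qed.

(* K = cliff3 B is symmetric, kills x, and sends E_m x to -12 sum_i b_mi E_i x;
   as b is skew, this forces b = 0, and then K vanishes on a basis. *)
Lemma torsion_spinor_eq0 (B : 'I_7 -> 'I_7 -> 'I_7 -> R) (b : 'I_7 -> 'I_7 -> R) :
  (forall p q s, B p q s = - B q p s) -> (forall p q s, B p q s = - B p s q) ->
  (forall p q, b p q = - b q p) ->
  (forall i, \sum_p \sum_q b p q * w7 r p q i x = 0) ->
  (forall m i, \sum_p \sum_q B m p q * w7 r p q i x = 2 * b m i) ->
  (forall p q s, B p q s = 0) /\ (forall p q, b p q = 0).
Proof.
move=> Bl Br bC b0 Bb; set K := cliff3 E B.
have Bx m : cliff2 E (B m) *m x = 2 *: \sum_i b m i *: (E i *m x).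
  rewrite (cliff2_spinor (Br m)) scaler_sumr; apply: eq_bigr => i _.
  by rewrite Bb scalerA.
have Kx : K *m x = 0.
  rewrite /K cliff3E mulmx_suml.
  transitivity (2 *: (cliff2 E b *m x)); last first.
    by rewrite (cliff2_spinor bC) big1 ?scaler0 // => i _; rewrite b0 scale0r.
  rewrite /cliff2 mulmx_suml scaler_sumr; apply: eq_bigr => m _.
  rewrite -mulmxA Bx -scalemxAr mulmx_sumr mulmx_suml; congr (_ *: _).
  by apply: eq_bigr => i _; rewrite -scalemxAr -scalemxAl mulmxA.
have KE m : K *m (E m *m x) = - (12 *: \sum_i b m i *: (E i *m x)).
  have := congr1 (mulmx^~ x) (cliff3_anticomm m Bl Br).
  rewrite /= -/K mulmxBl mulNmx -!mulmxA Kx mulmx0 => /esym/eqP.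
  rewrite -scalemxAl Bx scalerA subr_eq0 => /eqP /(congr1 -%R); rewrite opprK => ->.
  by congr (- (_ *: _)); ring.
have bE p q : b p q = 0.
  have H u v : dot (E v *m x) (K *m (E u *m x)) = - (12 * (r ^+ 2 * b u v)).
    rewrite KE /dot mulmxN mxE -scalemxAr mxE; congr (- (_ * _)).
    rewrite mulmx_sumr summxE -(kron_sum v (b u)) mulr_sumr; apply: eq_bigr => i _.
    rewrite -scalemxAr mxE -/(dot _ _) dot_octL xr -/(kron _ _).
    by rewrite (kronC v i); ring.
  have := H p q.
  have -> : dot (E q *m x) (K *m (E p *m x)) = dot (E p *m x) (K *m (E q *m x)).
    by rewrite dotC /dot (trmx_mul K) (cliff3_tr Bl Br : K^T = K) !mulmxA.
  rewrite H (bC q p) => /eqP; rewrite -subr_eq0 => /eqP Hpq.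
  apply: (mulfI (_ : 24 * r ^+ 2 != 0)); first by rewrite mulf_neq0 ?expf_neq0 ?pnatr_eq0.
  by apply: (lincomb (k := 1) Hpq); ring.
have K0 : K = 0.
  apply: E_spinor_eq0 => // i; rewrite KE big1 ?scaler0 ?oppr0 // => j _.
  by rewrite bE scale0r.
have B2 m : cliff2 E (B m) = 0.
  have := cliff3_anticomm m Bl Br; rewrite -/K K0 mulmx0 mul0mx oppr0 sub0r.
  by move/eqP; rewrite eq_sym oppr_eq0 scaler_eq0 pnatr_eq0 /= => /eqP.
split=> // m p.
apply: spinor_coefs0; have := cliff2_comm p (Br m).
rewrite B2 mulmx0 mul0mx sub0r => /(congr1 (mulmx^~ x)).
rewrite /= mul0mx mulNmx -scalemxAl => /eqP.
rewrite eq_sym oppr_eq0 scaler_eq0 pnatr_eq0 /= mulmx_suml => /eqP H0.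
by rewrite -[RHS]H0; apply: eq_bigr => i _; rewrite scalemxAl.
Qed.
End Spinors.

(** * Difference of two torsions, and the nearly parallel sphere *)

Section AlternatingForms.
Variables (R : realType) (n : nat).

Lemma swap_skew_alt (f : seq 'I_n -> R) k (I : k.-tuple 'I_n) (s : 'S_k) :
  swap_skew (V := R^o) (fun _ : seq 'I_n => True) f ->
  f [seq tnth I (s i) | i <- enum 'I_k] = (-1) ^+ s * f I.
Proof.
move=> fs; have C : swap_closed (fun _ : seq 'I_n => True) by [].
have := @swap_skew_perm _ R^o _ _ f _ I s [::] C fs Logic.I.
by rewrite !cats0.
Qed.

Lemma alt3_swap (f : seq 'I_n -> R) :
  (forall (I : 3.-tuple 'I_n) (s : 'S_3),
     f [seq tnth I (s i) | i <- enum 'I_3] = (-1) ^+ s * f I) ->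
  (forall i j k, f [:: i; j; k] = - f [:: j; i; k]) /\
  (forall i j k, f [:: i; j; k] = - f [:: i; k; j]).
Proof.
move=> fa.
have E (I : 3.-tuple 'I_n) (s : 'S_3) : [seq tnth I (s i) | i <- enum 'I_3] =
    [:: tnth I (s ord0); tnth I (s (lift ord0 ord0));
        tnth I (s (lift ord0 (lift ord0 ord0)))].
  by rewrite !enum_ordSl /= (size0nil (s := enum 'I_0)) // -cardE card_ord.
split=> i j k.
  have := fa [tuple j; i; k] (tperm ord0 (lift ord0 ord0)).
  rewrite E tpermL tpermR tpermD // odd_tperm /= mulN1r => <-.
  by rewrite !(tnth_nth i).
have := fa [tuple i; k; j] (tperm (lift ord0 ord0) (lift ord0 (lift ord0 ord0))).
rewrite E tpermL tpermR tpermD // odd_tperm /= mulN1r => <-.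
by rewrite !(tnth_nth i).
Qed.

End AlternatingForms.

(** The action of C on w, contracted with p, becomes the contraction of C with w. This converts
    parallelism of the form into a statement about the Clifford action on the spinor. The three
    terms agree by skewness of p, and each gives 4 by [sum_w_iab_p_abkl]. *)
Lemma contract_w_p (R : realType) n d (w : 'I_n -> 'I_n -> 'I_n -> R) p q
    (C : 'I_n -> 'I_n -> R) i : g2_tensors d w p q -> q = 1 ->
  \sum_j \sum_k \sum_l p i j k l * (\sum_s C j s * w s k l + \sum_s C k s * w j s l
    + \sum_s C l s * w j k s) = 12 * \sum_j \sum_s C j s * w j s i.
Proof.
move=> T q1.
pose F j k l := p i j k l * \sum_s C j s * w s k l.
have F2 j k l : p i j k l * (\sum_s C k s * w j s l) = F k j l.
  rewrite /F (g2_pm T i j) mulNr -mulrN -sumrN; congr (_ * _); apply: eq_bigr => s _.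
  by rewrite (g2_wl T j) mulrN opprK.
have F3 j k l : p i j k l * (\sum_s C l s * w j k s) = F l j k.
  rewrite /F (g2_pr T i j) (g2_pm T i j) opprK; congr (_ * _); apply: eq_bigr => s _.
  by rewrite (w_cyc T s).
transitivity (3 * \sum_j \sum_k \sum_l F j k l).
  transitivity (\sum_j \sum_k \sum_l F j k l + \sum_j \sum_k \sum_l F k j l
    + \sum_j \sum_k \sum_l F l j k).
    rewrite -!big_split; apply: eq_bigr => j _; rewrite -!big_split; apply: eq_bigr => k _.
    by rewrite -!big_split; apply: eq_bigr => l _; rewrite /= !mulrDr F2 F3.
  have -> : \sum_j \sum_k \sum_l F k j l = \sum_j \sum_k \sum_l F j k l.
    by rewrite exchange_big.
  have -> : \sum_j \sum_k \sum_l F l j k = \sum_j \sum_k \sum_l F j k l.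
    by under eq_bigr do rewrite exchange_big; rewrite exchange_big.
  by ring.
rewrite (_ : 12 = 3 * 4) -?mulrA; last by ring.
congr (_ * _); rewrite mulr_sumr; apply: eq_bigr => j _.
transitivity (\sum_s C j s * \sum_k \sum_l w s k l * p k l i j).
  rewrite /F; under [RHS]eq_bigr do rewrite mulr_sumr.
  rewrite [RHS]exchange_big; apply: eq_bigr => k _ /=.
  under [RHS]eq_bigr do rewrite mulr_sumr.
  rewrite [RHS]exchange_big; apply: eq_bigr => l _ /=.
  by rewrite mulr_sumr; apply: eq_bigr => s _; rewrite (p_pair T i); ring.
rewrite mulr_sumr; apply: eq_bigr => s _.
by rewrite (sum_w_iab_p_abkl T) q1 (w_cyc T s) (w_cyc T i); ring.
Qed.

Lemma parallel_tconnB (R : realType) (V : normedModType R) n (M : framed V n)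
    (D : set V) k (a T T' : dform V n) :
  parallel M D k (tconn M T') a -> parallel M D k (tconn M T) a ->
  forall m y I, D y -> size I = k -> \sum_(j < size I) \sum_s
    (T' [:: m; tnth (in_tuple I) j; s] y - T [:: m; tnth (in_tuple I) j; s] y)
      * a (set_nth s I j s) y = 0.
Proof.
move=> H' H m y I Dy Ik; have := H' m y I Dy Ik; have := H m y I Dy Ik.
rewrite /cov => /eqP; rewrite subr_eq0 => /eqP -> /eqP; rewrite subr_eq0 => /eqP E.
apply: (mulfI (_ : 2^-1 != 0)); first by rewrite invr_eq0 pnatr_eq0.
rewrite mulr0 -[RHS](subrr (\sum_(j < size I) \sum_s tconn M T' m (tnth (in_tuple I) j) s y
  * a (set_nth s I j s) y)) -[in X in _ - X]E -sumrB mulr_sumr.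
apply: eq_bigr => j _; rewrite -sumrB mulr_sumr; apply: eq_bigr => s _.
by rewrite /tconn -mulrBl opprD addrACA subrr add0r -mulrBr mulrA.
Qed.

Section ParallelDifference.
Variables (R : realType) (V : normedModType R) (n : nat) (M : framed V n).
Variables (D : set V) (a T T' : dform V n).
Let B i j k y := T' [:: i; j; k] y - T [:: i; j; k] y.

Lemma parallel_tconnB3 :
  parallel M D 3 (tconn M T') a -> parallel M D 3 (tconn M T) a ->
  forall m i j k y, D y -> \sum_s B m i s y * a [:: s; j; k] y
    + \sum_s B m j s y * a [:: i; s; k] y + \sum_s B m k s y * a [:: i; j; s] y = 0.
Proof.
move=> H' H m i j k y Dy; have := parallel_tconnB H' H m Dy (I := [:: i; j; k]) erefl.
by rewrite !big_ord_recl big_ord0 !(tnth_nth i) /= addr0 addrA.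
Qed.

Lemma parallel_tconnB4 :
  parallel M D 4 (tconn M T') a -> parallel M D 4 (tconn M T) a ->
  forall m i j k l y, D y -> \sum_s B m i s y * a [:: s; j; k; l] y
    + \sum_s B m j s y * a [:: i; s; k; l] y + \sum_s B m k s y * a [:: i; j; s; l] y
    + \sum_s B m l s y * a [:: i; j; k; s] y = 0.
Proof.
move=> H' H m i j k l y Dy; have := parallel_tconnB H' H m Dy (I := [:: i; j; k; l]) erefl.
by rewrite !big_ord_recl big_ord0 !(tnth_nth i) /= addr0 !addrA.
Qed.

End ParallelDifference.

Section G2Forms.
Variables (R : realType) (V : normedModType R) (n : nat) (M : framed V n).
Variables (D : set V) (c : R) (d : 'I_n -> 'I_n -> R).
Variables (w : 'I_n -> 'I_n -> 'I_n -> V -> R).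
Variables (p : 'I_n -> 'I_n -> 'I_n -> 'I_n -> V -> R) (q : V -> R).
Hypothesis G : g2_frame M D c d w p q.

Lemma w3form_swap t y : swap_skew (V := R^o) (fun _ : seq 'I_n => True) (fun I => w3form w t I y).
Proof.
have T := g2f_tensors G y.
move=> [|a [|b s]] u v tl _ /=; last by case: s => [|e [|f s]] /=; rewrite oppr0.
  by case: tl => [|e [|f tl]]; rewrite ?oppr0 // (g2_wl T) mulrN.
by case: tl => [|e tl]; rewrite ?oppr0 // (g2_wr T) mulrN.
Qed.

Lemma w3form_derivable t m y I : size I = 3 -> derivable (w3form w t I) y (fr M m y).
Proof.
case: I => [|i [|j [|k []]]] // _.
have H := g2f_Dw G m i j k y.
have -> : w3form w t [:: i; j; k] = t *: w i j k by [].
by apply: derivableZ; case: H.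
Qed.

Lemma w3form_smooth (U : set V) t : open U -> D `<=` U ->
  (forall i j k, smooth_on U (w i j k)) -> smooth_form D 3 (w3form w t).
Proof.
move=> Uo DU ws; split=> [I I3|y I s Dy]; last exact: (swap_skew_alt _ _ (w3form_swap t y)).
exists U; split=> //; case: I I3 => [|i [|j [|k []]]] // _.
by apply: smooth_onM => //; exact: smooth_on_cst.
Qed.

End G2Forms.

Section Sphere7.
Variables (R : realType) (r : R).
Hypothesis r_neq0 : r != 0.
Local Notation S7 := (sphere7 r).
Let c := - (2 / r).
Let G := sphere7_g2_frame r_neq0.

Let c_neq0 : c != 0.
Proof. by rewrite oppr_eq0 mulf_neq0 ?invr_eq0 ?pnatr_eq0. Qed.

Lemma sphere7_omega_w3form I : size I = 3 ->
  sphere7_omega r I = fun y => sq r y * w3form (w7 r) 1 I y.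
Proof.
case: I => [|i [|j [|k []]]] // _; apply/funext => y.
by rewrite sphere7_omegaE /= mul1r.
Qed.

Lemma sphere7_nearly_parallel : form_eq (pts S7) 4 (extd S7 (sphere7_omega r))
  (fun I y => - (- (4 / r)) * star 3 (sphere7_omega r) I y).
Proof.
move=> y [|i [|j [|k [|l []]]]] // Dy _.
rewrite (extd_qM (g2f_Dq G) sphere7_omega_w3form (w3form_derivable (t := 1) G)) //.
rewrite (extd_w3form G) star_sphere7_omega // (g2f_q G Dy).
by move: (p7 _ _ _ _ _ _) => u; field.
Qed.

Lemma sphere7_parallel :
  parallel S7 (pts S7) 3 (tconn S7 (g2_torsion c (w7 r))) (sphere7_omega r).
Proof.
move=> m y I Dy I3.
rewrite (cov_qM (g2f_Dq G) sphere7_omega_w3form (w3form_derivable (t := 1) G)) //.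
case: I I3 => [|i [|j [|k []]]] // _.
by rewrite (cov_w G) // mulr0.
Qed.

Lemma sphere7_torsion_smooth : smooth_form (pts S7) 3 (g2_torsion c (w7 r)).
Proof.
apply: (w3form_smooth G (U := setT)) => //; first exact: openT.
by move=> i j k; apply: smooth_on_w7; exact: openT.
Qed.

(** For uniqueness, the difference B of two torsions acts trivially on w in its last two indices; by
    [contract_w_p] its contraction with w vanishes, and [torsion_spinor_eq0] applies with b = 0. *)
Lemma sphere7_characteristic_torsion :
  characteristic_torsion S7 (pts S7) 3 (sphere7_omega r) (g2_torsion c (w7 r)).
Proof.
split; [exact: sphere7_torsion_smooth|exact: sphere7_parallel|].
move=> T' [_ Talt] Tpar y [|i0 [|j0 [|k0 []]]] // Dy _.
have [Tl Tr] := @alt3_swap _ _ (fun I => T' I y) (fun I s => Talt y I s Dy).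
have T := g2f_tensors G y.
pose B i j k := T' [:: i; j; k] y - g2_torsion c (w7 r) [:: i; j; k] y.
suff : B i0 j0 k0 = 0 by move/eqP; rewrite subr_eq0 => /eqP.
have Bl i j k : B i j k = - B j i k.
  by rewrite /B Tl /g2_torsion /= (g2_wl T); ring.
have Br i j k : B i j k = - B i k j.
  by rewrite /B Tr /g2_torsion /= (g2_wr T); ring.
have q1 := g2f_q G Dy.
have Bw m i j k : \sum_s B m i s * w7 r s j k y + \sum_s B m j s * w7 r i s k y
    + \sum_s B m k s * w7 r i j s y = 0.
  have wE a b e : w7 r a b e y = sphere7_omega r [:: a; b; e] y.
    by rewrite sphere7_omegaE // q1 mul1r.
  rewrite -[RHS](parallel_tconnB3 Tpar sphere7_parallel m i j k Dy).
  by congr (_ + _ + _); apply: eq_bigr => s _; rewrite wE.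
have Bb m i : \sum_u \sum_v B m u v * w7 r u v i y = 2 * 0.
  rewrite mulr0; apply: (mulfI (_ : 12 != 0)); first by rewrite pnatr_eq0.
  rewrite mulr0 -(contract_w_p _ _ T) //; do 3 (apply: big1 => ? _).
  by rewrite Bw mulr0.
have [B0 _] := torsion_spinor_eq0 r_neq0 Dy (b := fun _ _ => 0) Bl Br
  (fun _ _ => esym (oppr0 _))
  (fun i => big1 _ _ _ (fun p _ => big1 _ _ _ (fun q _ => mul0r _)))
  Bb.
exact: B0.
Qed.
End Sphere7.

(** * Supersymmetry on the sphere *)

Section Sphere7Spinor.
Variables (R : realType) (r : R).
Hypothesis r_neq0 : r != 0.
Local Notation S7 := (sphere7 r).
Local Notation E := (@gamma7 R).
Let c := - (2 / r).
Let G := sphere7_g2_frame r_neq0.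

Lemma cliff2_w7 t m x : pts S7 x ->
  cliff2 E (fun p q => t * w7 r m p q x) *m x = (6 * t) *: (E m *m x).
Proof.
move=> Dx; have T := g2f_tensors G x; have q1 := g2f_q G Dx.
rewrite (cliff2_spinor r_neq0 Dx) => [|p q]; last by rewrite (g2_wr T) mulrN.
rewrite -(kron_scale m (fun i => (6 * t) *: (E i *m x))); apply: eq_bigr => i _.
rewrite scalerA; congr (_ *: _).
transitivity (t * \sum_p \sum_q w7 r m p q x * w7 r i p q x).
  rewrite mulr_sumr; apply: eq_bigr => p _; rewrite mulr_sumr; apply: eq_bigr => q _.
  by rewrite (w_cyc T i) mulrA.
by rewrite (sum_w_iab_w_jab T) q1 expr1n mulr1 (kronC i m); ring.
Qed.

Lemma sphere7_spinor_defines : spinor_defines E (pts S7) 3 (sphere7_omega r) id.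
Proof.
split=> [|x Dx].
  exists setT; split=> //; first exact: openT.
  by apply: smooth_on_linear => // x; exact: cvg_id.
have x2 : dot x x = r ^+ 2 := Dx; split.
  by apply: contra_eq_neq x2 => ->; rewrite /dot mulmx0 mxE eq_sym expf_neq0.
move=> [|i [|j [|k []]]] // _ _.
rewrite sphere7_omegaE // (g2f_q G Dx) mul1r -/(dot x x) x2 /w7 !mulNr mulrAC.
rewrite mulVf ?expf_neq0 // mul1r /qs /qform /=.
by rewrite mulmx1 !mulmxA.
Qed.

Lemma sphere7_gravitino : gravitino S7 E (pts S7) (g2_torsion c (w7 r)) id.
Proof.
move=> x m Dx; rewrite /spin_cov.
have -> : 'D_(fr S7 m x) id x = r^-1 *: (E m *m x).
  by case: (is_derive_id x (fr S7 m x)).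
have -> : cliff2 E (fun p q => lc S7 m p q x) = cliff2 E (fun p q => c / 2 * w7 r m p q x).
  by apply: eq_bigr => p _; apply: eq_bigr => q _; rewrite (g2_lc G).
rewrite [id x]/= !cliff2_w7 // !scalerA -!scalerDl.
(* The three coefficients are 1/r, (1/4) 6 (c/2) and (1/8) 6 (- c/3), with sum 1/r + c/2 = 0. *)
rewrite (_ : _ + _ + _ = 0) ?scale0r // /c.
by field.
Qed.

Lemma sphere7_gaugino : gaugino E (pts S7)
  (curv S7 (tconn S7 (g2_torsion c (w7 r)))) id.
Proof.
move=> x a b Dx; have T := g2f_tensors G x.
rewrite [id x]/= (cliff2_spinor r_neq0 Dx) => [|p q]; last first.
  by rewrite !(g2_curv_torsion G) // -(gcurv_skewl G).
rewrite big1 // => i _; rewrite -[RHS](scale0r (E i *m x)); congr (_ *: _).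
rewrite -[RHS](sum_w_gcurv_eq0 G i a b Dx); apply: eq_bigr => p _; apply: eq_bigr => q _.
by rewrite (g2_curv_torsion G) // mulrC (w_cyc T i).
Qed.

End Sphere7Spinor.

(** * Products with a curve *)

Section Pullback.
Variables (R : realType) (V W : normedModType R) (n : nat).
Implicit Types (a : dform V n) (x : V * W).

Lemma pullback_lift a (I : seq 'I_n) x :
  pullback a (map (lift ord0) I) x = a I x.1.
Proof.
have H i : lift ord0 i != ord0 :> 'I_n.+1 by rewrite eq_sym neq_lift.
rewrite /pullback all_map (_ : all _ I = true); last by apply/allP => i _; exact: H.
congr a; elim: I => //= i I ->.
by rewrite liftK.
Qed.

Lemma pullback_ord0 a (I : seq 'I_n.+1) x : ord0 \in I -> pullback a I x = 0.
Proof.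
move=> I0; rewrite /pullback ifN //; apply/negP => /allP /(_ _ I0).
by rewrite eqxx.
Qed.

Lemma pullbackP (I : seq 'I_n.+1) :
  {J : seq 'I_n | I = map (lift ord0) J} + {ord0 \in I}.
Proof.
have [|I0] := boolP (ord0 \in I); [by right|left].
exists (pmap (unlift ord0) I); elim: I I0 => //= i I IH.
rewrite inE negb_or => /andP[i0 /IH IE].
by case: (unliftP ord0 i) i0 IE => [j ->|-> //] _ IE /=; rewrite -IE.
Qed.

End Pullback.

Section DerivePullback.
Variables (R : realType).

Lemma is_derive_linear_comp (V V' W : normedModType R) (L : V' -> V) (g : V -> W) dg x v :
  linear L -> is_derive (L x) (L v) g dg -> is_derive x v (g \o L) dg.
Proof.
move=> lL [dg1 dg2].
have E : (fun h : R => h^-1 *: ((g \o L) (h *: v + x) - (g \o L) x)) =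
    fun h : R => h^-1 *: (g (h *: L v + L x) - g (L x)).
  by apply/funext => h /=; rewrite lL.
apply: DeriveDef.
  by move: dg1; rewrite /derivable -E.
by rewrite -dg2 /derive -E.
Qed.

Lemma is_derive0 (V W : normedModType R) (f : V -> W) x : is_derive x 0 f 0.
Proof.
have E : (fun h : R => h^-1 *: ((f \o shift x) (h *: 0) - f x)) = fun=> 0.
  by apply/funext => h /=; rewrite scaler0 add0r subrr scaler0.
apply: DeriveDef; first by rewrite /derivable E; exact: is_cvg_cst.
rewrite /derive E; exact: lim_cst.
Qed.

Variables (V W : normedModType R) (n : nat) (M : framed V n) (L : framed W 1).
Local Notation P := (prod_framed M L).

Lemma is_derive_pullback (k : nat) (a da : dform V n) m I y :
  (forall m I z, size I = k -> is_derive z (fr M m z) (a I) (da (m :: I) z)) ->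
  size I = k -> is_derive y (fr P m y) (pullback a I) (pullback da (m :: I) y).
Proof.
move=> aD Ik; have [[J IE]|I0] := pullbackP I; last first.
  rewrite pullback_ord0 ?inE ?I0 ?orbT //.
  have -> : pullback a I = (fun=> 0 : R) :> (V * W -> R).
    by apply/funext => z; exact: pullback_ord0.
  exact: is_derive_cst.
have -> : pullback a I = (a J \o fst : V * W -> R).
  by apply/funext => z; rewrite IE pullback_lift.
case: (unliftP ord0 m) => [j ->|->].
  rewrite IE -map_cons pullback_lift; apply: is_derive_linear_comp; first exact: linear_fst.
  by rewrite /= liftK; apply: aD; rewrite -Ik IE size_map.
rewrite pullback_ord0 ?inE //; apply: is_derive_linear_comp; first exact: linear_fst.
by rewrite /= unlift_none; exact: is_derive0.
Qed.

End DerivePullback.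

Definition horizontal (R : realType) n (i j : 'I_n.+1) : R :=
  kron i j - kron i ord0 * kron j ord0.

Section ProductTensors.
Variables (R : realType) (V W : normedModType R) (n : nat).
Variables (w : 'I_n -> 'I_n -> 'I_n -> V -> R) (p : 'I_n -> 'I_n -> 'I_n -> 'I_n -> V -> R).
Local Notation d8 := (@horizontal R n).

Definition pull3 i j k : V * W -> R := pullback (form3 w) [:: i; j; k].
Definition pull4 i j k l : V * W -> R := pullback (form4 p) [:: i; j; k; l].

Lemma pull3_lift i j k y : pull3 (lift ord0 i) (lift ord0 j) (lift ord0 k) y = w i j k y.1.
Proof. exact: (pullback_lift _ [:: i; j; k]). Qed.

Lemma pull4_lift i j k l y :
  pull4 (lift ord0 i) (lift ord0 j) (lift ord0 k) (lift ord0 l) y = p i j k l y.1.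
Proof. exact: (pullback_lift _ [:: i; j; k; l]). Qed.

Lemma pull3_0 y i j : (pull3 ord0 i j y = 0) * (pull3 i ord0 j y = 0) * (pull3 i j ord0 y = 0).
Proof. by do !split; apply: pullback_ord0; rewrite !inE eqxx ?orbT. Qed.

Lemma pull4_0 y i j k : (pull4 ord0 i j k y = 0) * (pull4 i ord0 j k y = 0)
  * (pull4 i j ord0 k y = 0) * (pull4 i j k ord0 y = 0).
Proof. by do !split; apply: pullback_ord0; rewrite !inE eqxx ?orbT. Qed.

Lemma horizontal_lift i j : d8 (lift ord0 i) (lift ord0 j) = kron i j.
Proof.
rewrite /horizontal /kron (inj_eq (@lift_inj _ _)).
by rewrite (eq_sym (lift _ i) _) (negPf (neq_lift _ _)) mul0r subr0.
Qed.

Lemma horizontal_0 i : (d8 ord0 i = 0) * (d8 i ord0 = 0).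
Proof.
rewrite /horizontal (kronC ord0) {1 3}/kron.
by rewrite /kron eqxx mul1r mulr1 subrr.
Qed.

Let simp := (pull3_lift, pull4_lift, horizontal_lift, pull3_0, pull4_0, horizontal_0).
Ltac lift_case i := case: (unliftP ord0 i) => [?|] ->.
Ltac sum_simp := rewrite big1 => [|? _]; rewrite ?simp ?(mul0r, mulr0, subr0, addr0, oppr0).

(** Components with an index [ord0] vanish on both sides, and the others are those of M. The trace
    stays 7 because the metric is degenerate along e_0. *)
Lemma pull_g2_tensors q y : g2_tensors kron (fun i j k => w i j k y.1)
    (fun i j k l => p i j k l y.1) q ->
  g2_tensors d8 (fun i j k => pull3 i j k y) (fun i j k l => pull4 i j k l y) q.
Proof.
move=> T; split.
- by move=> i j; rewrite /horizontal (kronC i j) mulrC.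
- move=> i j k; lift_case i; lift_case j; lift_case k; rewrite !simp ?oppr0 //.
  exact: g2_wl T _ _ _.
- move=> i j k; lift_case i; lift_case j; lift_case k; rewrite !simp ?oppr0 //.
  exact: g2_wr T _ _ _.
- move=> i j k l; lift_case i; lift_case j; lift_case k; lift_case l; rewrite !simp ?oppr0 //.
  exact: g2_pl T _ _ _ _.
- move=> i j k l; lift_case i; lift_case j; lift_case k; lift_case l; rewrite !simp ?oppr0 //.
  exact: g2_pm T _ _ _ _.
- move=> i j k l; lift_case i; lift_case j; lift_case k; lift_case l; rewrite !simp ?oppr0 //.
  exact: g2_pr T _ _ _ _.
- move=> i j; rewrite big_ord_recl !simp mul0r add0r.
  lift_case i; lift_case j; rewrite !simp; try by sum_simp.
  by under eq_bigr do rewrite !simp; exact: g2_dd T _ _.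
- move=> i j k; rewrite big_ord_recl !simp mul0r add0r.
  lift_case i; lift_case j; lift_case k; rewrite !simp; try by sum_simp.
  by under eq_bigr do rewrite !simp; exact: g2_dw T _ _ _.
- move=> i j k l; rewrite big_ord_recl !simp mul0r add0r.
  lift_case i; lift_case j; lift_case k; lift_case l; rewrite !simp; try by sum_simp.
  by under eq_bigr do rewrite !simp; exact: g2_dp T _ _ _ _.
- rewrite big_ord_recl !simp add0r; under eq_bigr do rewrite !simp.
  exact: g2_tr T.
- move=> i j k l; rewrite big_ord_recl !simp mul0r add0r.
  lift_case i; lift_case j; lift_case k; lift_case l; rewrite !simp; try by sum_simp.
  by under eq_bigr do rewrite !simp; exact: g2_ww T _ _ _ _.
- move=> i j k l m; rewrite big_ord_recl !simp mul0r add0r.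
  lift_case i; lift_case j; lift_case k; lift_case l; lift_case m;
    rewrite !simp; try by sum_simp.
  by under eq_bigr do rewrite !simp; exact: g2_wp T _ _ _ _ _.
Qed.

End ProductTensors.

(** * The frame of a product with a curve whose unit tangent field is affine: constant on the line,
    linear on the circle *)

Section ProductFrame.
Variables (R : realType) (V W : normedModType R) (n : nat).
Variables (M : framed V n) (L : framed W 1).
Variables (c : R) (w : 'I_n -> 'I_n -> 'I_n -> V -> R).
Variables (p : 'I_n -> 'I_n -> 'I_n -> 'I_n -> V -> R) (q : V -> R).
Hypothesis G : g2_frame M (pts M) c kron w p q.
Hypothesis frM_linear : forall i, linear (fr M i).
Hypotheses (ipM0l : forall u, ip M 0 u = 0) (ipM0r : forall u, ip M u 0 = 0).
Hypothesis ipL0l : forall u, ip L 0 u = 0.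
Variables (l : W -> W) (b : W).
Hypotheses (l_linear : linear l) (frLE : forall z, fr L ord0 z = l z + b).
Local Notation P := (prod_framed M L).

Lemma prod_fr_lift i x : fr P (lift ord0 i) x = (fr M i x.1, 0).
Proof. by rewrite /= liftK. Qed.

Lemma prod_fr_0 x : fr P ord0 x = (0, fr L ord0 x.2).
Proof. by rewrite /= unlift_none. Qed.

Lemma linear_0 (U U' : lmodType R) (f : U -> U') : linear f -> f 0 = 0.
Proof. by move=> fl; have := fl (- 1) 0 0; rewrite scaler0 addr0 scaleN1r addNr. Qed.

Lemma derive_prod_fr_lift i v x : 'D_v (fr P (lift ord0 i)) x = (fr M i v.1, 0).
Proof.
have -> : fr P (lift ord0 i) = (fun x => (fr M i x.1, 0)) by apply/funext/prod_fr_lift.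
case: (@is_derive_linear R (V * W)%type (V * W)%type (fun x => (fr M i x.1, 0)) x v) => //.
by move=> a u z /=; rewrite frM_linear [RHS]surjective_pairing /= scaler0 addr0.
Qed.

Lemma derive_prod_fr_0 v x : 'D_v (fr P ord0) x = (0, l v.2).
Proof.
have -> : fr P ord0 = (fun x => (0, l x.2)) + (fun=> (0, b)).
  by apply/funext => z; rewrite prod_fr_0 frLE [RHS]surjective_pairing /= addr0.
have H : is_derive x v (fun x : V * W => (0 : V, l x.2)) (0, l v.2).
  apply: (@is_derive_linear R (V * W)%type (V * W)%type) => a u z /=.
  by rewrite l_linear [RHS]surjective_pairing /= scaler0 addr0.
by case: (is_deriveD H (is_derive_cst (0, b) x v)) => _ ->; rewrite addr0.
Qed.

Lemma prod_lie_lift i j x : lie P (lift ord0 i) (lift ord0 j) x = (lie M i j x.1, 0).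
Proof.
rewrite /lie !derive_prod_fr_lift !prod_fr_lift [LHS]surjective_pairing /= subr0.
congr (_ - _, _).
  by case: (is_derive_linear x.1 (fr M i x.1) (frM_linear j)) => _ ->.
by case: (is_derive_linear x.1 (fr M j x.1) (frM_linear i)) => _ ->.
Qed.

Lemma prod_lie_0 i x : lie P (lift ord0 i) ord0 x = 0 /\ lie P ord0 (lift ord0 i) x = 0.
Proof.
rewrite /lie !derive_prod_fr_lift !derive_prod_fr_0 prod_fr_lift prod_fr_0 /=.
by rewrite (linear_0 l_linear) (linear_0 (frM_linear i)) subrr.
Qed.

Lemma prod_struct i j k x : struct P i j k x = c * pull3 w i j k x.
Proof.
have ip0 u : ip P 0 u = 0 by rewrite /= ipM0l ipL0l addr0.
rewrite /struct; case: (unliftP ord0 i) => [i' ->|->].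
  case: (unliftP ord0 j) => [j' ->|->].
    rewrite prod_lie_lift; case: (unliftP ord0 k) => [k' ->|->].
      rewrite prod_fr_lift pull3_lift -(g2f_struct G).
      by rewrite /= ipL0l addr0.
    by rewrite prod_fr_0 pull3_0 mulr0 /= ipM0r ipL0l addr0.
  by rewrite (prod_lie_0 _ _).1 ip0 pull3_0 mulr0.
rewrite pull3_0 mulr0; case: (unliftP ord0 j) => [j' ->|->].
  by rewrite (prod_lie_0 _ _).2 ip0.
by rewrite /lie subrr ip0.
Qed.

Lemma prod_g2_frame : g2_frame P (pts P) c (@horizontal R n) (pull3 w) (pull4 p) (q \o fst).
Proof.
split.
- move=> y; apply: pull_g2_tensors; exact: g2f_tensors G y.1.
- by move=> y [Dy _]; rewrite /= (g2f_q G).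
- exact: prod_struct.
- move=> m y; apply: is_derive_linear_comp; first exact: linear_fst.
  case: (unliftP ord0 m) => [j ->|->]; rewrite (prod_fr_lift, prod_fr_0).
    exact: g2f_Dq G _ _.
  exact: is_derive0.
- move=> m i j k y.
  have := @is_derive_pullback R V W n M L 3 (form3 w) (form4 (fun m i j k y => c * p m i j k y))
    m [:: i; j; k] y.
  move/(_ _ erefl) => H.
  have -> : c * pull4 p m i j k y =
      pullback (form4 (fun m i j k y => c * p m i j k y)) [:: m; i; j; k] y.
    rewrite /pull4 /pullback; case: ifP => _; last by rewrite mulr0.
    by case: (pmap _ _) => [|? [|? [|? [|? []]]]] //=; rewrite mulr0.
  apply: H => m' [|i' [|j' [|k' []]]] // z _.
  exact: g2f_Dw G _ _ _ _ _.
- move=> m i j k s y.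
  pose da : dform V n := fun I z => if I is [:: m; i; j; k; s] then
    - c * (kron m i * w j k s z - kron m j * w i k s z + kron m k * w i j s z
            - kron m s * w i j k z) else 0.
  have -> : - c * (horizontal R m i * pull3 w j k s y - horizontal R m j * pull3 w i k s y
      + horizontal R m k * pull3 w i j s y - horizontal R m s * pull3 w i j k y) =
      pullback da [:: m; i; j; k; s] y.
    have simp := (@pull3_lift R V W n w, @horizontal_lift R n, @pull3_0 R V W n w, @horizontal_0 R n).
    case: (unliftP ord0 m) => [m' ->|->]; last first.
      by rewrite pullback_ord0 ?inE // !simp !mul0r !subrr ?addr0 ?subr0 ?mulr0.
    have [[J JE]|J0] := pullbackP [:: i; j; k; s].
      rewrite JE -map_cons pullback_lift.
      case: J JE => [|? [|? [|? [|? []]]]] // [-> -> -> ->].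
      by rewrite !simp.
    rewrite pullback_ord0; last by rewrite inE J0 orbT.
    by move: J0; rewrite !inE => /or4P[] /eqP <-;
      rewrite !simp ?(mulr0, mul0r, subr0, addr0, add0r, oppr0).
  have H := @is_derive_pullback R V W n M L 4 (form4 p) da m [:: i; j; k; s] y.
  apply: H => // m' [|i' [|j' [|k' [|l' []]]]] // z _.
  exact: g2f_Dp G _ _ _ _ _ _.
Qed.

End ProductFrame.

(** * The 4-form e wedge w + p *)

Section Spin7Forms.
Variables (R : realType) (V : normedModType R) (n : nat) (M : framed V n).
Variables (D : set V) (c : R) (d : 'I_n -> 'I_n -> R).
Variables (w : 'I_n -> 'I_n -> 'I_n -> V -> R).
Variables (p : 'I_n -> 'I_n -> 'I_n -> 'I_n -> V -> R) (q : V -> R).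
Hypothesis G : g2_frame M D c d w p q.
Variable e : 'I_n -> R.
Hypothesis eE : forall i j, kron i j = d i j + e i * e j.
Hypothesis e_sqr : \sum_i e i * e i = 1.

Let T y := g2f_tensors G y.

Definition spin7 i j k l y : R := e i * w j k l y - e j * w i k l y + e k * w i j l y
  - e l * w i j k y + p i j k l y.

Definition e_wedge_p i j k l m y : R := e i * p j k l m y - e j * p i k l m y
  + e k * p i j l m y - e l * p i j k m y + e m * p i j k l y.

(** Contracting w with the identity and with d gives the same result, so e_k <e, w> = 0 for every k;
    then the unit length of e is used. *)
Lemma sum_e_w i j y : \sum_s e s * w s i j y = 0.
Proof.
have H k : e k * \sum_s e s * w s i j y = 0.
  rewrite -[RHS](subrr (w k i j y)) -{1}(kron_sum k (fun s => w s i j y)).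
  rewrite -[in X in _ - X](d_w1 (T y)) mulr_sumr -sumrB; apply: eq_bigr => s _.
  by rewrite eE; ring.
transitivity (\sum_k e k * (e k * \sum_s e s * w s i j y)).
  under [RHS]eq_bigr do rewrite mulrA.
  by rewrite -mulr_suml e_sqr mul1r.
by rewrite big1 // => k _; rewrite H mulr0.
Qed.

Lemma spin7_swapl i j k l y : spin7 i j k l y = - spin7 j i k l y.
Proof. by rewrite /spin7 (g2_wl (T y) i j l) (g2_wl (T y) i j k) (g2_pl (T y) i); ring. Qed.

Lemma spin7_swapm i j k l y : spin7 i j k l y = - spin7 i k j l y.
Proof. by rewrite /spin7 (g2_wl (T y) j k) (g2_wr (T y) i j k) (g2_pm (T y) i); ring. Qed.

Lemma spin7_swapr i j k l y : spin7 i j k l y = - spin7 i j l k y.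
Proof. by rewrite /spin7 (g2_wr (T y) j k) (g2_wr (T y) i k) (g2_pr (T y) i); ring. Qed.

Lemma is_derive_spin7 m i j k l y : is_derive y (fr M m y) (spin7 i j k l)
  (c * (e i * p m j k l y - e j * p m i k l y + e k * p m i j l y - e l * p m i j k y
   - (d m i * w j k l y - d m j * w i k l y + d m k * w i j l y - d m l * w i j k y))).
Proof.
have Dw := g2f_Dw G m; have Dp := g2f_Dp G m.
have -> : spin7 i j k l = e i *: w j k l - e j *: w i k l + e k *: w i j l
  - e l *: w i j k + p i j k l by [].
apply: is_derive_eq (is_deriveD (is_deriveB (is_deriveD (is_deriveB
  (is_deriveZ (e i) (Dw j k l y)) (is_deriveZ (e j) (Dw i k l y)))
  (is_deriveZ (e k) (Dw i j l y))) (is_deriveZ (e l) (Dw i j k y))) (Dp i j k l y)) _.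
rewrite /GRing.scale /=; ring.
Qed.

Lemma sum_w_spin7 u v j k l y : \sum_s w u v s y * spin7 s j k l y =
  - e j * (q y * p u v k l y + q y ^+ 2 * (d u k * d v l - d u l * d v k))
  + e k * (q y * p u v j l y + q y ^+ 2 * (d u j * d v l - d u l * d v j))
  - e l * (q y * p u v j k y + q y ^+ 2 * (d u j * d v k - d u k * d v j))
  + q y * (d u j * w v k l y - d u k * w v j l y + d u l * w v j k y
           - d v j * w u k l y + d v k * w u j l y - d v l * w u j k y).
Proof.
rewrite -!(g2_ww (T y)) -(g2_wp (T y)).
transitivity (w j k l y * \sum_s e s * w s u v y - e j * \sum_s w u v s y * w k l s y
   + e k * \sum_s w u v s y * w j l s y - e l * \sum_s w u v s y * w j k s y
   + \sum_s w u v s y * p s j k l y).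
  rewrite !mulr_sumr -sumrB -big_split -sumrB -big_split; apply: eq_bigr => s _ /=.
  rewrite /spin7 (w_cyc (T y) s k l) (w_cyc (T y) s j l) (w_cyc (T y) s j k).
  by rewrite (w_cyc (T y) s u v); ring.
by rewrite sum_e_w mulr0 sub0r mulNr.
Qed.

Lemma cov_spin7 m i j k l y : D y ->
  cov M (tconn M (g2_torsion c w)) m (form4 spin7) [:: i; j; k; l] y = 0.
Proof.
move=> Dy; have q1 := g2f_q G Dy; rewrite cov4 (g2_tconn_torsion G) /=.
have -> : 'D_(fr M m y) (spin7 i j k l) y = c * (e i * p m j k l y - e j * p m i k l y
   + e k * p m i j l y - e l * p m i j k y
   - (d m i * w j k l y - d m j * w i k l y + d m k * w i j l y - d m l * w i j k y)).
  by case: (is_derive_spin7 m i j k l y).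
have S u v a b f (z : R) (P : 'I_n -> R) : (forall s, P s = z * spin7 s a b f y) ->
    \sum_s c / 3 * w u v s y * P s = c / 3 * z * (
  - e a * (p u v b f y + (d u b * d v f - d u f * d v b))
  + e b * (p u v a f y + (d u a * d v f - d u f * d v a))
  - e f * (p u v a b y + (d u a * d v b - d u b * d v a))
  + (d u a * w v b f y - d u b * w v a f y + d u f * w v a b y
           - d v a * w u b f y + d v b * w u a f y - d v f * w u a b y)).
  move=> PE; transitivity (c / 3 * z * \sum_s w u v s y * spin7 s a b f y).
    by rewrite mulr_sumr; apply: eq_bigr => s _; rewrite PE; ring.
  by rewrite sum_w_spin7 q1 expr1n !mul1r.
rewrite (S m i j k l 1) => [|s]; last by rewrite mul1r.
rewrite (S m j i k l (- 1)) => [|s]; last by rewrite (spin7_swapl i s) mulN1r.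
rewrite (S m k i j l 1) => [|s]; last first.
  by rewrite (spin7_swapm i j s) (spin7_swapl i s) opprK mul1r.
rewrite (S m l i j k (- 1)) => [|s]; last first.
  by rewrite (spin7_swapr i j k s) (spin7_swapm i j s) (spin7_swapl i s) opprK mulN1r.
rewrite (g2_dC (T y) k j) (g2_dC (T y) k i) (g2_dC (T y) j i) (g2_dC (T y) l i).
rewrite (g2_dC (T y) l j) (g2_dC (T y) l k).
rewrite ?(w_sort (T y) i j k) ?(w_sort (T y) i j l).
rewrite ?(w_sort (T y) i k l) ?(w_sort (T y) j k l).
rewrite ?(g2_pm (T y) m j i) ?(g2_pm (T y) m k i) ?(g2_pm (T y) m k j) ?(g2_pm (T y) m l i) ?(g2_pm (T y) m l j).
rewrite ?(g2_pr (T y) m i l k) ?(g2_pr (T y) m i k j) ?(g2_pr (T y) m i l j) ?(g2_pr (T y) m j l k).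
by field.
Qed.

(** Both e and p are closed, so what remains is - e wedge dw, with dw as in [extd_w3form]. *)
Lemma extd_spin7 i j k l m y :
  extd M (form4 spin7) [:: i; j; k; l; m] y = c * (6 * q y - 4) * e_wedge_p i j k l m y.
Proof.
have Dp m' a b f g : 'D_(fr M m' y) (spin7 a b f g) y =
    c * (e a * p m' b f g y - e b * p m' a f g y + e f * p m' a b g y - e g * p m' a b f y
   - (d m' a * w b f g y - d m' b * w a f g y + d m' f * w a b g y - d m' g * w a b f y)).
  by case: (is_derive_spin7 m' a b f g y).
have S a b f g h : \sum_s struct M a b s y * spin7 s f g h y =
    c * \sum_s w a b s y * spin7 s f g h y.
  by rewrite mulr_sumr; apply: eq_bigr => s _; rewrite (g2f_struct G) mulrA.
rewrite extd5 /= !Dp !S !sum_w_spin7 /e_wedge_p.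
rewrite (g2_dC (T y) j i) (g2_dC (T y) k i) (g2_dC (T y) l i) (g2_dC (T y) m i).
rewrite (g2_dC (T y) k j) (g2_dC (T y) l j) (g2_dC (T y) m j) (g2_dC (T y) l k).
rewrite (g2_dC (T y) m k) (g2_dC (T y) m l).
rewrite ?(w_sort (T y) i j k) ?(w_sort (T y) i j l) ?(w_sort (T y) i j m).
rewrite ?(w_sort (T y) i k l) ?(w_sort (T y) i k m) ?(w_sort (T y) i l m).
rewrite ?(w_sort (T y) j k l) ?(w_sort (T y) j k m) ?(w_sort (T y) j l m).
rewrite ?(w_sort (T y) k l m) ?(p_sort (T y) i j k l) ?(p_sort (T y) i j k m).
rewrite ?(p_sort (T y) i j l m) ?(p_sort (T y) i k l m) ?(p_sort (T y) j k l m).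
by ring.
Qed.

End Spin7Forms.

(** * The Lee form of the product *)

Section StarWedge.
Variables (R : realType).

Lemma eps_swap n : swap_skew (V := R^o) (fun _ : seq 'I_n => True) (@eps R n).
Proof.
by move=> s x y t _; rewrite /eps !map_cat /= mono_swap rmorphN.
Qed.

Lemma eps_front n s (x : 'I_n) t : eps R (s ++ x :: t) = (-1) ^+ size s * eps R (x :: s ++ t).
Proof.
by apply: (swap_skew_front (C := fun _ : seq 'I_n => True) (V := R^o)) => //; exact: eps_swap.
Qed.

Lemma eps_catC n (s t u : seq 'I_n) :
  eps R (s ++ t ++ u) = (-1) ^+ (size s * size t) * eps R (t ++ s ++ u).
Proof.
elim: t s => [|x t IH] s; first by rewrite muln0 mul1r.
rewrite /= eps_front -cat_cons IH /= eps_front !mulrA -!exprD; congr (_ * _).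
have -> : (size s + (size s).+1 * size t + size t = size s * (size t).+1 + (size t).*2)%N.
  by rewrite mulSn mulnS -addnn -!addnA; congr addn; rewrite addnCA.
by rewrite exprD -[X in _ * X]signr_odd odd_double mulr1.
Qed.

Lemma eps_lift n (L : seq 'I_n) : eps R (ord0 :: map (lift ord0) L) = eps R L.
Proof.
rewrite /eps map_cons !mono_iota -[iota 0 n.+1]/(0%N :: iota 1 n); congr (_%:~R).
have -> : [seq val i | i <- [seq lift ord0 i | i <- L]] = map S [seq val i | i <- L].
  by rewrite -!map_comp; apply: eq_map => i; exact: lift0.
move: [seq val i | i <- L] => s.
have -> : perm_eq (0%N :: map S s) (0%N :: iota 1 n) = perm_eq s (iota 0 n).
  rewrite perm_cons (iotaDl 1 0 n) (_ : map S s = map (addn 1) s) //.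
  by apply/idP/idP => [|/perm_map -> //]; apply: perm_map_inj; exact: addnI.
case: ifP => // _; congr (_ ^+ _).
rewrite /= (eq_count (a2 := pred0)) // count_pred0 add0n.
elim: s => //= a s ->; congr (_ + _)%N.
by rewrite count_map; apply: eq_count.
Qed.

(** The volume symbol is itself alternating, so all k! permutations give the same sum. This removes
    the alternation from the star of a wedge product. *)
Lemma sum_eps_alt n k (f : seq 'I_n -> R) (I : seq 'I_n) :
  \sum_(J : k.-tuple 'I_n) eps R (J ++ I) * alt f J =
  k`!%:R * \sum_(J : k.-tuple 'I_n) eps R (J ++ I) * f J.
Proof.
rewrite /alt; under eq_bigr do rewrite mulr_sumr.
rewrite exchange_big /= -card_Sn -sum1_card natr_sum mulr_suml; apply: eq_bigr => s _.
rewrite mul1r (reindex_inj (h := fun J : k.-tuple 'I_n => [tuple tnth J (s^-1%g i) | i < k])) /=.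
  apply: eq_bigr => J _.
  have -> : [seq tnth [tuple tnth J (s^-1%g i) | i < k] (s i) | i <- enum 'I_k] = J.
    rewrite -[RHS]map_tnth_enum; apply: eq_map => i.
    by rewrite tnth_mktuple permK.
  have := @swap_skew_perm _ R^o _ (fun=> True) (@eps R n) k J s^-1%g I (fun _ _ _ _ => id)
    (@eps_swap n) Logic.I.
  rewrite odd_permV => ->; rewrite -[_ *: _]/((-1) ^+ s * eps R (J ++ I)).
  by rewrite mulrACA -signr_addb addbb mul1r.
move=> J J' /(congr1 (fun J : k.-tuple _ => tnth J)) E; apply: eq_from_tnth => i.
by have := congr1 (@^~ (s i)) E; rewrite !tnth_mktuple permK.
Qed.

Variables (V : normedModType R) (n : nat).

Lemma star_wedge k l (a b : dform V n) (I : seq 'I_n) x :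
  star (k + l) (wedge k a b) I x = ((k`! * l`!)%:R)^-1 *
    \sum_(K : k.-tuple 'I_n) \sum_(L : l.-tuple 'I_n) eps R (K ++ L ++ I) * (a K x * b L x).
Proof.
rewrite /star.
transitivity (((k + l)`!%:R)^-1 * (((k`! * l`!)%:R)^-1 * \sum_(J : (k + l).-tuple 'I_n)
    eps R (J ++ I) * alt (fun J => a (take k J) x * b (drop k J) x) J)).
  congr (_ * _); rewrite mulr_sumr; apply: eq_bigr => J _.
  by rewrite wedge_alt addKn mulrCA.
rewrite sum_eps_alt mulrCA mulKf ?pnatr_eq0 -?lt0n ?fact_gt0 //; congr (_ * _).
rewrite (sum_tuple_cat k l (fun J => eps R (J ++ I) * (a (take k J) x * b (drop k J) x))).
apply: eq_bigr => K _; apply: eq_bigr => L _.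
by rewrite take_size_cat ?size_tuple // drop_size_cat ?size_tuple // catA.
Qed.

End StarWedge.

Section SkewSums.
Variables (R : realType) (n : nat) (e : 'I_n -> R).
Variable g : seq 'I_n -> R.
Hypothesis g_skew : swap_skew (V := R^o) (fun _ : seq 'I_n => True) g.

Let g1 i j s : g (i :: j :: s) = - g (j :: i :: s).
Proof. exact: (g_skew (s := [::])). Qed.
Let g2 a i j s : g (a :: i :: j :: s) = - g (a :: j :: i :: s).
Proof. exact: (g_skew (s := [:: a])). Qed.
Let g3 a b i j s : g (a :: b :: i :: j :: s) = - g (a :: b :: j :: i :: s).
Proof. exact: (g_skew (s := [:: a; b])). Qed.
Let g4 a b c i j s : g (a :: b :: c :: i :: j :: s) = - g (a :: b :: c :: j :: i :: s).
Proof. exact: (g_skew (s := [:: a; b; c])). Qed.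

Lemma sum_skew_e4 (w : 'I_n -> 'I_n -> 'I_n -> R) :
  \sum_i \sum_j \sum_k \sum_l g [:: i; j; k; l] *
    (e i * w j k l - e j * w i k l + e k * w i j l - e l * w i j k) =
  4 * \sum_i \sum_j \sum_k \sum_l g [:: i; j; k; l] * (e i * w j k l).
Proof.
pose A i j k l := g [:: i; j; k; l] * (e i * w j k l).
transitivity (\sum_i \sum_j \sum_k \sum_l A i j k l + \sum_i \sum_j \sum_k \sum_l A j i k l
  + \sum_i \sum_j \sum_k \sum_l A k i j l + \sum_i \sum_j \sum_k \sum_l A l i j k).
  rewrite -!big_split; apply: eq_bigr => i _; rewrite -!big_split; apply: eq_bigr => j _.
  rewrite -!big_split; apply: eq_bigr => k _; rewrite -!big_split; apply: eq_bigr => l _ /=.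
  rewrite /A (g1 j i) (g1 k i) (g2 i k j) (g1 l i) (g2 i l j) (g3 i j l k).
  by move: (g _) => *; ring.
have H1 : \sum_i \sum_j \sum_k \sum_l A j i k l = \sum_i \sum_j \sum_k \sum_l A i j k l.
  exact: exchange_big.
have H2 : \sum_i \sum_j \sum_k \sum_l A k i j l = \sum_i \sum_j \sum_k \sum_l A i j k l.
  by under eq_bigr do rewrite exchange_big; exact: exchange_big.
have H3 : \sum_i \sum_j \sum_k \sum_l A l i j k = \sum_i \sum_j \sum_k \sum_l A i j k l.
  under eq_bigr do under eq_bigr do rewrite exchange_big.
  by under eq_bigr do rewrite exchange_big; exact: exchange_big.
by rewrite H1 H2 H3 /A; ring.
Qed.

Lemma sum_skew_e5 (p : 'I_n -> 'I_n -> 'I_n -> 'I_n -> R) :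
  \sum_i \sum_j \sum_k \sum_l \sum_m g [:: i; j; k; l; m] *
    (e i * p j k l m - e j * p i k l m + e k * p i j l m - e l * p i j k m
     + e m * p i j k l) =
  5 * \sum_i \sum_j \sum_k \sum_l \sum_m g [:: i; j; k; l; m] * (e i * p j k l m).
Proof.
pose A i j k l m := g [:: i; j; k; l; m] * (e i * p j k l m).
transitivity (\sum_i \sum_j \sum_k \sum_l \sum_m A i j k l m
  + \sum_i \sum_j \sum_k \sum_l \sum_m A j i k l m
  + \sum_i \sum_j \sum_k \sum_l \sum_m A k i j l m
  + \sum_i \sum_j \sum_k \sum_l \sum_m A l i j k m
  + \sum_i \sum_j \sum_k \sum_l \sum_m A m i j k l).
  rewrite -!big_split; apply: eq_bigr => i _; rewrite -!big_split; apply: eq_bigr => j _.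
  rewrite -!big_split; apply: eq_bigr => k _; rewrite -!big_split; apply: eq_bigr => l _ /=.
  rewrite -!big_split; apply: eq_bigr => m _ /=.
  rewrite /A (g1 j i) (g1 k i) (g2 i k j) (g1 l i) (g2 i l j) (g3 i j l k).
  rewrite (g1 m i) (g2 i m j) (g3 i j m k) (g4 i j k m l).
  by move: (g _) => *; ring.
have H1 : \sum_i \sum_j \sum_k \sum_l \sum_m A j i k l m =
    \sum_i \sum_j \sum_k \sum_l \sum_m A i j k l m.
  exact: exchange_big.
have H2 : \sum_i \sum_j \sum_k \sum_l \sum_m A k i j l m =
    \sum_i \sum_j \sum_k \sum_l \sum_m A i j k l m.
  by under eq_bigr do rewrite exchange_big; exact: exchange_big.
have H3 : \sum_i \sum_j \sum_k \sum_l \sum_m A l i j k m =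
    \sum_i \sum_j \sum_k \sum_l \sum_m A i j k l m.
  under eq_bigr do under eq_bigr do rewrite exchange_big.
  by under eq_bigr do rewrite exchange_big; exact: exchange_big.
have H4 : \sum_i \sum_j \sum_k \sum_l \sum_m A m i j k l =
    \sum_i \sum_j \sum_k \sum_l \sum_m A i j k l m.
  under eq_bigr do under eq_bigr do under eq_bigr do rewrite exchange_big.
  under eq_bigr do under eq_bigr do rewrite exchange_big.
  by under eq_bigr do rewrite exchange_big; exact: exchange_big.
by rewrite H1 H2 H3 H4 /A; ring.
Qed.

End SkewSums.

Lemma pullback_qM (R : realType) (V W : normedModType R) n k (a b : dform V n) (q : V -> R) :
  (forall I z, size I = k -> a I z = q z * b I z) ->
  forall I (y : V * W), size I = k -> pullback a I y = q y.1 * pullback b I y.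
Proof.
move=> ab I y Ik; have [[J JE]|I0] := pullbackP I.
  by rewrite JE !pullback_lift ab // -Ik JE size_map.
by rewrite !pullback_ord0 // mulr0.
Qed.

Notation product_g2_frame r L := (g2_frame (prod_framed (sphere7 r) L)
  (pts (prod_framed (sphere7 r) L)) (- (2 / r)) (@horizontal _ 7)
  (pull3 (w7 r)) (pull4 (p7 r)) (sq r \o fst)).

Section Lee.
Variables (R : realType) (r : R) (W : normedModType R) (L : framed W 1).
Local Notation P := (prod_framed (sphere7 r) L).
Local Notation V8 := ('cV[R]_8 * W)%type.
Hypothesis r_neq0 : r != 0.
Let c := - (2 / r).
Local Notation w8 := (@pull3 R 'cV[R]_8 W 7 (w7 r)).
Local Notation p8 := (@pull4 R 'cV[R]_8 W 7 (p7 r)).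
Local Notation e := (fun i : 'I_8 => @kron R 8 i ord0).
Hypothesis G : product_g2_frame r L.
Let T y := g2f_tensors G y.

Lemma horizontal_e i j : kron i j = horizontal R i j + e i * e j.
Proof. by rewrite /horizontal subrK. Qed.

Lemma e_sqr : \sum_i e i * e i = 1.
Proof. by rewrite kron_sum /kron eqxx. Qed.

Lemma product_PhiE I : size I = 4 -> product_Phi (sphere7_omega r) I =
  fun y : V8 => sq r y.1 * form4 (spin7 w8 p8 e) I y.
Proof.
case: I => [|i [|j [|k [|l []]]]] // _; apply/funext => y.
have omE a b f : pullback (sphere7_omega r) [:: a; b; f] y = sq r y.1 * w8 a b f y.
  by apply: (pullback_qM (k := 3)) => // -[|? [|? [|? []]]] // z _; exact: sphere7_omegaE.
rewrite /product_Phi wedge13 => [|u v t|u v t]; last 2 first.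
- by rewrite !omE (g2_wl (T y)) mulrN.
- by rewrite !omE (g2_wr (T y)) mulrN.
rewrite !omE (_ : pullback (star 3 _) _ y = sq r y.1 * p8 i j k l y); last first.
  apply: (pullback_qM (k := 4)) => // -[|? [|? [|? [|? []]]]] // z _.
  exact: star_sphere7_omega.
rewrite /= /spin7 /e0form !eqseq_cons !andbT /kron.
generalize_deltas; move: (w8 _ _ _ y) (w8 i _ _ y) (w8 i j _ y) (w8 i j k y) (p8 _ _ _ _ y).
by move: (sq r y.1) => *; ring.
Qed.

Lemma extd_product_Phi i j k l m y :
  extd P (product_Phi (sphere7_omega r)) [:: i; j; k; l; m] y =
  sq r y.1 * (c * (6 * sq r y.1 - 4)) * e_wedge_p p8 e i j k l m y.
Proof.
rewrite (extd_qM (g2f_Dq G) product_PhiE) => [|m' z [|a [|b [|f [|h []]]]] // _|//].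
  by rewrite (extd_spin7 G horizontal_e e_sqr) mulrA.
have H := is_derive_spin7 G e m'.
by case: (H a b f h z).
Qed.

Lemma eps_nuniq n (I : seq 'I_n) : ~~ uniq I -> eps R I = 0.
Proof.
rewrite /eps mono_iota; case: ifP => // /perm_uniq.
by rewrite iota_uniq (map_inj_uniq val_inj) => ->.
Qed.

Lemma eps_notin n (i : 'I_n) (I : seq 'I_n) : i \notin I -> eps R I = 0.
Proof.
rewrite /eps mono_iota; case: ifP => // /perm_mem /(_ (val i)).
by rewrite mem_iota add0n ltn_ord (mem_map val_inj) => ->.
Qed.

Lemma eps_swap_cat n (I : seq 'I_n) :
  swap_skew (V := R^o) (fun _ : seq 'I_n => True) (fun J => eps R (J ++ I)).
Proof. by move=> s x y' t _; rewrite -!catA; exact: eps_swap. Qed.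

Lemma sum_eps_pull_p4 i j k y : \sum_(N : 4.-tuple 'I_8)
    eps R (ord0 :: N ++ [:: i; j; k]) * pullback (form4 (p7 r)) N y = 24 * w8 i j k y.
Proof.
have [[I IE]|I0] := pullbackP [:: i; j; k]; last first.
  rewrite /pull3 pullback_ord0 // mulr0 big1 // => N _; rewrite eps_nuniq ?mul0r //.
  by rewrite /= mem_cat I0 orbT.
rewrite (sum_tuple_lift _ (F := fun N => eps R (ord0 :: N ++ [:: i; j; k])
  * pullback (form4 (p7 r)) N y)) => [|N N0]; last by rewrite pullback_ord0 ?mulr0.
rewrite /pull3 IE pullback_lift.
case: I IE => [|a [|b [|f []]]] // IE.
rewrite -[RHS](sum_eps_p7 r_neq0 a b f); apply: eq_bigr => N _.
by rewrite pullback_lift -map_cat eps_lift.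
Qed.

(** d Phi is a multiple of e_0 wedge p, and the star of e_0 wedge p in dimension eight is the star
    of p in dimension seven, that is, w. *)
Lemma star_extd_product_Phi i j k y :
  star 5 (extd P (product_Phi (sphere7_omega r))) [:: i; j; k] y =
  sq r y.1 * (c * (6 * sq r y.1 - 4)) * w8 i j k y.
Proof.
set z := sq r y.1 * _; set I := [:: i; j; k].
pose g J := eps R (J ++ I).
have g_skew := eps_swap_cat I : swap_skew (V := R^o) (fun _ : seq 'I_8 => True) g.
rewrite (_ : star 5 _ _ _ = (5`!%:R)^-1 *
  \sum_(J : 5.-tuple 'I_8) g J * extd P (product_Phi (sphere7_omega r)) J y) //.
transitivity ((5`!%:R)^-1 * (z * (5 * \sum_(N : 4.-tuple 'I_8) g (ord0 :: N)
    * pullback (form4 (p7 r)) N y))); last first.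
  rewrite sum_eps_pull_p4 (_ : 5`! = 120%N) //.
  by move: z (w8 i j k y) => *; field.
congr (_ * _).
rewrite (sum_tupleS _ (fun J => g J * extd P (product_Phi (sphere7_omega r)) J y)).
under eq_bigr do rewrite (sum_tuple4
  (fun J => g (_ :: J) * extd P (product_Phi (sphere7_omega r)) (_ :: J) y)).
rewrite (sum_tuple4 (fun N => g (ord0 :: N) * pullback (form4 (p7 r)) N y)).
have -> : \sum_a \sum_b \sum_f \sum_h g [:: ord0; a; b; f; h]
      * pullback (form4 (p7 r)) [:: a; b; f; h] y =
    \sum_s \sum_a \sum_b \sum_f \sum_h g [:: s; a; b; f; h] * (e s * p8 a b f h y).
  rewrite -(kron_sum ord0 (fun s => \sum_a \sum_b \sum_f \sum_h g [:: s; a; b; f; h]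
    * p8 a b f h y)); apply: eq_bigr => s _.
  rewrite mulr_sumr; apply: eq_bigr => a _; rewrite mulr_sumr; apply: eq_bigr => b _.
  rewrite mulr_sumr; apply: eq_bigr => f _; rewrite mulr_sumr; apply: eq_bigr => h _.
  exact: mulrCA.
rewrite -(sum_skew_e5 e g_skew (fun a b f h => p8 a b f h y)) mulr_sumr.
apply: eq_bigr => s _; rewrite mulr_sumr; apply: eq_bigr => a _.
rewrite mulr_sumr; apply: eq_bigr => b _; rewrite mulr_sumr; apply: eq_bigr => f _.
rewrite mulr_sumr; apply: eq_bigr => h _; rewrite extd_product_Phi.
exact: mulrCA.
Qed.

Lemma sum_eps_spin7 K i y : \sum_(N : 4.-tuple 'I_8) eps R (K ++ N ++ [:: i])
    * form4 (spin7 w8 p8 e) N y =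
  4 * (\sum_(N : 3.-tuple 'I_8) eps R (K ++ ord0 :: N ++ [:: i]) * form3 w8 N y)
  + \sum_(N : 4.-tuple 'I_8) eps R (K ++ N ++ [:: i]) * form4 p8 N y.
Proof.
pose g J := eps R (K ++ J ++ [:: i]).
have g_skew : swap_skew (V := R^o) (fun _ : seq 'I_8 => True) g.
  by move=> s x y' t _; rewrite /g -!catA (catA K) (catA K s (_ :: _)); exact: eps_swap.
rewrite (sum_tuple4 (fun N => g N * form4 (spin7 w8 p8 e) N y)).
rewrite (sum_tuple4 (fun N => g N * form4 p8 N y)).
have -> : \sum_(N : 3.-tuple 'I_8) eps R (K ++ ord0 :: N ++ [:: i]) * form3 w8 N y =
    \sum_s \sum_a \sum_b \sum_f g [:: s; a; b; f] * (e s * w8 a b f y).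
  rewrite -(kron_sum ord0 (fun s => \sum_(N : 3.-tuple 'I_8) g (s :: N) * form3 w8 N y)).
  apply: eq_bigr => s _; rewrite (sum_tuple3 (fun N => g (s :: N) * form3 w8 N y)).
  rewrite mulr_sumr; apply: eq_bigr => a _; rewrite mulr_sumr; apply: eq_bigr => b _.
  rewrite mulr_sumr; apply: eq_bigr => f _.
  exact: mulrCA.
rewrite -(sum_skew_e4 e g_skew (fun a b f => w8 a b f y)) -big_split.
apply: eq_bigr => s _; rewrite -big_split; apply: eq_bigr => a _.
rewrite -big_split; apply: eq_bigr => b _; rewrite -big_split; apply: eq_bigr => f _.
by rewrite /= -mulrDr.
Qed.

Lemma form3_pull K y : size K = 3 -> form3 w8 K y = pullback (form3 (w7 r)) K y.
Proof. by case: K => [|? [|? [|? []]]]. Qed.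

Lemma form4_pull N y : size N = 4 -> form4 p8 N y = pullback (form4 (p7 r)) N y.
Proof. by case: N => [|? [|? [|? [|? []]]]]. Qed.

(** If i is not [ord0], the list lacks [ord0] and the symbol vanishes. Otherwise moving [ord0]
    across the seven other entries gives the sign - 1, and the dual of p in dimension seven
    remains. *)
Lemma sum_eps_p8_lift K i y : size K = 3 -> \sum_(N : 4.-tuple 'I_8)
    eps R (map (lift ord0) K ++ N ++ [:: i]) * form4 p8 N y =
  - (24 * e i * form3 (w7 r) K y.1).
Proof.
move=> K3; transitivity (\sum_(N : 4.-tuple 'I_8)
    eps R (map (lift ord0) K ++ N ++ [:: i]) * pullback (form4 (p7 r)) N y).
  by apply: eq_bigr => N _; rewrite form4_pull ?size_tuple.
rewrite (sum_tuple_lift _ (F := fun N => eps R (map (lift ord0) K ++ N ++ [:: i])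
  * pullback (form4 (p7 r)) N y)) => [|N N0]; last by rewrite pullback_ord0 ?mulr0.
have l0 k : lift ord0 k == ord0 :> 'I_8 = false by rewrite eq_sym (negPf (neq_lift _ _)).
case: (unliftP ord0 i) => [k ->|->].
  rewrite /kron l0 mulr0 mul0r oppr0 big1 // => N _; rewrite (@eps_notin _ ord0) ?mul0r //.
  rewrite -[[:: lift _ _]]/(map (lift ord0) [:: k]) -!map_cat.
  by apply/negP => /mapP[u _ /eqP]; rewrite eq_sym l0.
rewrite /kron eqxx mulr1 -mulNr.
case: K K3 => [|a [|b [|f []]]] // _.
rewrite mulNr -[form3 _ _ _]/(w7 r a b f y.1) -(sum_eps_p7 r_neq0 a b f) -sumrN; apply: eq_bigr => N _.
rewrite pullback_lift -mulNr; congr (_ * _).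
rewrite catA -map_cat eps_front cats0 eps_lift size_map size_cat size_tuple.
rewrite -[X in eps R X]cats0 -catA (eps_catC R _ N [::]) cats0 size_tuple.
by rewrite -signr_odd -[X in _ * (X * _)]signr_odd /= expr0 expr1 mul1r mulN1r.
Qed.

(** The part w wedge e_0 wedge w vanishes because w has odd degree: exchanging the factors shows X =
    - X. The part w wedge p gives 24 times the full square 42 of w. *)
Lemma sum_eps_w8_spin7 i y : \sum_(K : 3.-tuple 'I_8) \sum_(N : 4.-tuple 'I_8)
    eps R (K ++ N ++ [:: i]) * (form3 w8 K y * form4 (spin7 w8 p8 e) N y) =
  - (1008 * sq r y.1 ^+ 2 * e i).
Proof.
pose X := \sum_(K : 3.-tuple 'I_8) \sum_(N : 3.-tuple 'I_8)
  eps R (K ++ ord0 :: N ++ [:: i]) * (form3 w8 K y * form3 w8 N y).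
have X0 : X = 0.
  apply: skew_eq0; rewrite {1}/X exchange_big -sumrN; apply: eq_bigr => K _.
  rewrite -sumrN; apply: eq_bigr => N _ /=.
  rewrite (eps_catC R K (ord0 :: N) [:: i]) eps_front /= !size_tuple.
  by rewrite -signr_odd -[in RHS]signr_odd /= expr0 expr1 mul1r mulN1r mulNr [form3 _ _ _ * _]mulrC.
transitivity (4 * X + \sum_(K : 3.-tuple 'I_8) form3 w8 K y *
    (\sum_(N : 4.-tuple 'I_8) eps R (K ++ N ++ [:: i]) * form4 p8 N y)).
  rewrite /X mulr_sumr -big_split; apply: eq_bigr => K _ /=.
  transitivity (form3 w8 K y * \sum_(N : 4.-tuple 'I_8)
      eps R (K ++ N ++ [:: i]) * form4 (spin7 w8 p8 e) N y).
    by rewrite mulr_sumr; apply: eq_bigr => N _; exact: mulrCA.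
  rewrite sum_eps_spin7 mulrDr mulrCA; congr (_ * _ + _).
  by rewrite mulr_sumr; apply: eq_bigr => N _; exact: mulrCA.
rewrite X0 mulr0 add0r.
transitivity (\sum_(K : 3.-tuple 'I_8) - (24 * e i) * (form3 w8 K y * form3 w8 K y)).
  apply: eq_bigr => K _; rewrite form3_pull ?size_tuple //.
  have [[K' KE]|K0] := pullbackP K; last by rewrite !pullback_ord0 // !mul0r mulr0.
  have K3 : size K' = 3 by rewrite -(size_map (lift ord0)) -KE size_tuple.
  rewrite KE sum_eps_p8_lift // mulrCA mulNr -mulrN; congr (_ * _); rewrite pullback_lift.
  by rewrite mulrN.
rewrite -mulr_sumr (sum_tuple3 (fun K => form3 w8 K y * form3 w8 K y)) /= (sum_w (T y)).
rewrite (_ : (sq r \o fst) y = sq r y.1) //; move: (sq r y.1) (kron i ord0) => *; ring.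
Qed.

(** On the product, where [sq] is 1, this is 2 c e_0. The powers of [sq] are kept because the Lee
    form is differentiated in [lee8_product_closed]. *)
Lemma lee8_product i y : lee8 P (product_Phi (sphere7_omega r)) [:: i] y =
  sq r y.1 * (c * (6 * sq r y.1 - 4)) * sq r y.1 ^+ 3 * kron i ord0.
Proof.
rewrite /lee8 (@star_wedge _ _ _ 3 4) (_ : (3`! * 4`!)%N = 144%N) //.
set z := sq r y.1 * _.
(* The numerical factors cancel: 7 times 144 is 1008. *)
transitivity (- 7^-1 * (144^-1 * (z * sq r y.1 * - (1008 * sq r y.1 ^+ 2 * e i)))); last first.
  by move: z (sq r y.1) (kron i ord0) => *; field.
congr (_ * (_ * _)); rewrite -sum_eps_w8_spin7 mulr_sumr; apply: eq_bigr => K _.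
rewrite mulr_sumr; apply: eq_bigr => N _.
rewrite product_PhiE ?size_tuple //.
case: K => [[|a [|b [|f []]]]] //= ?; rewrite star_extd_product_Phi.
by rewrite -/z [RHS]mulrCA; congr (_ * _); exact: mulrACA.
Qed.

(** The components are constant along the frame, and no bracket of frame fields has a component
    along e_0. *)
Lemma lee8_product_closed :
  form_eq (pts P) 2 (extd P (lee8 P (product_Phi (sphere7_omega r)))) (fun _ _ => 0).
Proof.
move=> y [|i [|j []]] // Dy _.
have D m a : 'D_(fr P m y) (lee8 P (product_Phi (sphere7_omega r)) [:: a]) y = 0.
  have M0 (f g : V8 -> R) v : is_derive y v f 0 -> is_derive y v g 0 -> is_derive y v (f * g) 0.
    by move=> H1 H2; apply: is_derive_eq (is_deriveM H1 H2) _; rewrite !scaler0 addr0.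
  pose q : V8 -> R := sq r \o fst.
  have -> : lee8 P (product_Phi (sphere7_omega r)) [:: a] =
      q * (cst c * (cst 6 * q - cst 4)) * (q * (q * q)) * cst (kron a ord0).
    by apply/funext => z; rewrite lee8_product.
  have Dq : is_derive y (fr P m y) q 0 := g2f_Dq G m y.
  have C k : is_derive y (fr P m y) (cst k : V8 -> R) 0 by exact: is_derive_cst.
  have H : is_derive y (fr P m y) (cst 6 * q - cst 4) 0.
    by apply: is_derive_eq (is_deriveB (M0 _ _ _ (C _) Dq) (C _)) _; rewrite subr0.
  by case: (M0 _ _ _ (M0 _ _ _ (M0 _ _ _ Dq (M0 _ _ _ (C c) H))
    (M0 _ _ _ Dq (M0 _ _ _ Dq Dq))) (C (kron a ord0))).
rewrite extd2 !D subrr sub0r big1 ?oppr0 // => s _.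
rewrite lee8_product (g2f_struct G) mulrCA !mulrA.
case: (unliftP ord0 s) => [s' ->|->]; last by rewrite pull3_0 !(mulr0, mul0r).
by rewrite /kron eq_sym (negPf (neq_lift _ _)) mulr0.
Qed.

End Lee.

(** * The characteristic torsion of the product *)

Section ProductTorsion.
Variables (R : realType) (r : R) (W : normedModType R) (L : framed W 1).
Local Notation P := (prod_framed (sphere7 r) L).
Local Notation V8 := ('cV[R]_8 * W)%type.
Hypothesis r_neq0 : r != 0.
Let c := - (2 / r).
Local Notation w8 := (@pull3 R 'cV[R]_8 W 7 (w7 r)).
Local Notation p8 := (@pull4 R 'cV[R]_8 W 7 (p7 r)).
Local Notation e := (fun i : 'I_8 => @kron R 8 i ord0).
Hypothesis G : product_g2_frame r L.
Local Notation Phi := (product_Phi (sphere7_omega r)).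
Local Notation Tor := (g2_torsion c w8).
Let T y := g2f_tensors G y.

Lemma product_Phi_spin7 i j k l y : pts P y ->
  Phi [:: i; j; k; l] y = spin7 w8 p8 e i j k l y.
Proof.
move=> Dy; rewrite (product_PhiE r_neq0 G) //.
by have := g2f_q G Dy => /= ->; rewrite mul1r.
Qed.

Lemma spin7_derivable m y I : size I = 4 ->
  derivable (form4 (spin7 w8 p8 e) I) y (fr P m y).
Proof.
case: I => [|i [|j [|k [|l []]]]] // _.
by case: (is_derive_spin7 G e m i j k l y).
Qed.

Lemma product_parallel : parallel P (pts P) 4 (tconn P Tor) Phi.
Proof.
move=> m y I Dy I4.
rewrite (cov_qM (g2f_Dq G) (product_PhiE r_neq0 G) spin7_derivable) //.
case: I I4 => [|i [|j [|k [|l []]]]] // _.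
by rewrite (cov_spin7 G (horizontal_e R) (e_sqr R)) // mulr0.
Qed.

Lemma pull3_smooth i j k : smooth_on setT (w8 i j k : V8 -> R).
Proof.
have [[J JE]|I0] := pullbackP [:: i; j; k]; last first.
  have -> : w8 i j k = cst 0 by apply/funext => z; exact: pullback_ord0.
  exact: smooth_on_cst.
have -> : w8 i j k = form3 (w7 r) J \o fst.
  by apply/funext => z; rewrite /pull3 JE pullback_lift.
case: J JE => [|a [|b [|f []]]] // _.
apply: (linear_smooth_comp (U := setT)); [exact: linear_fst|exact: continuous_fst|].
exact: smooth_on_w7 openT.
Qed.

Lemma product_torsion_smooth : smooth_form (pts P) 3 Tor.
Proof.
apply: (w3form_smooth G (U := setT)) => //; first exact: openT.
exact: pull3_smooth.
Qed.

Lemma product_characteristic_torsion : characteristic_torsion P (pts P) 4 Phi Tor.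
Proof.
split; [exact: product_torsion_smooth|exact: product_parallel|].
move=> T' [_ Talt] Tpar y [|i0 [|j0 [|k0 []]]] // Dy _.
have [Tl Tr] := @alt3_swap _ _ (fun I => T' I y) (fun I s => Talt y I s Dy).
have TS := g2f_tensors (sphere7_g2_frame r_neq0) y.1.
have q1 : sq r y.1 = 1 := g2f_q G Dy.
pose B i j k := T' [:: i; j; k] y - Tor [:: i; j; k] y.
suff : B i0 j0 k0 = 0 by move/eqP; rewrite subr_eq0 => /eqP.
have Bl i j k : B i j k = - B j i k.
  by rewrite /B Tl /g2_torsion /= (g2_wl (T y)); ring.
have Br i j k : B i j k = - B i k j.
  by rewrite /B Tr /g2_torsion /= (g2_wr (T y)); ring.
pose C m i j := B m (lift ord0 i) (lift ord0 j).
have Phi_lift i j k l : Phi [:: lift ord0 i; lift ord0 j; lift ord0 k; lift ord0 l] y =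
    p7 r i j k l y.1.
  rewrite product_Phi_spin7 // /spin7 pull4_lift /kron.
  by rewrite ![lift _ _ == _]eq_sym !(negPf (neq_lift _ _)) !mul0r !subr0 !add0r.
have Phi_0 i j k : Phi [:: ord0; lift ord0 i; lift ord0 j; lift ord0 k] y = w7 r i j k y.1.
  rewrite product_Phi_spin7 // /spin7 pull3_lift !pull4_0 /kron eqxx mul1r.
  by rewrite ![lift _ _ == _]eq_sym !(negPf (neq_lift _ _)) !mul0r !subr0 !addr0.
have Phi_00 i j : [/\ Phi [:: ord0; ord0; i; j] y = 0,
    Phi [:: ord0; i; ord0; j] y = 0 & Phi [:: ord0; i; j; ord0] y = 0].
  by split; rewrite product_Phi_spin7 // /spin7 !pull3_0 !pull4_0; ring.
have Bm00 m : B m ord0 ord0 = 0 by exact/skew_eq0/Br.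
(* The action of B on Phi is evaluated on e_0 and three directions of the sphere: there the mixed
   components of B meet p and the purely spherical ones, C, meet w. *)
have Bw m j k l : \sum_s B m ord0 (lift ord0 s) * p7 r s j k l y.1
    + (\sum_s C m j s * w7 r s k l y.1 + \sum_s C m k s * w7 r j s l y.1
       + \sum_s C m l s * w7 r j k s y.1) = 0.
  have := parallel_tconnB4 Tpar product_parallel m ord0 (lift ord0 j) (lift ord0 k)
    (lift ord0 l) Dy.
  have S8 (F : 'I_8 -> R) : \sum_s F s = F ord0 + \sum_(s < 7) F (lift ord0 s).
    exact: big_ord_recl.
  rewrite !S8 -![T' _ _ - _]/(B _ _ _) Bm00 mul0r add0r.
  have [H1 _ _] := Phi_00 (lift ord0 k) (lift ord0 l).
  have [_ H2 _] := Phi_00 (lift ord0 j) (lift ord0 l).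
  have [_ _ H3] := Phi_00 (lift ord0 j) (lift ord0 k).
  rewrite H1 H2 H3 !mulr0 !add0r -!addrA => H; rewrite -[RHS]H.
  by congr (_ + (_ + (_ + _))); apply: eq_bigr => s _; rewrite ?Phi_lift ?Phi_0.
(* Contract [Bw] with p: the mixed part gives 24 by [sum_p_iabc_p_jabc], the spherical part 12 times
   the contraction of C with w by [contract_w_p]. *)
have Bb m i : \sum_u \sum_v C m u v * w7 r u v i y.1 = - (2 * B m ord0 (lift ord0 i)).
  have Cr u v : C m u v = - C m v u by exact: Br.
  have : \sum_j \sum_k \sum_l p7 r i j k l y.1 * (\sum_s B m ord0 (lift ord0 s) * p7 r s j k l y.1
    + (\sum_s C m j s * w7 r s k l y.1 + \sum_s C m k s * w7 r j s l y.1
       + \sum_s C m l s * w7 r j k s y.1)) = 0.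
    by do 3 (apply: big1 => ? _); rewrite Bw mulr0.
  under eq_bigr do under eq_bigr do under eq_bigr do rewrite mulrDr.
  under eq_bigr do under eq_bigr do rewrite big_split.
  under eq_bigr do rewrite big_split.
  rewrite big_split /= (contract_w_p _ _ TS) //.
  have -> : \sum_j \sum_k \sum_l p7 r i j k l y.1 *
      (\sum_s B m ord0 (lift ord0 s) * p7 r s j k l y.1) = 24 * B m ord0 (lift ord0 i).
    transitivity (\sum_s kron s i * (24 * B m ord0 (lift ord0 s))); last by rewrite kron_sum.
    transitivity (\sum_s B m ord0 (lift ord0 s) *
        \sum_j \sum_k \sum_l p7 r i j k l y.1 * p7 r s j k l y.1).
      under [RHS]eq_bigr do rewrite mulr_sumr.
      rewrite [RHS]exchange_big; apply: eq_bigr => j _ /=.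
      under [RHS]eq_bigr do rewrite mulr_sumr.
      rewrite [RHS]exchange_big; apply: eq_bigr => k _ /=.
      under [RHS]eq_bigr do rewrite mulr_sumr.
      rewrite [RHS]exchange_big; apply: eq_bigr => l _ /=.
      by rewrite mulr_sumr; apply: eq_bigr => s _; exact: mulrCA.
    apply: eq_bigr => s _; rewrite (sum_p_iabc_p_jabc TS) // (kronC i s).
    by move: (B _ _ _) => ?; ring.
  move=> /eqP; rewrite addrC addr_eq0 => /eqP H.
  apply: (mulfI (_ : 12 != 0)); first by rewrite pnatr_eq0.
  by apply: (etrans H); rewrite mulrN mulrA -natrM.
(* For m = [ord0] the right side of [Bb] vanishes; for a direction m of the sphere it is 2 B(e_0, m,
   i). These are the hypotheses of [torsion_spinor_eq0] with b = B(e_0, ., .), so all components of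
   B vanish. *)
have Bb0 i : \sum_u \sum_v C ord0 u v * w7 r u v i y.1 = 0.
  by rewrite Bb (skew_eq0 (Bl _ _ _)) mulr0 oppr0.
have Bbl m i : \sum_u \sum_v C (lift ord0 m) u v * w7 r u v i y.1 = 2 * C ord0 m i.
  by rewrite Bb Bl mulrN opprK.
have [C0 b0] := torsion_spinor_eq0 r_neq0 Dy.1 (B := fun i j k => C (lift ord0 i) j k)
  (b := fun i j => C ord0 i j) (fun p q s => Bl _ _ _) (fun p q s => Br _ _ _)
  (fun p q => Br _ _ _)
  Bb0 Bbl.
have B00i i : B ord0 ord0 i = 0 by exact/skew_eq0/Bl.
have B0i0 i : B ord0 i ord0 = 0 by rewrite Br B00i oppr0.
have B0 i j : B ord0 i j = 0.
  case: (unliftP ord0 i) => [i' ->|->]; last exact: B00i.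
  case: (unliftP ord0 j) => [j' ->|->]; last exact: B0i0.
  exact: b0.
case: (unliftP ord0 i0) => [i' ->|->]; last exact: B0.
case: (unliftP ord0 j0) => [j' ->|->]; last by rewrite Bl B0 oppr0.
case: (unliftP ord0 k0) => [k' ->|->]; last by rewrite Br Bl B0 opprK.
exact: C0.
Qed.

End ProductTorsion.

Lemma mx_continuous (R : realType) (V : topologicalType) m n (f : V -> 'M[R]_(m, n)) :
  (forall i j, continuous (fun y => f y i j)) -> continuous f.
Proof.
move=> cf y A [Q Qn QA].
have : \forall z \near y, forall i, forall j, Q i j (f z i j).
  apply: filter_forall => i; apply: filter_forall => j.
  exact: cf.
by apply: filterS => z; exact: QA.
Qed.

Lemma sum_col_mx (R : realType) m1 m2 m n (F : 'I_n -> 'M[R]_(m1, m))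
    (H : 'I_n -> 'M[R]_(m2, m)) :
  \sum_i col_mx (F i) (H i) = col_mx (\sum_i F i) (\sum_i H i).
Proof.
elim/big_ind3 : _ => //; first by rewrite col_mx0.
by move=> ? ? ? ? ? ? -> ->; rewrite add_col_mx.
Qed.

(** * Spinors on the product *)

Section ProductSpinor.
Variables (R : realType) (r : R) (W : normedModType R) (L : framed W 1).
Local Notation P := (prod_framed (sphere7 r) L).
Local Notation V8 := ('cV[R]_8 * W)%type.
Hypothesis r_neq0 : r != 0.
Let c := - (2 / r).
Local Notation w8 := (@pull3 R 'cV[R]_8 W 7 (w7 r)).
Local Notation p8 := (@pull4 R 'cV[R]_8 W 7 (p7 r)).
Local Notation e := (fun i : 'I_8 => @kron R 8 i ord0).
Hypothesis G : product_g2_frame r L.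
Local Notation Phi := (product_Phi (sphere7_omega r)).
Local Notation Tor := (g2_torsion c w8).
Local Notation gam := (@gamma8 R).
Local Notation E := (@gamma7 R).
Let T y := g2f_tensors G y.

(** The Clifford action exchanges the two blocks, which are the half-spinor spaces. Placing the
    position vector in the lower one gives the e_0 part of Phi its positive sign. *)
Definition spinor8 (y : V8) : 'cV[R]_(8 + 8) := col_mx 0 y.1.

Lemma dotN (u v : 'cV[R]_8) : dot u (- v) = - dot u v.
Proof. by rewrite /dot mulmxN mxE. Qed.

Lemma gamma8_lift j (u v : 'cV[R]_8) :
  gam (lift ord0 j) *m col_mx u v = col_mx (E j *m v) (E j *m u).
Proof. by rewrite /gamma8 liftK mul_block_col !mul0mx add0r addr0. Qed.

Lemma gamma8_0 (u v : 'cV[R]_8) : gam ord0 *m col_mx u v = col_mx (- v) u.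
Proof.
by rewrite /gamma8 unlift_none mul_block_col !mul0mx add0r addr0 mulNmx !mul1mx.
Qed.

Lemma linear_spinor8 : linear spinor8.
Proof. by move=> a u z; rewrite /spinor8 scale_col_mx add_col_mx scaler0 addr0. Qed.

Lemma smooth_spinor8 (U : set V8) : smooth_on U spinor8.
Proof.
apply: smooth_on_linear; first exact: linear_spinor8.
apply: mx_continuous => i j; rewrite (ord1 j).
case: (splitP i) => k ik.
  have -> : (fun y => spinor8 y i 0) = fun=> 0.
    apply/funext => y; rewrite /spinor8 (_ : i = lshift 8 k); last exact: val_inj.
    by rewrite col_mxEu mxE.
  exact: cst_continuous.
have -> : (fun y => spinor8 y i 0) = (fun y : 'cV[R]_8 => y k 0) \o fst.
  apply/funext => y; rewrite /spinor8 (_ : i = rshift 8 k); last exact: val_inj.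
  by rewrite col_mxEd.
move=> y; apply: continuous_comp; first exact: continuous_fst.
exact: coord_continuous.
Qed.

Lemma cliff2_gamma8 (B : 'I_8 -> 'I_8 -> R) (u v : 'cV[R]_8) :
  (forall i, B ord0 i = 0) -> (forall i, B i ord0 = 0) ->
  cliff2 gam B *m col_mx u v =
  col_mx (cliff2 E (fun p q => B (lift ord0 p) (lift ord0 q)) *m u)
         (cliff2 E (fun p q => B (lift ord0 p) (lift ord0 q)) *m v).
Proof.
move=> B0l B0r; rewrite /cliff2 big_ord_recl big1 ?add0r => [|q _]; last by rewrite B0l scale0r.
transitivity (\sum_(p < 7) \sum_(q < 7)
  B (lift ord0 p) (lift ord0 q) *: col_mx (E p *m E q *m u) (E p *m E q *m v)).
  rewrite mulmx_suml; apply: eq_bigr => p _.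
  rewrite big_ord_recl B0r scale0r add0r mulmx_suml; apply: eq_bigr => q _.
  by rewrite -scalemxAl -mulmxA !gamma8_lift !mulmxA.
rewrite !mulmx_suml -sum_col_mx; apply: eq_bigr => p _.
rewrite !mulmx_suml -sum_col_mx; apply: eq_bigr => q _.
by rewrite scale_col_mx !scalemxAl.
Qed.

Lemma product_spinor_defines : spinor_defines gam (pts P) 4 Phi spinor8.
Proof.
split=> [|y Dy]; first by exists setT; split=> //; [exact: openT|exact: smooth_spinor8].
have y2 : dot y.1 y.1 = r ^+ 2 := Dy.1.
have sE : spinor8 y = col_mx 0 y.1 by [].
have s2 (u v : 'cV[R]_8) : ((col_mx 0 y.1)^T *m col_mx u v) 0 0 = dot y.1 v.
  by rewrite tr_col_mx mul_row_col trmx0 mul0mx add0r.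
split.
  apply: contra_eq_neq y2 => s0; have := s2 0 y.1; rewrite -sE s0.
  by rewrite mulmx0 mxE => <-; rewrite eq_sym expf_neq0.
rewrite sE s2 y2 => -[|i [|j [|k [|l []]]]] // _ Iu.
rewrite (product_Phi_spin7 r_neq0 G) //.
have l0 (a : 'I_7) : e (lift ord0 a) = 0.
  by rewrite /kron eq_sym (negPf (neq_lift _ _)).
have e0 : e ord0 = 1 by rewrite /kron eqxx.
have simp := (l0, e0, @pull3_lift R _ W 7 (w7 r), @pull4_lift R _ W 7 (p7 r),
  @pull3_0 R _ W 7 (w7 r), @pull4_0 R _ W 7 (p7 r), mul0r, mul1r, subr0, add0r, addr0, sub0r).
have r2 t : - r ^- 2 * t * r ^+ 2 = - t.
  by rewrite !mulNr mulrAC mulVf ?expf_neq0 // mul1r.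
have q3 a b f : w7 r a b f y.1 * r ^+ 2 = - dot y.1 (E a *m (E b *m (E f *m y.1))).
  by rewrite /w7 r2 /qs /qform /= mulmx1 /dot !mulmxA.
move: Iu; rewrite /= !inE !negb_or => /and4P[/and3P[ij ik il] /andP[jk jl] kl _].
case: (unliftP ord0 i) ij ik il => [i' ->|->] ij ik il;
 case: (unliftP ord0 j) jk jl ij => [j' ->|->] jk jl ij;
 case: (unliftP ord0 k) kl ik jk => [k' ->|->] kl ik jk;
 case: (unliftP ord0 l) il jl kl => [l' ->|->] il jl kl;
 rewrite ?eqxx // in ij ik il jk jl kl *;
 rewrite /spin7 !simp /= !(gamma8_lift, gamma8_0) s2 ?mulNr ?q3 ?(mulmxN, dotN) ?opprK //.
rewrite oppr0 add0r p7_uniq ?r2.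
  by rewrite /qs /qform /= mulmx1 /dot !mulmxA.
rewrite -(map_inj_uniq (@lift_inj 8 ord0)) 4!map_cons !cons_uniq !inE !negb_or.
by rewrite ij ik il jk jl kl.
Qed.

Lemma derive_spinor8 m y : 'D_(fr P m y) spinor8 y = spinor8 (fr P m y).
Proof. by case: (is_derive_linear y (fr P m y) linear_spinor8). Qed.

Lemma cliff2_pull3 t m y : cliff2 gam (fun p q => t * w8 m p q y) *m spinor8 y =
  col_mx 0 (if unlift ord0 m is Some m' then
    cliff2 E (fun p q => t * w7 r m' p q y.1) *m y.1 else 0).
Proof.
rewrite cliff2_gamma8 => [|i|i]; last 2 first.
- by rewrite pull3_0 mulr0.
- by rewrite pull3_0 mulr0.
rewrite mulmx0; congr col_mx.
case: (unliftP ord0 m) => [m' ->|->]; rewrite ?liftK ?unlift_none.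
  by congr (_ *m _); apply: eq_bigr => p _; apply: eq_bigr => q _; rewrite pull3_lift.
rewrite /cliff2 big1 ?mul0mx // => p _; rewrite big1 // => q _.
by rewrite pull3_0 mulr0 scale0r.
Qed.

Lemma product_gravitino : gravitino P gam (pts P) Tor spinor8.
Proof.
move=> y m Dy; rewrite /spin_cov derive_spinor8.
have -> : cliff2 gam (fun p q => lc P m p q y) = cliff2 gam (fun p q => c / 2 * w8 m p q y).
  by apply: eq_bigr => p _; apply: eq_bigr => q _; rewrite (g2_lc G).
rewrite !cliff2_pull3 !scale_col_mx add_col_mx /spinor8 add_col_mx !scaler0 !addr0.
have := sphere7_gravitino r_neq0 _ Dy.1; rewrite /spin_cov.
case: (unliftP ord0 m) => [m' ->|->] H; rewrite ?liftK ?unlift_none; last first.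
  rewrite !scaler0 !addr0 (_ : (fr P ord0 y).1 = 0) ?col_mx0 //.
  by rewrite /= unlift_none.
rewrite -[RHS]col_mx0; congr col_mx; rewrite -[RHS](H m').
congr (_ + _ *: _ + _ *: _).
  by rewrite prod_fr_lift; case: (is_derive_id y.1 (fr (sphere7 r) m' y.1)).
congr (_ *m _); apply: eq_bigr => p _; apply: eq_bigr => q _.
by rewrite (g2_lc (sphere7_g2_frame r_neq0)).
Qed.

Lemma product_gaugino : gaugino gam (pts P) (curv P (tconn P Tor)) spinor8.
Proof.
move=> y a b Dy.
have FE m p : curv P (tconn P Tor) m p a b y =
    gcurv (@horizontal R 7) p8 (- (2 * c ^+ 2 / 9)) (c ^+ 2 / 9) m p a b y.
  by rewrite (g2_curv_torsion G).
have F0 m : curv P (tconn P Tor) ord0 m a b y = 0.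
  by rewrite FE /gcurv /Delta pull4_0 !horizontal_0; ring.
rewrite cliff2_gamma8 //; last by move=> m; rewrite FE (gcurv_skewl G) -FE F0 oppr0.
rewrite mulmx0 -[RHS]col_mx0; congr col_mx.
have [[a' aE]|a0] := pullbackP [:: a; b]; last first.
  rewrite /cliff2 big1 ?mul0mx // => m _; rewrite big1 // => p _.
  rewrite FE /gcurv /Delta; move: a0; rewrite !inE => /orP[] /eqP <-;
    by rewrite pull4_0 !horizontal_0 !(mulr0, mul0r) subrr mulr0 addr0 scale0r.
case: a' aE => [|a' [|b' []]] // [aE bE].
rewrite -[RHS](sphere7_gaugino r_neq0 a' b' Dy.1); congr (_ *m _).
apply: eq_bigr => m _; apply: eq_bigr => p _; congr (_ *: _).
rewrite FE (g2_curv_torsion (sphere7_g2_frame r_neq0)) ?aE ?bE; last exact: Dy.1.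
by rewrite /gcurv /Delta pull4_lift !horizontal_lift.
Qed.

Lemma product_dilatino (phi : V8 -> R) y : pts P y ->
  (forall m, 'D_(fr P m y) phi y = - (7 / (3 * r)) * kron m ord0) ->
  (\sum_m 'D_(fr P m y) phi y *: gam m
   + 12^-1 *: cliff3 gam (fun m p q => Tor [:: m; p; q] y)) *m spinor8 y = 0.
Proof.
move=> Dy Dphi.
have -> : \sum_m 'D_(fr P m y) phi y *: gam m = - (7 / (3 * r)) *: gam ord0.
  rewrite -(kron_scale ord0 (fun m => - (7 / (3 * r)) *: gam m)); apply: eq_bigr => m _.
  by rewrite Dphi scalerA mulrC.
rewrite mulmxDl -!scalemxAl [spinor8 y in X in X + _]/spinor8 gamma8_0.
have -> : cliff3 gam (fun m p q => Tor [:: m; p; q] y) *m spinor8 y =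
    col_mx (- (42 * - (c / 3)) *: y.1) 0.
  rewrite /cliff3 mulmx_suml.
  transitivity (\sum_m gam m *m (cliff2 gam (fun p q => - (c / 3) * w8 m p q y) *m spinor8 y)).
    apply: eq_bigr => m _; rewrite mulmxA; congr (_ *m _); rewrite mulmx_sumr.
    apply: eq_bigr => p _; rewrite mulmx_sumr; apply: eq_bigr => q _.
    by rewrite -scalemxAr mulmxA.
  rewrite big_ord_recl cliff2_pull3 unlift_none col_mx0 mulmx0 add0r.
  transitivity (\sum_(m < 7) col_mx (- (6 * - (c / 3)) *: y.1) (0 : 'cV[R]_8)).
    apply: eq_bigr => m _; rewrite cliff2_pull3 liftK (cliff2_w7 r_neq0); last exact: Dy.1.
    rewrite gamma8_lift mulmx0 -scalemxAr mulmxA E_sqr mulNmx mul1mx scalerN.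
    by rewrite scaleNr.
  rewrite sumr_const card_ord -scaler_nat scale_col_mx scaler0 scalerA.
  by congr (col_mx (_ *: _) _); rewrite mulrN mulrA -natrM.
rewrite !scale_col_mx add_col_mx !scaler0 addr0 scalerN scalerA -scaleNr -scalerDl.
(* The gradient contributes 7/(3 r). The flux contributes (1/12) 14 c = - 7/(3 r), where 42 = 7
   times 6 comes from seven applications of [cliff2_w7]. *)
rewrite (_ : - _ + _ = 0) ?scale0r ?col_mx0 // /c.
by field.
Qed.

End ProductSpinor.

Lemma sum_tuple3_prod (R : comPzRingType) n (F : seq 'I_n -> R) (A : 'I_n -> 'I_n -> R)
    (i j k : 'I_n) :
  \sum_(J : 3.-tuple 'I_n) F J * \prod_(l < 3) A (tnth J l) (tnth [tuple i; j; k] l) =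
  \sum_a \sum_b \sum_c F [:: a; b; c] * (A a i * A b j * A c k).
Proof.
under eq_bigr do rewrite prod_tnth_zip.
rewrite (sum_tuple3 (fun J => F J * \prod_(q <- zip J [:: i; j; k]) A q.1 q.2)).
do 3 (apply: eq_bigr => ? _).
by rewrite /= !big_cons big_nil mulr1 !mulrA.
Qed.

(** * Local model of the Spin(7)-form *)

Section ProductModel.
Variable R : realType.

(** Writes the tabulated dual form as a contraction of the 3-form with itself. An orthogonal matrix
    that carries the 3-form to its standard model therefore carries the 4-form as well, which is
    [Phi0_rotate]. *)
Lemma Phi0_lift (a b c d : 'I_7) :
  Phi0 [:: lift ord0 a; lift ord0 b; lift ord0 c; lift ord0 d] =
  \sum_(u < 7) omega0 [:: a; b; u] * omega0 [:: c; d; u]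
  - ((a == c)%:R * (b == d)%:R - (a == d)%:R * (b == c)%:R).
Proof.
have H : all (fun a => all (fun b => all (fun c => all (fun d =>
    altform ([seq (t.1, 0%N :: t.2) | t <- omega_table] ++ staromega_table)
      [:: a.+1; b.+1; c.+1; d.+1] ==
    foldr (fun u z => altform omega_table [:: a.+1; b.+1; u.+1]
      * altform omega_table [:: c.+1; d.+1; u.+1] + z) 0 (iota 0 7)
    - ((a == c)%:R * (b == d)%:R - (a == d)%:R * (b == c)%:R))
  (iota 0 7)) (iota 0 7)) (iota 0 7)) (iota 0 7) by vm_compute.
have /eqP := all_ordP (all_ordP (all_ordP (all_ordP H a) b) c) d => {H}.
rewrite (foldr_iota (fun u => altform omega_table [:: a.+1; b.+1; u.+1]
  * altform omega_table [:: c.+1; d.+1; u.+1])) => E.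
by rewrite /Phi0 !map_cons !lift0 E.
Qed.

Lemma Phi0_0 (b c d : 'I_7) :
  (Phi0 [:: ord0; lift ord0 b; lift ord0 c; lift ord0 d] = omega0 [:: b; c; d])
  * (Phi0 [:: lift ord0 b; ord0; lift ord0 c; lift ord0 d] = - omega0 [:: b; c; d])
  * (Phi0 [:: lift ord0 b; lift ord0 c; ord0; lift ord0 d] = omega0 [:: b; c; d])
  * (Phi0 [:: lift ord0 b; lift ord0 c; lift ord0 d; ord0] = - omega0 [:: b; c; d]).
Proof.
pose L := [seq (t.1, 0%N :: t.2) | t <- omega_table] ++ staromega_table.
have H : all (fun b => all (fun c => all (fun d =>
    [&& altform L [:: 0; b.+1; c.+1; d.+1]%N == altform omega_table [:: b.+1; c.+1; d.+1],
     altform L [:: b.+1; 0; c.+1; d.+1]%N == - altform omega_table [:: b.+1; c.+1; d.+1],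
     altform L [:: b.+1; c.+1; 0; d.+1]%N == altform omega_table [:: b.+1; c.+1; d.+1]
   & altform L [:: b.+1; c.+1; d.+1; 0]%N == - altform omega_table [:: b.+1; c.+1; d.+1]])
  (iota 0 7)) (iota 0 7)) (iota 0 7) by vm_compute.
have /and4P[/eqP H1 /eqP H2 /eqP H3 /eqP H4] := all_ordP (all_ordP (all_ordP H b) c) d.
by do !split; rewrite /Phi0 !map_cons !lift0.
Qed.

Lemma Phi0_00 (i j : 'I_8) :
  (Phi0 [:: ord0; ord0; i; j] = 0) * (Phi0 [:: ord0; i; ord0; j] = 0)
  * (Phi0 [:: ord0; i; j; ord0] = 0) * (Phi0 [:: i; ord0; ord0; j] = 0)
  * (Phi0 [:: i; ord0; j; ord0] = 0) * (Phi0 [:: i; j; ord0; ord0] = 0).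
Proof.
pose L := [seq (t.1, 0%N :: t.2) | t <- omega_table] ++ staromega_table.
have H : all (fun i => all (fun j =>
    [&& altform L [:: 0; 0; i; j]%N == 0, altform L [:: 0; i; 0; j]%N == 0
     & altform L [:: 0; i; j; 0]%N == 0] &&
    [&& altform L [:: i; 0; 0; j]%N == 0, altform L [:: i; 0; j; 0]%N == 0
     & altform L [:: i; j; 0; 0]%N == 0]) (iota 0 8)) (iota 0 8) by vm_compute.
have /andP[/and3P[/eqP H1 /eqP H2 /eqP H3] /and3P[/eqP H4 /eqP H5 /eqP H6]] :=
  all_ordP (all_ordP H i) j.
by do !split.
Qed.

Variables (A : 'M[R]_7) (w : 'I_7 -> 'I_7 -> 'I_7 -> R).
Hypothesis AA : A *m A^T = 1%:M.
Hypothesis wE : forall i j k, w i j k = \sum_a \sum_b \sum_c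
  (omega0 [:: a; b; c])%:~R * (A a i * A b j * A c k).

Definition extend_rot : 'M[R]_(1 + 7) := block_mx 1%:M 0 0 A.

Let X i j u : R := \sum_a \sum_b (omega0 [:: a; b; u])%:~R * (A a i * A b j).

Let wX i j s : w i j s = \sum_u X i j u * A u s.
Proof.
rewrite wE /X; under [RHS]eq_bigr do rewrite mulr_suml.
rewrite [RHS]exchange_big; apply: eq_bigr => a _ /=.
under [RHS]eq_bigr do rewrite mulr_suml.
rewrite [RHS]exchange_big; apply: eq_bigr => b _ /=.
by apply: eq_bigr => c _; rewrite mulrA.
Qed.

Let A_row u v : \sum_s A u s * A v s = kron u v.
Proof.
have := congr1 (fun Z : 'M[R]_7 => Z u v) AA; rewrite /kron !mxE => <-.
by apply: eq_bigr => s _; rewrite mxE.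
Qed.

Let A_col i j : \sum_a A a i * A a j = kron i j.
Proof.
have /(congr1 (fun Z : 'M[R]_7 => Z i j)) := mulmx1C AA; rewrite /kron !mxE => <-.
by apply: eq_bigr => s _; rewrite mxE.
Qed.

Let ww i j k l : \sum_s w i j s * w k l s = \sum_u X i j u * X k l u.
Proof.
transitivity (\sum_u \sum_v X i j u * X k l v * \sum_s A u s * A v s).
  under [LHS]eq_bigr do rewrite !wX mulr_suml.
  rewrite exchange_big; apply: eq_bigr => u _.
  under [LHS]eq_bigr do rewrite mulr_sumr.
  rewrite exchange_big; apply: eq_bigr => v _ /=.
  by rewrite mulr_sumr; apply: eq_bigr => s _; exact: mulrACA.
apply: eq_bigr => u _; rewrite -(kron_sum u (fun v => X i j u * X k l v)).
by apply: eq_bigr => v _; rewrite A_row kronC mulrC.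
Qed.

Lemma Phi0_rotate i j k l :
  \sum_a \sum_b \sum_c \sum_d
    (Phi0 [:: lift ord0 a; lift ord0 b; lift ord0 c; lift ord0 d])%:~R
      * (A a i * A b j * A c k * A d l) =
  \sum_s w i j s * w k l s - (kron i k * kron j l - kron i l * kron j k).
Proof.
rewrite ww -!A_col.
transitivity (\sum_a \sum_b \sum_c \sum_d \sum_u
     ((omega0 [:: a; b; u])%:~R * (A a i * A b j)) * ((omega0 [:: c; d; u])%:~R * (A c k * A d l))
   - (\sum_a \sum_b \sum_c \sum_d kron a c * (kron b d * (A a i * A b j * A c k * A d l))
     - \sum_a \sum_b \sum_c \sum_d kron a d * (kron b c * (A a i * A b j * A c k * A d l)))).
  rewrite -!sumrB; apply: eq_bigr => a _; rewrite -!sumrB; apply: eq_bigr => b _.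
  rewrite -!sumrB; apply: eq_bigr => c _; rewrite -!sumrB; apply: eq_bigr => d _ /=.
  rewrite Phi0_lift rmorphB rmorph_sum /= mulrBl mulr_suml; congr (_ - _).
    apply: eq_bigr => u _; rewrite rmorphM /=.
    by move: (A a i) (A b j) (A c k) (A d l) (_%:~R) (_%:~R) => *; ring.
  rewrite rmorphB !rmorphM /= !rmorph_nat /kron.
  by move: (A a i) (A b j) (A c k) (A d l) => *; generalize_deltas => *; ring.
congr (_ - (_ - _)).
- rewrite /X; under [RHS]eq_bigr do rewrite mulr_suml.
  rewrite [RHS]exchange_big; apply: eq_bigr => a _ /=.
  under [RHS]eq_bigr do rewrite mulr_suml.
  rewrite [RHS]exchange_big; apply: eq_bigr => b _ /=.
  under [RHS]eq_bigr do rewrite mulr_sumr.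
  rewrite [RHS]exchange_big; apply: eq_bigr => c _ /=.
  under [RHS]eq_bigr do rewrite mulr_sumr.
  by rewrite [RHS]exchange_big.
- rewrite mulr_suml; apply: eq_bigr => a _; rewrite mulr_sumr; apply: eq_bigr => b _.
  transitivity (\sum_c kron c a * \sum_d kron d b * (A a i * A b j * A c k * A d l)).
    apply: eq_bigr => c _; rewrite mulr_sumr; apply: eq_bigr => d _.
    by rewrite (kronC a) (kronC b).
  by rewrite kron_sum kron_sum; ring.
- rewrite mulr_suml; apply: eq_bigr => a _; rewrite mulr_sumr; apply: eq_bigr => b _.
  transitivity (\sum_c kron c b * \sum_d kron d a * (A a i * A b j * A c k * A d l)).
    apply: eq_bigr => c _; rewrite mulr_sumr; apply: eq_bigr => d _.
    by rewrite mulrCA (kronC a) (kronC b).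
  by rewrite kron_sum kron_sum; ring.
Qed.

Lemma extend_rotE (a i : 'I_7) :
  (extend_rot (ord0 : 'I_8) (ord0 : 'I_8) = 1) * (extend_rot (lift ord0 a) (ord0 : 'I_8) = 0)
  * (extend_rot (ord0 : 'I_8) (lift ord0 i) = 0)
  * (extend_rot (lift ord0 a) (lift ord0 i) = A a i).
Proof.
have E0 : (ord0 : 'I_8) = lshift 7 (ord0 : 'I_1) by exact: val_inj.
have E1 (u : 'I_7) : (lift ord0 u : 'I_8) = rshift 1 u by exact: val_inj.
rewrite (E1 a) (E1 i) E0 /extend_rot block_mxEul block_mxEur block_mxEdl block_mxEdr.
by rewrite !mxE.
Qed.

Lemma extend_rot_orth : extend_rot *m extend_rot^T = 1%:M.
Proof.
rewrite /extend_rot tr_block_mx mulmx_block !trmx0 !(mulmx0, mul0mx, addr0, add0r).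
by rewrite trmx1 mulmx1 AA -scalar_mx_block.
Qed.

Lemma det_extend_rot : \det A = 1 -> \det extend_rot = 1.
Proof. by move=> A1; rewrite /extend_rot det_ublock det1 mul1r. Qed.

(** Contraction of one index with a column of [extend_rot], whose [ord0] column has the single
    nonzero entry 1. *)
Let slot (i : 'I_8) (f : 'I_8 -> R) : R :=
  if unlift ord0 i is Some i' then \sum_a f (lift ord0 a) * A a i' else f ord0.

Let sum_extend_rot (i : 'I_8) f : \sum_(a < 8) f a * extend_rot a i = slot i f.
Proof.
rewrite /slot big_ord_recl; case: (unliftP ord0 i) => [i' ->|->].
  rewrite (extend_rotE i' i').1.2 mulr0 add0r; apply: eq_bigr => a _.
  by rewrite (extend_rotE a i').2.
rewrite (extend_rotE ord0 ord0).1.1.1 mulr1 big1 ?addr0 // => a _.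
by rewrite (extend_rotE a ord0).1.1.2 mulr0.
Qed.

Lemma Phi0_model i j k l :
  \sum_(J : 4.-tuple 'I_8) (Phi0 J)%:~R *
     \prod_(t < 4) extend_rot (tnth J t) (tnth [tuple i; j; k; l] t) =
  slot i (fun a => slot j (fun b => slot k (fun c => slot l (fun d =>
    (Phi0 [:: a; b; c; d])%:~R)))).
Proof.
under eq_bigr do rewrite prod_tnth_zip.
rewrite (sum_tuple4 (fun J => (Phi0 J)%:~R *
  \prod_(t <- zip J [:: i; j; k; l]) extend_rot t.1 t.2)).
rewrite -sum_extend_rot; apply: eq_bigr => a _.
rewrite -sum_extend_rot mulr_suml; apply: eq_bigr => b _.
rewrite -sum_extend_rot !mulr_suml; apply: eq_bigr => c _.
rewrite -sum_extend_rot !mulr_suml; apply: eq_bigr => d _.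
rewrite /= !big_cons big_nil mulr1.
by move: (extend_rot a i) (extend_rot b j) (extend_rot c k) (extend_rot d l) (_%:~R) => *; ring.
Qed.

Lemma slot_Phi0 (V W : normedModType R) (y : V * W) (w' : 'I_7 -> 'I_7 -> 'I_7 -> V -> R)
    (p' : 'I_7 -> 'I_7 -> 'I_7 -> 'I_7 -> V -> R) (i j k l : 'I_8) :
  (forall i j k, w' i j k y.1 = w i j k) ->
  (forall i j k l, p' i j k l y.1 =
     \sum_s w i j s * w k l s - (kron i k * kron j l - kron i l * kron j k)) ->
  spin7 (@pull3 R V W 7 w') (@pull4 R V W 7 p') (fun a => @kron R 8 a ord0) i j k l y =
  slot i (fun a => slot j (fun b => slot k (fun c => slot l (fun d =>
    (Phi0 [:: a; b; c; d])%:~R)))).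
Proof.
move=> wE' pE.
have S0 : slot ord0 = fun f => f ord0.
  by apply/funext => f; rewrite /slot unlift_none.
have SL u : slot (lift ord0 u) = fun f => \sum_a f (lift ord0 a) * A a u.
  by apply/funext => f; rewrite /slot liftK.
have l0 (a : 'I_7) : kron (lift ord0 a) (ord0 : 'I_8) = 0 :> R.
  by rewrite /kron eq_sym (negPf (neq_lift _ _)).
have e0 : kron ord0 (ord0 : 'I_8) = 1 :> R by rewrite /kron eqxx.
have simp := (l0, e0, @pull3_lift R V W 7 w', @pull4_lift R V W 7 p',
  @pull3_0 R V W 7 w', @pull4_0 R V W 7 p', mul0r, mul1r, subr0, add0r, addr0, sub0r, oppr0).
have w3 (F : 'I_7 -> 'I_7 -> 'I_7 -> int) u v z : (forall a b f, F a b f = omega0 [:: a; b; f]) ->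
    \sum_a (\sum_b (\sum_f (F a b f)%:~R * A f z) * A b v) * A a u = w u v z.
  move=> FE; rewrite wE; apply: eq_bigr => a _; rewrite mulr_suml.
  apply: eq_bigr => b _; rewrite !mulr_suml; apply: eq_bigr => f _; rewrite FE.
  by move: (A a u) (A b v) (A f z) (_%:~R) => *; ring.
have w3N (F : 'I_7 -> 'I_7 -> 'I_7 -> int) u v z : (forall a b f, F a b f = - omega0 [:: a; b; f]) ->
    \sum_a (\sum_b (\sum_f (F a b f)%:~R * A f z) * A b v) * A a u = - w u v z.
  move=> FE; rewrite wE -sumrN; apply: eq_bigr => a _; rewrite mulr_suml -sumrN.
  apply: eq_bigr => b _; rewrite !mulr_suml -sumrN; apply: eq_bigr => f _; rewrite FE rmorphN /=.
  by move: (A a u) (A b v) (A f z) (_%:~R) => *; ring.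
case: (unliftP ord0 i) => [i' ->|->]; case: (unliftP ord0 j) => [j' ->|->];
 case: (unliftP ord0 k) => [k' ->|->]; case: (unliftP ord0 l) => [l' ->|->];
 rewrite !(S0, SL) /spin7 !simp;
 try (by rewrite Phi0_00);
 try (by rewrite big1 // => a _; rewrite Phi0_00 mul0r);
 try (by rewrite big1 // => a _; rewrite big1 ?mul0r // => b _; rewrite Phi0_00 mul0r).
- rewrite pE -Phi0_rotate; apply: eq_bigr => a _; rewrite mulr_suml.
  apply: eq_bigr => b _; rewrite !mulr_suml; apply: eq_bigr => c _; rewrite !mulr_suml.
  apply: eq_bigr => d _.
  by move: (A a i') (A b j') (A c k') (A d l') (_%:~R) => *; ring.
- by rewrite wE'; apply/esym/w3N => *; rewrite Phi0_0.
- by rewrite wE'; apply/esym/w3 => *; rewrite Phi0_0.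
- by rewrite wE'; apply/esym/w3N => *; rewrite Phi0_0.
by rewrite wE'; apply/esym/w3 => *; rewrite Phi0_0.
Qed.

End ProductModel.

Lemma product_locally_modelled (R : realType) (r : R) (W : normedModType R) (L : framed W 1) :
  r != 0 -> product_g2_frame r L ->
  locally_modelled_on (pts (prod_framed (sphere7 r) L)) 4 Phi0
    (product_Phi (sphere7_omega r)).
Proof.
move=> r_neq0 G y Dy.
have [U [A [Uo Uy As HA]]] := sphere7_locally_modelled r_neq0 Dy.1.
exists (fst @^-1` U), (fun y => extend_rot (A y.1)); split=> //.
- by apply: open_comp => // z _; exact: continuous_fst.
- move=> i j; case: (unliftP ord0 i) => [i' ->|->]; case: (unliftP ord0 j) => [j' ->|->].
  + have -> : (fun y : 'cV[R]_8 * W => extend_rot (A y.1) (lift ord0 i') (lift ord0 j')) =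
        (fun x => A x i' j') \o fst by apply/funext => z; rewrite (extend_rotE _ i' j').2.
    exact: linear_smooth_comp (@linear_fst _ _ _) (@continuous_fst _ _ _) (As i' j').
  + have -> : (fun y : 'cV[R]_8 * W => extend_rot (A y.1) (lift ord0 i') ord0) = cst 0.
      by apply/funext => z; rewrite (extend_rotE _ i' i').1.1.2.
    exact: smooth_on_cst.
  + have -> : (fun y : 'cV[R]_8 * W => extend_rot (A y.1) ord0 (lift ord0 j')) = cst 0.
      by apply/funext => z; rewrite (extend_rotE _ j' j').1.2.
    exact: smooth_on_cst.
  + have -> : (fun y : 'cV[R]_8 * W => extend_rot (A y.1) ord0 ord0) = cst 1.
      by apply/funext => z; rewrite (extend_rotE _ ord0 ord0).1.1.1.
    exact: smooth_on_cst.
move=> z Dz Uz; have [AA A1 Aw] := HA z.1 Dz.1 Uz.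
split; [exact: extend_rot_orth|exact: det_extend_rot|].
move=> -[[|i [|j [|k [|l []]]]]] //= I4.
have q1 : sq r z.1 = 1 := g2f_q G Dz.
pose w i j k := w7 r i j k z.1.
have wE a b f : w a b f = \sum_i1 \sum_i2 \sum_i3
    (omega0 [:: i1; i2; i3])%:~R * (A z.1 i1 a * A z.1 i2 b * A z.1 i3 f).
  have := Aw [tuple a; b; f]; rewrite /= sphere7_omegaE // q1 mul1r /w => ->.
  exact: (sum_tuple3_prod (fun J => (omega0 J)%:~R)).
rewrite (product_Phi_spin7 r_neq0 G) // (slot_Phi0 AA wE) => [|//|a b f h]; last first.
  by rewrite /w (w7_w7 r) q1 expr1n !mul1r addrK.
rewrite -(Phi0_model _ i j k l); apply: eq_bigr => J _; congr (_ * _).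
by apply: eq_bigr => t _; congr (extend_rot _ _ _); rewrite !(tnth_nth i).
Qed.

(** * Compactness of spheres *)

Section Compactness.
Variable R : realType.

Lemma continuous_sum (V : topologicalType) n (f : 'I_n -> V -> R) :
  (forall i, continuous (f i)) -> continuous (fun x => \sum_i f i x).
Proof.
elim: n f => [|n IH] f fc.
  by under eq_fun do rewrite big_ord0; exact: cst_continuous.
under eq_fun do rewrite big_ord_recl.
by move=> x; apply: cvgD; [exact: fc|apply: IH => i; exact: fc].
Qed.

Lemma compact_sphere n (s : R) : compact [set x : 'cV[R]_n | dot x x = s ^+ 2].
Proof.
(* Heine-Borel is applied to row vectors, and transposition carries the result to columns. *)
pose S := [set u : 'rV[R]_n | \sum_i u 0 i * u 0 i = s ^+ 2].
have -> : [set x : 'cV[R]_n | dot x x = s ^+ 2] = (fun u : 'rV[R]_n => u^T) @` S.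
  apply/seteqP; split=> [x /= xs|x [u us <-]] /=.
    exists x^T; last exact: trmxK.
    by rewrite /S /= -xs dotE; apply: eq_bigr => i _; rewrite !mxE.
  by rewrite dotE -us; apply: eq_bigr => i _; rewrite !mxE.
apply: continuous_compact.
  apply: continuous_subspaceT; apply: mx_continuous => i j.
  under eq_fun do rewrite mxE; exact: coord_continuous.
apply: bounded_closed_compact.
  exists `|s|; split; first exact: num_real.
  move=> M sM u us; apply: le_trans (ltW sM).
  rewrite [leLHS]/Num.norm /= mx_normrE; apply/bigmax_leP; split=> // -[i j] _ /=.
  rewrite (ord1 i) -ler_sqr ?nnegrE // !real_normK ?num_real // -us.
  by rewrite (bigD1 j) //= lerDl sumr_ge0 // => k _; rewrite -expr2 sqr_ge0.
have -> : S = (fun u : 'rV[R]_n => \sum_i u 0 i * u 0 i) @^-1` [set s ^+ 2] by [].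
apply: preimage_closed; last exact: closed_eq.
move=> u _; apply: continuous_sum => i v.
exact: (cvgM (@coord_continuous R 1 n 0 i v) (@coord_continuous R 1 n 0 i v)).
Qed.

End Compactness.

(** * Dilatons on the line and on the circle *)

Section ProductFactors.
Variables (R : realType) (r : R).
Hypothesis r_neq0 : r != 0.
Local Notation e := (fun i : 'I_8 => @kron R 8 i ord0).

Lemma sphere7_fr_linear i : linear (fr (sphere7 r) i).
Proof. by move=> a u z /=; rewrite mulmxDr scalerDr -scalemxAr !scalerA mulrC. Qed.

Lemma dot0l n (u : 'cV[R]_n) : dot 0 u = 0.
Proof. by rewrite /dot trmx0 mul0mx mxE. Qed.

Lemma dot0r n (u : 'cV[R]_n) : dot u 0 = 0.
Proof. by rewrite /dot mulmx0 mxE. Qed.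

Lemma line_g2_frame : product_g2_frame r (line R).
Proof.
apply: (@prod_g2_frame R _ _ 7 (sphere7 r) (line R) _ _ _ _ (sphere7_g2_frame r_neq0)
  sphere7_fr_linear (@dot0l 8) (@dot0r 8) _ (fun=> 0) 1).
- by move=> u /=; rewrite mul0r.
- by move=> a u z; rewrite scaler0 addr0.
- by move=> z; rewrite add0r.
Qed.

Lemma circle_g2_frame (s : R) : product_g2_frame r (circle s).
Proof.
apply: (@prod_g2_frame R _ _ 7 (sphere7 r) (circle s) _ _ _ _ (sphere7_g2_frame r_neq0)
  sphere7_fr_linear (@dot0l 8) (@dot0r 8) (@dot0l 2) (fr (circle s) ord0) 0).
- move=> a u z; apply/colP => i; rewrite !mxE.
  by case: ifP => _; rewrite ?mulrN; ring.
- by move=> z; rewrite addr0.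
Qed.

(** The Lee form 2 c e_0 = - (4/r) e_0 must equal (12/7) dphi, so phi has slope - 7/(3 r) in the
    unit direction e_0. *)
Let k := - (7 / (3 * r)).

Lemma lee8_dilaton (W : normedModType R) (L : framed W 1) (D : set ('cV[R]_8 * W)%type) phi :
  product_g2_frame r L ->
  D `<=` pts (prod_framed (sphere7 r) L) ->
  (forall m y, D y -> 'D_(fr (prod_framed (sphere7 r) L) m y) phi y = k * e m) ->
  form_eq D 1 (lee8 (prod_framed (sphere7 r) L) (product_Phi (sphere7_omega r)))
    (fun I y => 12 / 7 * dfun (prod_framed (sphere7 r) L) phi I y).
Proof.
move=> G DP Dphi y [|i []] // Dy _.
have q1 : sq r y.1 = 1 := g2f_q G (DP _ Dy).
rewrite (lee8_product r_neq0 G) extd1 Dphi // q1 expr1n !mulr1 mul1r /k.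
by move: (kron i ord0) => *; field.
Qed.

Let phi_line (y : 'cV[R]_8 * R) : R := k * y.2.

Lemma linear_phi_line : linear phi_line.
Proof. by move=> a u z; rewrite /phi_line /= mulrDr mulrCA. Qed.

Lemma is_derive_phi_line m y :
  is_derive y (fr (prod_framed (sphere7 r) (line R)) m y) phi_line (k * e m).
Proof.
apply: is_derive_eq (is_derive_linear _ _ linear_phi_line) _; rewrite /phi_line; congr (_ * _).
rewrite /kron; case: (unliftP ord0 m) => [j ->|->] /=; rewrite ?liftK ?unlift_none ?eqxx //.
Qed.

Lemma is_derive_exp_phi_line m y :
  is_derive y (fr (prod_framed (sphere7 r) (line R)) m y)
    (fun y => expR (- 2 * phi_line y)) (- 2 * (k * e m) * expR (- 2 * phi_line y)).
Proof.
have H : is_derive y (fr (prod_framed (sphere7 r) (line R)) m y)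
    (fun y => - 2 * phi_line y) (- 2 * (k * e m)).
  exact: (is_deriveZ (- 2) (is_derive_phi_line m y)).
have dphi : differentiable (fun y => - 2 * phi_line y) y.
  have ls : linear (fun y => - 2 * phi_line y).
    by move=> a u z; rewrite linear_phi_line mulrDr mulrCA.
  have cs : continuous (fun y => - 2 * phi_line y).
    move=> z; apply: cvgM; first exact: cvg_cst.
    by apply: cvgM; [exact: cvg_cst|exact: continuous_snd].
  exact: (smooth_on_linear (U := setT) ls cs [::]).
apply: is_derive_eq (is_derive_comp _ dphi (is_derive_expR _)) _.
by case: H => _ ->; rewrite mulrC.
Qed.

Variable s : R.
Hypothesis s_neq0 : s != 0.
Local Notation C := (prod_framed (sphere7 r) (circle s)).

(** A local angle function on the part of the circle where coordinate a does not vanish, with the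
    scale [t] absorbed. *)
Definition angle (a b : 'I_2) (t : R) (y : 'cV[R]_8 * 'cV[R]_2) : R :=
  t * atan (y.2 b 0 / y.2 a 0).

Lemma smooth_circle_coord (U : set ('cV[R]_8 * 'cV[R]_2)%type) a :
  smooth_on U (fun y => y.2 a 0).
Proof.
apply: smooth_on_linear => [k' u v|]; first by rewrite !mxE.
move=> y; apply: (continuous_comp (f := snd) (g := fun z : 'cV[R]_2 => z a 0)).
  exact: continuous_snd.
exact: coord_continuous.
Qed.

Lemma open_circle_coord a : open [set y : 'cV[R]_8 * 'cV[R]_2 | y.2 a 0 != 0].
Proof.
have -> : [set y : 'cV[R]_8 * 'cV[R]_2 | y.2 a 0 != 0] =
    (fun y : 'cV[R]_8 * 'cV[R]_2 => y.2 a 0) @^-1` [set t | t != 0] by [].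
apply: open_comp; last exact: open_neq.
move=> y _; apply: (continuous_comp (f := snd) (g := fun z : 'cV[R]_2 => z a 0)).
  exact: continuous_snd.
exact: coord_continuous.
Qed.

Lemma smooth_ratio a b :
  smooth_on [set y : 'cV[R]_8 * 'cV[R]_2 | y.2 a 0 != 0] (fun y => y.2 b 0 / y.2 a 0).
Proof.
apply: smooth_onM; [exact: open_circle_coord|exact: smooth_circle_coord|].
by apply: smooth_onV => //; [exact: open_circle_coord|exact: smooth_circle_coord].
Qed.

Lemma smooth_angle a b t :
  smooth_on [set y : 'cV[R]_8 * 'cV[R]_2 | y.2 a 0 != 0] (angle a b t).
Proof.
apply: smooth_onM; [exact: open_circle_coord|exact: smooth_on_cst|].
by apply: smooth_on_atan; [exact: open_circle_coord|exact: smooth_ratio].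
Qed.

(** The factor s converts the angle to arc length, and the sign t records whether the pair of
    coordinates (a, b) is positively oriented with respect to the tangent field. *)
Lemma derive_angle a b (t : R) (y : 'cV[R]_8 * 'cV[R]_2) m : t ^+ 2 = 1 -> y.2 a 0 != 0 ->
  y.2 a 0 ^+ 2 + y.2 b 0 ^+ 2 = s ^+ 2 ->
  fr (circle s) ord0 y.2 a 0 = - (t * y.2 b 0 / s) ->
  fr (circle s) ord0 y.2 b 0 = t * y.2 a 0 / s ->
  'D_(fr C m y) (angle a b (k * s * t)) y = k * e m.
Proof.
move=> t2 ya ab va vb; set v := (fr C m y).2.
have Dx i : is_derive y (fr C m y) (fun y => y.2 i 0) (v i 0).
  have := @is_derive_linear_comp R _ _ _ snd (fun z : 'cV[R]_2 => z i 0) (v i 0) y (fr C m y)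
    (@linear_snd _ _ _).
  by apply; exact: is_derive_coord.
have DV : is_derive y (fr C m y) (fun y => (y.2 a 0)^-1) (- (y.2 a 0) ^- 2 * v a 0).
  case: (Dx a) => dx dxE; apply: DeriveDef; first exact: (derivableV ya dx).
  by rewrite (deriveV ya dx) dxE.
have Dq := is_deriveM (Dx b) DV.
have dq : differentiable (fun y : 'cV[R]_8 * 'cV[R]_2 => y.2 b 0 / y.2 a 0) y.
  exact: (smooth_ratio b [::] ya).
have Da := is_derive_comp (fr C m y) dq (is_derive1_atan _).
have -> : angle a b (k * s * t) = (k * s * t) *:
    (fun y : 'cV[R]_8 * 'cV[R]_2 => atan (y.2 b 0 / y.2 a 0)) by [].
case: (is_deriveZ (k * s * t) Da) => _ ->.
have -> : 'D_(fr C m y) (fun y : 'cV[R]_8 * 'cV[R]_2 => y.2 b 0 / y.2 a 0) y =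
    y.2 b 0 * (- (y.2 a 0) ^- 2 * v a 0) + (y.2 a 0)^-1 * v b 0.
  by case: Dq.
rewrite /GRing.scale /= /v.
case: (unliftP ord0 m) => [j ->|->].
  rewrite prod_fr_lift /= !mxE /kron eq_sym (negPf (neq_lift _ _)).
  by rewrite !mulr0 addr0 !mulr0.
rewrite prod_fr_0 /= -/(fr (circle s) ord0 y.2) va vb /kron eqxx mulr1.
have sab : y.2 a 0 ^+ 2 + y.2 b 0 ^+ 2 != 0 by rewrite ab expf_neq0.
move: (y.2 a 0) (y.2 b 0) ya ab sab t2 => u z u0 uz uz0 t2.
transitivity (k * t ^+ 2 * (u ^+ 2 + z ^+ 2) / (u ^+ 2 + z ^+ 2)).
  by field; rewrite s_neq0 u0 uz0.
by rewrite t2 mulr1 mulfK.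
Qed.

Lemma circle_dilaton x : pts C x ->
  exists (U : set ('cV[R]_8 * 'cV[R]_2)%type) (phi : 'cV[R]_8 * 'cV[R]_2 -> R),
    [/\ open U, U x, smooth_on U phi &
      forall m y, (pts C `&` U) y -> 'D_(fr C m y) phi y = k * e m].
Proof.
have dot2 y : pts C y -> y.2 0 0 ^+ 2 + y.2 1 0 ^+ 2 = s ^+ 2.
  move=> [_ /= <-]; rewrite dotE !big_ord_recl big_ord0 addr0 !expr2.
  by rewrite (_ : (1 : 'I_2) = lift ord0 ord0) //; exact: val_inj.
move=> Px; have [x0|x0] := eqVneq (x.2 0 0) 0; last first.
  exists [set y : 'cV[R]_8 * 'cV[R]_2 | y.2 0 0 != 0], (angle 0 1 (k * s * 1)); split=> //.
  - exact: open_circle_coord.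
  - exact: smooth_angle.
  move=> m y [Py Uy]; apply: derive_angle => //.
  - exact: expr1n.
  - exact: dot2.
  - by rewrite /= !mxE /= mul1r mulrN mulrC.
  - by rewrite /= !mxE /= mul1r mulrC.
(* The second chart exchanges the two coordinates, which reverses the orientation; hence the sign -
   1. *)
exists [set y : 'cV[R]_8 * 'cV[R]_2 | y.2 1 0 != 0], (angle 1 0 (k * s * - 1)); split=> //.
- exact: open_circle_coord.
- apply: contra_eq_neq (dot2 _ Px) => /= ->; rewrite x0 expr0n addr0 eq_sym.
  exact: expf_neq0.
- exact: smooth_angle.
move=> m y [Py Uy]; apply: derive_angle => //.
- by rewrite sqrrN expr1n.
- by rewrite addrC; exact: dot2.
- by rewrite /= !mxE /= mulN1r mulNr opprK mulrC.
- by rewrite /= !mxE /= mulN1r mulrN mulNr mulrC.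
Qed.

End ProductFactors.

(** * Assembly of the three parts of the theorem *)

Lemma sphere7_point (R : realType) (r : R) : pts (sphere7 r) (r *: delta_mx ord0 ord0).
Proof.
rewrite /= dotZl dotC dotZl; suff -> : dot (delta_mx ord0 ord0 : 'cV[R]_8) (delta_mx ord0 ord0) = 1.
  by rewrite mulr1 expr2.
rewrite dotE (bigD1 ord0) //= big1 ?mxE ?mulr1 ?addr0 // => i /negPf i0.
by rewrite mxE i0 mul0r.
Qed.

(** The sum of the squares of the components of w is 42, so they cannot all vanish. *)
Lemma g2_torsion_neq0 (R : realType) (V : normedModType R) n (M : framed V n) D c d w p q y :
  g2_frame M D c d w p q -> c != 0 -> D y -> exists I, size I = 3 /\ g2_torsion c w I y != 0.
Proof.
move=> G c0 Dy; apply: contrapT => H.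
have w0 i j k : w i j k y = 0.
  apply/eqP; apply: contrapT => /negP wn; apply: H; exists [:: i; j; k]; split=> //=.
  by rewrite mulf_neq0 // oppr_eq0 mulf_neq0 // invr_eq0 pnatr_eq0.
have := sum_w (g2f_tensors G y); rewrite (g2f_q G Dy) expr1n mulr1.
rewrite big1 => [/esym/eqP|i _]; first by rewrite pnatr_eq0.
by rewrite big1 // => j _; rewrite big1 // => k _; rewrite w0 mulr0.
Qed.

Theorem theorem6p3 (R : realType) (r s : R) (r_gt0 : 0 < r) (s_gt0 : 0 < s) :
  let S7 := sphere7 r in
  let omega := sphere7_omega r in
  let S7xR := prod_framed S7 (line R) in
  let S7xS1 := prod_framed S7 (circle s) in
  (* the nearly parallel 7-sphere *)
  [/\ locally_modelled_on (pts S7) 3 omega0 omega,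
      (exists2 lambda : R, lambda != 0 &
         form_eq (pts S7) 4 (extd S7 omega)
           (fun I x => - lambda * star 3 omega I x))
    & exists T : dform 'cV[R]_8 7,
        let F := curv S7 (tconn S7 T) in
        [/\ characteristic_torsion S7 (pts S7) 3 omega T,
            (exists eps : 'cV[R]_8 -> 'cV[R]_8,
               [/\ spinor_defines (@gamma7 R) (pts S7) 3 omega eps,
                   gravitino S7 (@gamma7 R) (pts S7) T eps
                 & gaugino (@gamma7 R) (pts S7) F eps]),
            (exists2 alpha : R, alpha < 0 & bianchi1 S7 (pts S7) T F alpha)
          & (exists2 alpha : R, alpha < 0 & bianchi2 S7 (pts S7) T F alpha)]]
  /\
  (* the product with the line *)
  (let M := S7xR in
   let Phi : dform ('cV[R]_8 * R)%type 8 := product_Phi omega in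
   locally_modelled_on (pts M) 4 Phi0 Phi /\
   exists T : dform ('cV[R]_8 * R)%type 8,
     let F := curv M (tconn M T) in
     [/\ characteristic_torsion M (pts M) 4 Phi T,
         (exists x, pts M x /\ exists I, size I = 3%N /\ T I x != 0),
         (exists phi : 'cV[R]_8 * R -> R,
            [/\ smooth_near (pts M) phi,
                form_eq (pts M) 1 (lee8 M Phi)
                  (fun I x => 12 / 7 * dfun M phi I x),
                ~ (exists c : R, forall x, pts M x -> phi x = c),
                (exists eps : 'cV[R]_8 * R -> 'cV[R]_(8 + 8),
                   [/\ spinor_defines (@gamma8 R) (pts M) 4 Phi eps,
                       gravitino M (@gamma8 R) (pts M) T eps,
                       dilatino M (@gamma8 R) (pts M) T phi eps
                     & gaugino (@gamma8 R) (pts M) F eps])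
              & exists2 alpha : R, alpha < 0 &
                  bianchi1 M (pts M) T F alpha /\
                  equations_of_motion M (pts M) T (tconn M T) phi alpha])
       & (exists2 alpha : R, alpha < 0 & bianchi2 M (pts M) T F alpha)])
  /\
  (* the product with the circle *)
  (let M := S7xS1 in
   let Phi : dform ('cV[R]_8 * 'cV[R]_2)%type 8 := product_Phi omega in
   [/\ compact (pts M),
       locally_modelled_on (pts M) 4 Phi0 Phi
     & exists T : dform ('cV[R]_8 * 'cV[R]_2)%type 8,
         let F := curv M (tconn M T) in
         [/\ characteristic_torsion M (pts M) 4 Phi T,
             form_eq (pts M) 2 (extd M (lee8 M Phi)) (fun _ _ => 0),
             (exists eps : 'cV[R]_8 * 'cV[R]_2 -> 'cV[R]_(8 + 8),
                [/\ spinor_defines (@gamma8 R) (pts M) 4 Phi eps,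
                    gravitino M (@gamma8 R) (pts M) T eps,
                    gaugino (@gamma8 R) (pts M) F eps
                  & forall x, pts M x ->
                      exists (U : set ('cV[R]_8 * 'cV[R]_2)%type)
                             (phi : 'cV[R]_8 * 'cV[R]_2 -> R),
                        [/\ open U, U x, smooth_on U phi,
                            form_eq (pts M `&` U) 1 (lee8 M Phi)
                              (fun I y => 12 / 7 * dfun M phi I y)
                          & dilatino M (@gamma8 R) (pts M `&` U) T phi eps]]),
             (exists2 alpha : R, alpha < 0 & bianchi1 M (pts M) T F alpha)
           & (exists2 alpha : R, alpha < 0 & bianchi2 M (pts M) T F alpha)]]).
Proof.
have r0 : r != 0 by rewrite gt_eqF.
have s0 : s != 0 by rewrite gt_eqF.
pose c := - (2 / r).
have c0 : c != 0 by rewrite oppr_eq0 mulf_neq0 ?invr_eq0 ?pnatr_eq0.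
have c2 : 0 < c ^+ 2 by rewrite lt_neqAle eq_sym sqrf_eq0 c0 sqr_ge0.
have a1 : - (3 / (2 * c ^+ 2)) < 0 by rewrite oppr_lt0; apply: divr_gt0 => //; apply: mulr_gt0.
have a2 : - (3 / (10 * c ^+ 2)) < 0 by rewrite oppr_lt0; apply: divr_gt0 => //; apply: mulr_gt0.
have G7 := sphere7_g2_frame r0.
have GR := line_g2_frame r0.
have GS := circle_g2_frame r0 s.
pose k := - (7 / (3 * r)).
split; [split|split].
- exact: sphere7_locally_modelled.
(* By [extd_w3form] with q = 1, d omega is - 2 c = 4/r times its star. *)
- exists (- (4 / r)); first by rewrite oppr_eq0 mulf_neq0 ?invr_eq0 ?pnatr_eq0.
  exact: sphere7_nearly_parallel.
- exists (g2_torsion c (w7 r)); split.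
  + exact: sphere7_characteristic_torsion.
  + exists id; split; [exact: sphere7_spinor_defines|exact: sphere7_gravitino|].
    exact: sphere7_gaugino.
  + by exists (- (3 / (2 * c ^+ 2))) => //; exact: (g2_bianchi1 G7).
  + by exists (- (3 / (10 * c ^+ 2))) => //; exact: (g2_bianchi2 G7).
- split; first exact: (product_locally_modelled r0 GR).
  exists (g2_torsion c (pull3 (w7 r))); split.
  + exact: product_characteristic_torsion.
  + have Px : pts (prod_framed (sphere7 r) (line R)) (r *: delta_mx ord0 ord0, 0).
      by split; first exact: sphere7_point.
    by exists (r *: delta_mx ord0 ord0, 0); split=> //; exact: (g2_torsion_neq0 GR c0 Px).
  + exists (fun y => k * y.2); split.
    * exists setT; split=> //; first exact: openT.
      apply: smooth_on_linear; first exact: linear_phi_line.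
      by move=> y; apply: cvgM; [exact: cvg_cst|exact: continuous_snd].
    * apply: (lee8_dilaton r0 GR) => // m y _.
      by case: (is_derive_phi_line r m y).
    * move=> [t Ht].
      have H1 := Ht (r *: delta_mx ord0 ord0, 1) (conj (sphere7_point r) Logic.I).
      have H0 := Ht (r *: delta_mx ord0 ord0, 0) (conj (sphere7_point r) Logic.I).
      move: H1; rewrite -H0 /= mulr1 mulr0 => /eqP.
      by rewrite /k oppr_eq0 !(mulf_eq0, invr_eq0, pnatr_eq0) (negPf r0).
    * exists (@spinor8 R R); split.
      - exact: product_spinor_defines.
      - exact: product_gravitino.
      - move=> y Dy; apply: product_dilatino => // m.
        by case: (is_derive_phi_line r m y).
      - exact: product_gaugino.
    * exists (- (3 / (2 * c ^+ 2))) => //; split; first exact: (g2_bianchi1 GR).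
      apply: (g2_equations_of_motion GR c0 (is_derive_phi_line r) (is_derive_exp_phi_line r)).
      (* The gradient is along e_0, which the horizontal metric annihilates. *)
      - move=> m i; rewrite /kron; case: (eqVneq m ord0) => [->|_].
          by rewrite horizontal_0 mulr0.
        by rewrite mulr0 mul0r.
      (* The squared slope is 49/(9 r^2), and c^2 = 4/r^2. *)
      - rewrite (bigD1 ord0) //= big1 => [|m /negPf m0].
          by rewrite /kron eqxx addr0 mulr1 /k /c; field.
        by rewrite /kron m0 mulr0 expr0n.
  + by exists (- (3 / (10 * c ^+ 2))) => //; exact: (g2_bianchi2 GR).
- split.
  + apply: compact_setX; exact: compact_sphere.
  + exact: product_locally_modelled.
  exists (g2_torsion c (pull3 (w7 r))); split.
  + exact: product_characteristic_torsion.
  + exact: lee8_product_closed.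
  + exists (@spinor8 R 'cV[R]_2); split.
    * exact: product_spinor_defines.
    * exact: product_gravitino.
    * exact: product_gaugino.
    move=> x Px; have [U [phi [Uo Ux phis Dphi]]] := circle_dilaton s0 Px.
    exists U, phi; split=> //.
    * by apply: (lee8_dilaton r0 GS) => // y [].
    * by move=> y Dy; apply: product_dilatino => //; [case: Dy|move=> m; exact: Dphi].
  + by exists (- (3 / (2 * c ^+ 2))) => //; exact: (g2_bianchi1 GS).
  + by exists (- (3 / (10 * c ^+ 2))) => //; exact: (g2_bianchi2 GS).
Qed.
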